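(* Let $\ell\ge2$ be an integer, let $\frac{\omega}{\ell-\frac12}\le h<\frac{\omega}{\ell-1}$ and let $\Phi=(\varphi_1,\dots,\varphi_{2\ell-1})$ with $\varphi_j\in B_\omega$. Suppose that there exist positive constants $\delta,\gamma,\sigma,\eta$ such that $\delta\le\sum_{j=1}^{2\ell-1}|\widehat{\varphi_j}|^2\le\gamma$ a.e. in $(-\omega,\omega)$, $[J_{\Phi,t_o}]_{2\ell-2}\ge\sigma$ a.e. in $K$, and $|\det J_{\Phi,t_o}|\ge\eta$ a.e. in $K_-\cup K_+$ (i.e. that $E_{\Phi,t_o}$ is a frame for $B_\omega$). Then the Fourier transform of the vector of dual generators $\Phi^*=(\varphi_1^*,\dots,\varphi_{2\ell-1}^* )$ is $$\widehat{\Phi^*}=\begin{cases}(-1)^{\ell+1-k}\,D\ \displaystyle\mathop{\times}_{\substack{j=-\ell-k+1\\ j\ne0}}^{\ell-k-1}\tau_{jh}\overline{\widehat\Phi} & \text{in } K_-+kh,\ \ -(\ell-1)\le k\le\ell-1,\\[3mm] -E\ \displaystyle\mathop{\times}_{j=-\ell-k+1}^{\ell-k-2}\tau_{jh}\overline{\widehat\Phi}\ \big\langle\overline{\widehat\Phi}\leftarrow\tau_{-kh}W\big\rangle & \text{in } K+kh,\ \ -(\ell-1)\le k\le\ell-2,\\[3mm] (-1)^{\ell+k}\,D\ \displaystyle\mathop{\times}_{\substack{j=-\ell-k\\ j\neq0}}^{\ell-2-k}\tau_{jh}\overline{\widehat\Phi} & \text{in } K_++kh,\ \ -\ell\le k\le\ell-2,\end{cases}$$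 where $W=\mathop{\times}_{j=-\ell+1}^{\ell-2}\tau_{jh}\widehat\Phi$, $E=h^{2\ell-3}(\det\mathbb J_{\Phi,t_o}\mathbb J_{\Phi,t_o}^* )^{-1}$ and $D=h^{\ell-\frac32}(\det J_{\Phi,t_o}^* )^{-1}$.
   Context: Conventions: $\hat f(\xi)=\frac{1}{\sqrt{2\pi}}\int f(t)e^{-it\xi}\,dt$ (extended to $L^2(\mathbb R)$); $\tau_a f(x)=f(x+a)$, applied componentwise to vectors; bar denotes complex conjugation. Fix $\omega>0$ and $B_\omega=\{f\in L^2(\mathbb R):\operatorname{supp}\hat f\subset[-\omega,\omega]\}$; $t_o>0$ and $h=2\pi/t_o$. $N=2\ell-1$ and $\widehat\Phi=(\widehat{\varphi_1},\dots,\widehat{\varphi_N})$. Cross product: for an ordered $(N-1)$-tuple $U_1,\dots,U_{N-1}\in\mathbb C^N$, $\mathop{\times}_{j=1}^{N-1}U_j=U_1\times\cdots\times U_{N-1}\in\mathbb C^N$ is the formal determinant of the $N\times N$ matrix with first row $(\mathbf e_1,\dots,\mathbf e_N)$ (canonical basis) and following rows $U_1,\dots,U_{N-1}$ (no conjugation). For indexed families the factors are taken in increasing order of $j$. $\mathop{\times}_jU_j\langle U_k\leftarrow V\rangle$ denotes the cross product of the tuple obtained by replacing $U_k$ by $V$ in its place; in the formula $\langle\overline{\widehat\Phi}\leftarrow\tau_{-kh}W\rangle$ means that the factor with $j=0$ is replaced by $\tau_{-kh}W$. $E_{\Phi,t_o}=\{\tau_{nt_o}\varphi_j:n\in\mathbb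 Z,\ 1\le j\le N\}$ is a frame for $B_\omega$ if there are $0<A\le B$ with $A\|f\|^2\le\sum_j\sum_n|\langle f,\tau_{nt_o}\varphi_j\rangle|^2\le B\|f\|^2$ for all $f\in B_\omega$. In that case the frame operator $Sf=\sum_j\sum_n\langle f,\tau_{nt_o}\varphi_j\rangle\tau_{nt_o}\varphi_j$ is invertible on $B_\omega$, and the dual generators are $\varphi_j^*=S^{-1}\varphi_j$. Intervals: $K_-=(0,\omega-(\ell-1)h)$, $K=(\omega-(\ell-1)h,-\omega+\ell h)$, $K_+=(-\omega+\ell h,h)$; $K+kh=\{x+kh:x\in K\}$, etc. The pre-Gramian $J_{\Phi,t_o}$ is the $h$-periodic $N\times N$ matrix-valued function whose rows are $\sqrt h\,\tau_{jh}\widehat\Phi$, in increasing order of $j$, with $j=-(\ell-1),\dots,\ell-1$ on $K_-\cup K$ (the last row is zero on $K$) and $j=-\ell,\dots,\ell-2$ on $K_+$. On $K$ (and translates by multiples of $h$), $\mathbb J_{\Phi,t_o}$ is the $(N-1)\times N$ matrix obtained by deleting the zero row. $^*$ on a matrix denotes conjugate transpose. Thus $D$ (on $K_-\cup K_+$ and translates) and $E$ (on $K$ and translates) are $h$-periodic functions. $[J]_n$ denotes the sum of the squares of the absolute values of the minors of order $n$ of $J$. Equalities hold almost everywhere. *)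

(* Defs.v *)
From HB Require Import structures.
From mathcomp Require Import all_boot all_order all_algebra.
From mathcomp Require Import complex.
From mathcomp Require Import all_classical all_reals all_analysis.
Import Order.TTheory GRing.Theory Num.Theory.
Import numFieldNormedType.Exports.

Set Implicit Arguments.
Unset Strict Implicit.
Unset Printing Implicit Defensive.

Local Open Scope classical_set_scope.
Local Open Scope ring_scope.
Local Open Scope complex_scope.

Section L2Fourier.
Variable R : realType.
Local Notation mu := (@lebesgue_measure R).
Local Notation Re := (@complex.Re R).
Local Notation Im := (@complex.Im R).
Implicit Types (f g F : R -> R[i]) (a omega : R).

Definition cabs (z : R[i]) : R := Normc.normc z.

Definition cintegral f : R[i] :=
  (\int[mu]_x Re (f x)) +i* (\int[mu]_x Im (f x)).

(* An element of L^2(R) is represented by a function; equality in L^2(R) is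
   almost everywhere equality. *)
Definition sqnormL2 f : \bar R := (\int[mu]_x ((cabs (f x)) ^+ 2)%:E)%E.

Definition L2 f : Prop :=
  [/\ measurable_fun setT (Re \o f),
      measurable_fun setT (Im \o f) & (sqnormL2 f < +oo)%E].

Definition innerL2 f g : R[i] := cintegral (fun x => f x * conjc (g x)).

Definition tau (V : Type) a (f : R -> V) : R -> V := fun x => f (x + a).

Definition cis (x : R) : R[i] := cos x +i* sin x.

Definition fourierL1 f : R -> R[i] := fun xi =>
  ((Num.sqrt (2 * pi))^-1)%:C * cintegral (fun t => f t * cis (- (t * xi))).

Definition truncate (n : nat) f : R -> R[i] :=
  fun x => if `|x| <= n%:R then f x else 0.

(* The extension of the Fourier transform to L^2(R): the transforms of the
   truncations of f, which are in L^1(R), converge to F in L^2(R). *)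
Definition is_fourierL2 f F : Prop :=
  L2 F /\
  (fun n : nat => sqnormL2 (fun xi => fourierL1 (truncate n f) xi - F xi))
    @ \oo --> 0%E.

(* A representative of the transform, which is unique almost everywhere. *)
Definition fourier f : R -> R[i] :=
  xget (fun _ => 0) [set F | is_fourierL2 f F].

(* The second condition holds for all f in L^2(R), by Plancherel's theorem. *)
Definition bandlimited omega f : Prop :=
  [/\ L2 f, is_fourierL2 f (fourier f) &
      {ae mu, forall x, ~ (`[- omega, omega]%classic x) -> fourier f x = 0}].

Section Frames.
Variable N : nat.
Implicit Types Phi : 'I_N -> R -> R[i].

Definition is_frame omega (t0 : R) Phi : Prop :=
  exists A B : R, [/\ 0 < A, A <= B &
    forall f, bandlimited omega f ->
      let s := (\sum_(j < N) \esum_(n in [set: int])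
          ((cabs (innerL2 f (tau (n%:~R * t0) (Phi j)))) ^+ 2)%:E)%E in
      (A%:E * sqnormL2 f <= s)%E /\ (s <= B%:E * sqnormL2 f)%E].

(* The sum over |n| <= M; M + M + 1 integers starting from - M. *)
Definition frame_partial_sum (t0 : R) Phi (M : nat) f : R -> R[i] := fun x =>
  \sum_(j < N) \sum_(i < (M + M).+1)
    let e := tau ((i%:Z - M%:Z)%:~R * t0) (Phi j) in innerL2 f e * e x.

(* g = S f, the series defining the frame operator converging in L^2(R). *)
Definition frame_operator (t0 : R) Phi f g : Prop :=
  (fun M : nat => sqnormL2 (fun x => frame_partial_sum t0 Phi M f x - g x))
    @ \oo --> 0%E.

(* Phis j = S^-1 (Phi j), S being regarded as an operator on B_omega. *)
Definition dual_generators omega (t0 : R) Phi (Phis : 'I_N -> R -> R[i]) : Prop :=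
  forall j, bandlimited omega (Phis j) /\
            frame_operator t0 Phi (Phis j) (Phi j).

Definition fourierv Phi : R -> 'rV[R[i]]_N :=
  fun x => \row_j fourier (Phi j) x.

End Frames.
End L2Fourier.

Section CrossProduct.
Variable (R : realType).

Definition mx_conjc (m n : nat) (A : 'M[R[i]]_(m, n)) := map_mx conjc A.

Definition mx_adjoint (m n : nat) (A : 'M[R[i]]_(m, n)) : 'M[R[i]]_(n, m) :=
  (mx_conjc A)^T.

(* The i-th component is the coefficient of e_i in the formal determinant. *)
Definition cross (n : nat) (U : 'I_n -> 'rV[R[i]]_n.+1) : 'rV[R[i]]_n.+1 :=
  \row_i \det (col_mx (delta_mx 0 i : 'rV_(1 + n)) (\matrix_(r < n) U r)).

(* The cross product of the factors listed in s, which has to be of size n. *)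
Definition cross_seq (n : nat) (s : seq 'rV[R[i]]_n.+1) : 'rV[R[i]]_n.+1 :=
  cross (fun r : 'I_n => s`_r).

(* The integers a, a + 1, ..., b, in increasing order. *)
Definition zrange (a b : int) : seq int :=
  if (a <= b)%R then [seq a + i%:Z | i <- iota 0 (absz (b - a)).+1] else [::].

Definition increasing (n m : nat) (f : {ffun 'I_n -> 'I_m}) : bool :=
  [forall i : 'I_n, forall j : 'I_n, (i < j)%N ==> (f i < f j)%N].

Definition sum_sq_minors (p n m : nat) (A : 'M[R[i]]_(n, m)) : R :=
  \sum_(f : {ffun 'I_p -> 'I_n} | increasing f)
    \sum_(g : {ffun 'I_p -> 'I_m} | increasing g)
      (cabs (\det (mxsub f g A))) ^+ 2.

End CrossProduct.

Arguments cross_seq {R} n s.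
Arguments sum_sq_minors {R} p {n m} A.

Section PreGramian.
Variables (R : realType) (l : nat) (omega h : R).

Definition Kminus : set R := `]0, omega - (l%:R - 1) * h[%classic.
Definition Kzero : set R :=
  `]omega - (l%:R - 1) * h, - omega + l%:R * h[%classic.
Definition Kplus : set R := `]- omega + l%:R * h, h[%classic.

Definition shift_set (A : set R) (a : R) : set R := [set x + a | x in A].

(* The point of [0, h[ congruent to x modulo h. *)
Definition reduce_mod (x : R) : R := x - (Num.floor (x / h))%:~R * h.

Definition first_index (y : R) : int :=
  if y \in Kplus then - l%:Z else - (l%:Z - 1).

(* F is the vector of the Fourier transforms of the generators; n.+1 = 2l - 1.
   Since F vanishes almost everywhere outside [-omega, omega], so does the last
   row (j = l - 1) on K. *)
Definition preGramian (n : nat) (F : R -> 'rV[R[i]]_n.+1) (x : R)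
    : 'M[R[i]]_n.+1 :=
  let y := reduce_mod x in
  \matrix_(r < n.+1)
    ((Num.sqrt h)%:C *: tau ((first_index y + r%:Z)%:~R * h) F y).

(* The pre-Gramian without its last row, to be used on the translates of K. *)
Definition preGramian_red (n : nat) (F : R -> 'rV[R[i]]_n.+1) (x : R)
    : 'M[R[i]]_(n, n.+1) :=
  row' ord_max (preGramian F x).

Definition dual_coefD (n : nat) (F : R -> 'rV[R[i]]_n.+1) (x : R) : R[i] :=
  (h `^ (l%:R - 3 / 2))%:C * (\det (mx_adjoint (preGramian F x)))^-1.

Definition dual_coefE (n : nat) (F : R -> 'rV[R[i]]_n.+1) (x : R) : R[i] :=
  (h ^+ (2 * l - 3))%:C *
  (\det (preGramian_red F x *m mx_adjoint (preGramian_red F x)))^-1.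

End PreGramian.

(* Main.v *)
(** Translations by multiples of t0 become, in the frequency variable, matrix
    algebra over the lattice h Z.  By Parseval's identity on (0, h), the inner
    products of f with the translates of phi_j are the Fourier coefficients of
    the h-periodization of f^ conj(phi_j^).  Hence, if A is the matrix of the
    phi_j^(y + k h), with a row for each k such that y + k h lies in the band,
    the frame operator acts on the column of the f^(y + k h) as h A A^*, and the
    matrix B of the phi*_j^(y + k h) is determined by h A A^* B = A.  It also
    satisfies h B A^* = 1, which bounds f by its frame coefficients.

    On K_- and K_+ the matrix A is square, so that the entries of B are cofactors
    of conj A, i.e. entries of cross products of its rows.  On K there is one row
    less than there are columns, and the rows of A are orthogonal to their cross
    product w.  The rows of B are then the cross products of the rows of conj A
    in which one factor is replaced by w: they are orthogonal to w, and dual to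
    the rows of conj A up to the factor |w|^2 = det A A^*, which is bounded
    below because it controls all the minors of the pre-Gramian.

    Plancherel's theorem for a compactly supported u is obtained by integrating
    Parseval's identity for the functions u(t) exp(-i t xi) over one period in
    xi; it implies that a band-limited f is a.e. the inverse transform, an
    absolutely convergent integral, of its transform. *)
Require Import Defs.
From HB Require Import structures.
From mathcomp Require Import all_boot all_order all_algebra.
From mathcomp Require Import perm complex.
From mathcomp Require Import all_classical all_reals all_analysis.
From mathcomp Require Import ring lra zify.
Import measurable_realfun.
Import Order.TTheory GRing.Theory Num.Theory.
Import numFieldNormedType.Exports.
Import HBSimple HBNNSimple.

Set Implicit Arguments.
Unset Strict Implicit.
Unset Printing Implicit Defensive.

Local Open Scope classical_set_scope.
Local Open Scope ring_scope.
Local Open Scope complex_scope.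

(** * Square integrable complex functions *)

Section ComplexL2.
Variable R : realType.
Local Notation mu := (@lebesgue_measure R).
Local Notation Re := (@complex.Re R).
Local Notation Im := (@complex.Im R).
Local Notation C := (R[i]).
Implicit Types (f g u v : R -> C) (z w : C) (D : set R).

(** [fourier] is only a chosen representative, so what is known of the transforms holds almost
    everywhere. The generators and the candidate duals are therefore clipped, so that bounds and
    supports hold at every point, and null sets are made invariant under h Z, since one value of the
    matrix A involves a whole coset y + h Z. Invertibility of S is not given beforehand. The matrix
    B is written down explicitly: h B A^* = 1 alone yields the lower frame bound and the injectivity
    of h A A^*, while h A A^* B = A says that S maps the function with matrix B to the generator.
    Every family of dual generators is then identified with B. Only squared norms are used, with |z
    + w|^2 <= 2 |z|^2 + 2 |w|^2 for the triangle inequality; this is enough because all limits in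
    L^2 are limits to 0. Completeness of the exponentials is proved from indicators of rays upwards.
    The powers of h in D and E come from the factor sqrt h in each row of the pre-Gramian: the
    determinants carry h^(l - 1/2) and h^(2l - 2), and one factor 1/h must be left over, as h B A^*
    = 1 requires. *)

Lemma aeS (P Q : R -> Prop) : (forall x, P x -> Q x) ->
  {ae mu, forall x, P x} -> {ae mu, forall x, Q x}.
Proof. by move=> PQ PP; apply: (@filterS _ _ (ae_filter_ringOfSetsType mu) _ _ _ PP) => x; exact: PQ. Qed.

Lemma aeS2 (P Q S : R -> Prop) : (forall x, P x -> Q x -> S x) ->
  {ae mu, forall x, P x} -> {ae mu, forall x, Q x} -> {ae mu, forall x, S x}.
Proof. by move=> PQ PP QQ; apply: (@filterS2 _ _ (ae_filter_ringOfSetsType mu) _ _ _ _ PP QQ) => x; exact: PQ. Qed.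

(** The squared modulus is multiplicative and a polynomial in the real and imaginary parts, so that
    estimates become polynomial inequalities between reals. *)
Definition sq z : R := cabs z ^+ 2.

Lemma sqE z : sq z = Re z ^+ 2 + Im z ^+ 2.
Proof. by case: z => a b; rewrite /sq /cabs /= sqr_sqrtr// addr_ge0// sqr_ge0. Qed.

Lemma sq_ge0 z : 0 <= sq z. Proof. exact: sqr_ge0. Qed.

Lemma sq0 : sq 0 = 0. Proof. by rewrite sqE /= expr0n/= addr0. Qed.

Lemma sq_eq0 z : sq z = 0 -> z = 0.
Proof. by move=> /eqP; rewrite expf_eq0/= => /eqP /Normc.eq0_normc. Qed.

Lemma sqM z w : sq (z * w) = sq z * sq w.
Proof. by rewrite /sq /cabs Normc.normcM exprMn. Qed.

Lemma sqV z : sq z^-1 = (sq z)^-1.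
Proof. by rewrite /sq /cabs Normc.normcV exprVn. Qed.

Lemma sqN z : sq (- z) = sq z.
Proof. by rewrite !sqE; case: z => a b /=; rewrite !sqrrN. Qed.

Lemma sqJ z : sq (conjc z) = sq z.
Proof. by rewrite !sqE; case: z => a b /=; rewrite !sqrrN. Qed.

Lemma sq_real (r : R) : sq r%:C = r ^+ 2.
Proof. by rewrite sqE /= expr0n/= addr0. Qed.

Lemma conjcD z w : conjc (z + w) = conjc z + conjc w.
Proof. exact: rmorphD. Qed.

Lemma conjcM z w : conjc (z * w) = conjc z * conjc w.
Proof. exact: rmorphM. Qed.

Lemma conjc_sum I (s : seq I) (P : pred I) (F : I -> C) :
  conjc (\sum_(i <- s | P i) F i) = \sum_(i <- s | P i) conjc (F i).
Proof. exact: rmorph_sum. Qed.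

Lemma mulconjc_sq z : z * conjc z = (sq z)%:C.
Proof.
rewrite sqE; case: z => a b; apply/eqP; rewrite eq_complex /=.
by apply/andP; split; apply/eqP; ring.
Qed.

Lemma sqD_le z w : sq (z + w) <= 2 * sq z + 2 * sq w.
Proof.
rewrite !sqE; case: z w => a b [c d] /=.
rewrite -subr_ge0 (_ : _ - _ = (a - c) ^+ 2 + (b - d) ^+ 2); last by ring.
by rewrite addr_ge0 ?sqr_ge0.
Qed.

(** Cauchy-Schwarz against the vector (1, ..., 1), applied to the real and imaginary parts. *)
Lemma sq_sum_le n (a : 'I_n -> C) :
  sq (\sum_i a i) <= n%:R * \sum_i sq (a i).
Proof.
suff H (b : 'I_n -> R) : (\sum_i b i) ^+ 2 <= n%:R * \sum_i b i ^+ 2.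
  rewrite sqE (raddf_sum Re) (raddf_sum Im).
  apply: le_trans (lerD (H _) (H _)) _.
  rewrite -mulrDr -big_split /=; apply: ler_wpM2l => //.
  by apply: ler_sum => i _; rewrite sqE.
elim: n b {a} => [|n IH] b; first by rewrite !big_ord0 expr0n/= mulr0.
rewrite !big_ord_recl /=; set s := \sum_(i < n) _; set t := \sum_(i < n) _.
have h1 : s ^+ 2 <= n%:R * t by apply: IH.
(* The cross terms of the new square: 2 b_0 b_i <= b_0^2 + b_i^2, summed over i. *)
have h2 : 2 * b ord0 * s <= n%:R * b ord0 ^+ 2 + t.
  rewrite /s /t mulr_sumr.
  rewrite (_ : n%:R * _ = \sum_(i < n) b ord0 ^+ 2); last first.
    by rewrite sumr_const card_ord mulr_natl.
  rewrite -big_split /=; apply: ler_sum => i _.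
  rewrite -subr_ge0 (_ : _ - _ = (b ord0 - b (lift ord0 i)) ^+ 2); last by ring.
  exact: sqr_ge0.
rewrite -natr1; nra.
Qed.

Definition cmeas f := measurable_fun setT (Re \o f) /\ measurable_fun setT (Im \o f).

Lemma cmeas_cst z : cmeas (fun=> z). Proof. by split; exact: measurable_cst. Qed.

Lemma cmeasD f g : cmeas f -> cmeas g -> cmeas (fun x => f x + g x).
Proof.
move=> [f1 f2] [g1 g2]; split.
- rewrite (_ : _ \o _ = (Re \o f) \+ (Re \o g)); first exact: measurable_funD.
  by apply/funext => x /=; case: (f x) (g x) => ? ? [].
- rewrite (_ : _ \o _ = (Im \o f) \+ (Im \o g)); first exact: measurable_funD.
  by apply/funext => x /=; case: (f x) (g x) => ? ? [].
Qed.

Lemma cmeasM f g : cmeas f -> cmeas g -> cmeas (fun x => f x * g x).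
Proof.
move=> [f1 f2] [g1 g2]; split.
- rewrite (_ : _ \o _ = ((Re \o f) \* (Re \o g)) \- ((Im \o f) \* (Im \o g))).
    by apply: measurable_funB; exact: measurable_funM.
  by apply/funext => x /=; case: (f x) (g x) => ? ? [].
- rewrite (_ : _ \o _ = ((Re \o f) \* (Im \o g)) \+ ((Im \o f) \* (Re \o g))).
    by apply: measurable_funD; exact: measurable_funM.
  by apply/funext => x /=; case: (f x) (g x) => ? ? [].
Qed.

Lemma cmeasN f : cmeas f -> cmeas (fun x => - f x).
Proof.
move=> mf; rewrite (_ : (fun _ => _) = (fun x => -1 * f x)).
  by apply: cmeasM => //; exact: cmeas_cst.
by apply/funext => x; rewrite mulN1r.
Qed.

Lemma cmeasB f g : cmeas f -> cmeas g -> cmeas (fun x => f x - g x).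
Proof. by move=> mf mg; apply: cmeasD => //; exact: cmeasN. Qed.

Lemma cmeasJ f : cmeas f -> cmeas (fun x => conjc (f x)).
Proof.
move=> [f1 f2]; split.
- by rewrite (_ : _ \o _ = Re \o f)//; apply/funext => x /=; case: (f x).
- rewrite (_ : _ \o _ = \- (Im \o f)); first exact: measurable_funN.
  by apply/funext => x /=; case: (f x).
Qed.

Lemma cmeas_real (r : R -> R) : measurable_fun setT r -> cmeas (fun x => (r x)%:C).
Proof. by move=> mr; split => //=; exact: measurable_cst. Qed.

Lemma cmeas_sum I (s : seq I) (P : pred I) (F : I -> R -> C) :
  (forall i, cmeas (F i)) -> cmeas (fun x => \sum_(i <- s | P i) F i x).
Proof.
move=> mF; elim: s => [|i s IH].
  by under eq_fun do rewrite big_nil; exact: cmeas_cst.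
under eq_fun do rewrite big_cons; case: (P i) => //.
exact: cmeasD.
Qed.

Lemma cmeas_prod I (s : seq I) (P : pred I) (F : I -> R -> C) :
  (forall i, cmeas (F i)) -> cmeas (fun x => \prod_(i <- s | P i) F i x).
Proof.
move=> mF; elim: s => [|i s IH].
  by under eq_fun do rewrite big_nil; exact: cmeas_cst.
under eq_fun do rewrite big_cons; case: (P i) => //.
exact: cmeasM.
Qed.

Lemma cmeas_det n (A : R -> 'M[C]_n) :
  (forall i j, cmeas (fun x => A x i j)) -> cmeas (fun x => \det (A x)).
Proof.
move=> mA; apply: cmeas_sum => s; apply: cmeasM; first exact: cmeas_cst.
by apply: cmeas_prod => i.
Qed.

Lemma measurable_sq f : cmeas f -> measurable_fun setT (fun x => sq (f x)).
Proof.
move=> [f1 f2]; under eq_fun do rewrite sqE.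
by apply: measurable_funD; exact: measurable_funX.
Qed.

(** The inverse is conj f times a real power of |f|^2, and real powers are measurable; where f
    vanishes both expressions are 0. *)
Lemma cmeasV f : cmeas f -> cmeas (fun x => (f x)^-1).
Proof.
move=> mf; rewrite (_ : (fun _ => _) =
    (fun x => conjc (f x) * (sq (f x) `^ (-1))%:C)).
  apply: cmeasM; [exact: cmeasJ|apply: cmeas_real].
  apply: (@measurableT_comp _ _ _ _ _ _ (@powR R ^~ (-1))).
    exact: measurable_powR.
  exact: measurable_sq.
apply/funext => x; rewrite powR_inv1 ?sq_ge0//.
have [->|f0] := eqVneq (f x) 0; first by rewrite sq0 !invr0 rmorph0 mulr0.
apply: (mulfI f0); rewrite mulrA mulconjc_sq divff// -rmorphM/= divff//.
by apply: contra f0 => /eqP/sq_eq0 ->.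
Qed.

Lemma cmeas_comp f (k : R -> R) :
  cmeas f -> measurable_fun setT k -> cmeas (fun x => f (k x)).
Proof.
move=> [f1 f2] mk; split.
- exact: (@measurableT_comp _ _ _ _ _ _ (Re \o f) _ k).
- exact: (@measurableT_comp _ _ _ _ _ _ (Im \o f) _ k).
Qed.

Lemma cmeas_if (b : R -> bool) f g : measurable_fun setT b ->
  cmeas f -> cmeas g -> cmeas (fun x => if b x then f x else g x).
Proof.
move=> mb [f1 f2] [g1 g2]; split.
- rewrite (_ : _ \o _ = (fun x => if b x then (Re \o f) x else (Re \o g) x)).
    exact: measurable_fun_ifT.
  by apply/funext => x /=; case: ifP.
- rewrite (_ : _ \o _ = (fun x => if b x then (Im \o f) x else (Im \o g) x)).
    exact: measurable_fun_ifT.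
  by apply/funext => x /=; case: ifP.
Qed.

Lemma continuous_cmeas f : continuous (Re \o f) -> continuous (Im \o f) -> cmeas f.
Proof. by move=> c1 c2; split; apply: continuous_measurable_fun. Qed.

(** * Complex integrals over a set *)

Definition CInt D f := mu.-integrable D (EFin \o (Re \o f)) /\
                       mu.-integrable D (EFin \o (Im \o f)).

Definition cint D f : C :=
  (\int[mu]_(x in D) Re (f x)) +i* (\int[mu]_(x in D) Im (f x)).

Lemma cintD D f g : measurable D -> CInt D f -> CInt D g ->
  cint D (fun x => f x + g x) = cint D f + cint D g.
Proof.
move=> mD [f1 f2] [g1 g2]; apply/eqP; rewrite eq_complex /= -!RintegralD//.
by apply/andP; split; apply/eqP; apply: eq_Rintegral => x _;
  case: (f x) (g x) => ? ? [].
Qed.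

Lemma CIntZ D z f : measurable D -> CInt D f -> CInt D (fun x => z * f x).
Proof.
move=> mD [f1 f2]; case: z => a b; split.
- rewrite (_ : _ \o _ = (fun x => a%:E * (EFin \o (Re \o f)) x) \-
                        (fun x => b%:E * (EFin \o (Im \o f)) x))%E.
    by apply: integrableB => //; exact: integrableZl.
  by apply/funext => x /=; case: (f x).
- rewrite (_ : _ \o _ = (fun x => a%:E * (EFin \o (Im \o f)) x) \+
                        (fun x => b%:E * (EFin \o (Re \o f)) x))%E.
    by apply: integrableD => //; exact: integrableZl.
  by apply/funext => x /=; case: (f x).
Qed.

Lemma integrable_mulE D (a : R) (p : R -> R) : measurable D ->
  mu.-integrable D (EFin \o p) -> mu.-integrable D (EFin \o (fun x => a * p x)).
Proof.
move=> mD ip; rewrite (_ : _ \o _ = (fun x => a%:E * (EFin \o p) x)%E)//.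
exact: integrableZl.
Qed.

Lemma cintZ D z f : measurable D -> CInt D f ->
  cint D (fun x => z * f x) = z * cint D f.
Proof.
move=> mD [f1 f2]; case: z => a b; apply/eqP; rewrite eq_complex /=.
rewrite -!RintegralZl// -RintegralB//; try exact: integrable_mulE.
rewrite -RintegralD//; try exact: integrable_mulE.
by apply/andP; split; apply/eqP; apply: eq_Rintegral => x _; case: (f x).
Qed.

Lemma cintJ D f : measurable D -> CInt D f ->
  cint D (fun x => conjc (f x)) = conjc (cint D f).
Proof.
move=> mD [f1 f2]; apply/eqP; rewrite eq_complex /=.
apply/andP; split; apply/eqP.
- by apply: eq_Rintegral => x _; case: (f x).
- rewrite -mulN1r -RintegralZl//; apply: eq_Rintegral => x _; case: (f x) => a b /=.
  by rewrite mulN1r.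
Qed.

Lemma cint0 D : cint D (fun=> 0) = 0.
Proof.
apply/eqP; rewrite eq_complex /=; apply/andP.
by split; rewrite /Rintegral integral0.
Qed.

Lemma eq_cint D f g : (forall x, D x -> f x = g x) -> cint D f = cint D g.
Proof.
move=> fg; rewrite /cint; congr (_ +i* _); apply: eq_Rintegral => x /set_mem Dx;
  by rewrite fg.
Qed.

Lemma ae_eq_cint D f g : measurable D -> cmeas f -> cmeas g ->
  {ae mu, forall x, D x -> f x = g x} -> cint D f = cint D g.
Proof.
move=> mD [f1 f2] [g1 g2] fg.
rewrite /cint; congr (_ +i* _); rewrite /Rintegral; congr fine;
  apply: ae_eq_integral => //; try (by apply/measurable_EFinP; exact: measurable_funTS);
  by apply: aeS fg => x /[apply] ->.
Qed.

Lemma cint_mkcond D f : cint D f = cint setT (fun x => if x \in D then f x else 0).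
Proof.
rewrite /cint; congr (_ +i* _); rewrite Rintegral_mkcond; apply: eq_Rintegral => x _;
  by rewrite patchE; case: ifP.
Qed.

(** * Squared L^2 norms as extended reals *)

Definition sqn D f : \bar R := (\int[mu]_(x in D) (sq (f x))%:E)%E.

Lemma sqnormE f : sqnormL2 f = sqn setT f. Proof. by []. Qed.

Lemma sqn_ge0 D f : (0 <= sqn D f)%E.
Proof. by apply: integral_ge0 => x _; rewrite lee_fin sq_ge0. Qed.

Definition L2D D f := cmeas f /\ (sqn D f < +oo)%E.

Lemma L2E f : L2 f <-> L2D setT f.
Proof. by split => [[? ? ?]|[[? ?] ?]]; split. Qed.

Lemma measurable_Esq D f : cmeas f -> measurable_fun D (fun x => (sq (f x))%:E).
Proof. by move=> mf; apply/measurable_EFinP; apply: measurable_funTS; exact: measurable_sq. Qed.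

Lemma eq_sqn D f g : (forall x, D x -> sq (f x) = sq (g x)) -> sqn D f = sqn D g.
Proof. by move=> fg; apply: eq_integral => x /set_mem Dx; rewrite fg. Qed.

Lemma ae_eq_sqn D f g : measurable D -> cmeas f -> cmeas g ->
  {ae mu, forall x, D x -> f x = g x} -> sqn D f = sqn D g.
Proof.
move=> mD mf mg fg; apply: ae_eq_integral => //; try exact: measurable_Esq.
by apply: aeS fg => x /[apply] ->.
Qed.

Lemma le_sqn D f g : measurable D -> cmeas f -> cmeas g ->
  {ae mu, forall x, D x -> sq (f x) <= sq (g x)} -> (sqn D f <= sqn D g)%E.
Proof.
move=> mD mf mg fg; apply: ae_ge0_le_integral => //;
  try exact: measurable_Esq; try by move=> x _; rewrite lee_fin sq_ge0.
Qed.

Lemma sqn_mkcond D f : sqn D f = sqn setT (fun x => if x \in D then f x else 0).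
Proof.
rewrite /sqn integral_mkcond; apply: eq_integral => x _; rewrite patchE.
by case: ifP; rewrite ?sq0.
Qed.

Lemma sqnZ D z f : measurable D -> cmeas f ->
  sqn D (fun x => z * f x) = ((sq z)%:E * sqn D f)%E.
Proof.
move=> mD mf; rewrite /sqn -ge0_integralZl//; first last.
- by rewrite lee_fin sq_ge0.
- by move=> x _; rewrite lee_fin sq_ge0.
- exact: measurable_Esq.
- by apply: eq_integral => x _; rewrite sqM EFinM.
Qed.

Lemma sqnD_le D f g : measurable D -> cmeas f -> cmeas g ->
  (sqn D (fun x => f x + g x)%R <= 2%:E * sqn D f + 2%:E * sqn D g)%E.
Proof.
move=> mD mf mg; rewrite /sqn -!ge0_integralZl//; try exact: measurable_Esq;
  try by move=> *; rewrite ?lee_fin ?sq_ge0.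
rewrite -ge0_integralD//.
- apply: ge0_le_integral => //.
  + by move=> *; rewrite ?lee_fin ?sq_ge0.
  + by apply: measurable_Esq; exact: cmeasD.
  + by apply: emeasurable_funD; apply: measurable_funeM; exact: measurable_Esq.
  + by move=> x _; rewrite -!EFinM -EFinD lee_fin sqD_le.
- by move=> *; rewrite -EFinM lee_fin mulr_ge0// sq_ge0.
- by apply: measurable_funeM; exact: measurable_Esq.
- by move=> *; rewrite -EFinM lee_fin mulr_ge0// sq_ge0.
- by apply: measurable_funeM; exact: measurable_Esq.
Qed.

Lemma sqnN D f : sqn D (fun x => - f x) = sqn D f.
Proof. by apply: eq_sqn => x _; rewrite sqN. Qed.

Lemma sqnB_le D f g : measurable D -> cmeas f -> cmeas g ->
  (sqn D (fun x => f x - g x)%R <= 2%:E * sqn D f + 2%:E * sqn D g)%E.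
Proof.
move=> mD mf mg; rewrite -(sqnN D g); apply: sqnD_le => //; exact: cmeasN.
Qed.

Lemma sqn_eq0 D f : measurable D -> cmeas f -> sqn D f = 0%E ->
  {ae mu, forall x, D x -> f x = 0}.
Proof.
move=> mD mf f0.
have : (\int[mu]_(x in D) `|(sq (f x))%:E| = 0)%E.
  by rewrite -[RHS]f0; apply: eq_integral => x _; rewrite gee0_abs// lee_fin sq_ge0.
move=> /(ae_eq_integral_abs mu mD (measurable_Esq mf)).1.
by apply: aeS => x /[apply] -[] /sq_eq0.
Qed.

Lemma L2D0 D : L2D D (fun=> 0).
Proof.
split; first exact: cmeas_cst.
by rewrite /sqn; under eq_integral do rewrite sq0; rewrite integral0.
Qed.

Lemma L2DZ D z f : measurable D -> L2D D f -> L2D D (fun x => z * f x).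
Proof.
move=> mD [mf f2]; split; first by apply: cmeasM => //; exact: cmeas_cst.
by rewrite sqnZ// lte_mul_pinfty// lee_fin sq_ge0.
Qed.

Lemma L2DD D f g : measurable D -> L2D D f -> L2D D g -> L2D D (fun x => f x + g x).
Proof.
move=> mD [mf f2] [mg g2]; split; first exact: cmeasD.
apply: le_lt_trans (sqnD_le mD mf mg) _.
by rewrite lte_add_pinfty// lte_mul_pinfty// lee_fin.
Qed.

Lemma L2DN D f : measurable D -> L2D D f -> L2D D (fun x => - f x).
Proof. by move=> mD [mf f2]; split; [exact: cmeasN|rewrite sqnN]. Qed.

Lemma L2DB D f g : measurable D -> L2D D f -> L2D D g -> L2D D (fun x => f x - g x).
Proof. by move=> mD Lf Lg; apply: L2DD => //; exact: L2DN. Qed.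

Lemma L2DJ D f : L2D D f -> L2D D (fun x => conjc (f x)).
Proof.
move=> [mf f2]; split; first exact: cmeasJ.
by rewrite (@eq_sqn _ _ f)// => x _; rewrite sqJ.
Qed.

Lemma L2D_sum D I (s : seq I) (F : I -> R -> C) : measurable D ->
  (forall i, L2D D (F i)) -> L2D D (fun x => \sum_(i <- s) F i x).
Proof.
move=> mD iF; elim: s => [|i s IH].
  by under eq_fun do rewrite big_nil; exact: L2D0.
by under eq_fun do rewrite big_cons; exact: L2DD.
Qed.

Lemma L2D_ae D f g : measurable D -> cmeas f -> L2D D g ->
  {ae mu, forall x, D x -> f x = g x} -> L2D D f.
Proof. by move=> mD mf [mg g2] fg; split => //; rewrite (ae_eq_sqn mD mf mg). Qed.

Lemma CInt_le D f (p : R -> R) : measurable D -> cmeas f ->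
  mu.-integrable D (EFin \o p) -> (forall x, D x -> cabs (f x) <= p x) ->
  CInt D f.
Proof.
move=> mD [f1 f2] ip_ fp.
have aRe z : `|Re z| <= cabs z.
  case: z => a b /=; rewrite /cabs /= -(sqrtr_sqr a) ler_wsqrtr//.
  by rewrite lerDl sqr_ge0.
have aIm z : `|Im z| <= cabs z.
  case: z => a b /=; rewrite /cabs /= -(sqrtr_sqr b) ler_wsqrtr//.
  by rewrite lerDr sqr_ge0.
split; apply: le_integrable ip_ => //;
  try (by apply/measurable_EFinP; exact: measurable_funTS);
  move=> x Dx /=; rewrite lee_fin (le_trans _ (ler_norm _))//.
  exact: le_trans (aRe _) (fp _ Dx).
exact: le_trans (aIm _) (fp _ Dx).
Qed.

Lemma L2D_integrable_sq D f : measurable D -> L2D D f ->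
  mu.-integrable D (EFin \o (fun x => sq (f x))).
Proof.
move=> mD [mf f2]; apply/integrableP; split; first exact: measurable_Esq.
rewrite (le_lt_trans _ f2)// le_eqVlt; apply/orP; left; apply/eqP.
by apply: eq_integral => x _; rewrite /= ger0_norm// sq_ge0.
Qed.

(** 2 |f g| <= |f|^2 + |g|^2 gives an integrable bound. *)
Lemma CIntM D f g : measurable D -> L2D D f -> L2D D g ->
  CInt D (fun x => f x * g x).
Proof.
move=> mD Lf Lg.
apply: (@CInt_le _ _ (fun x => sq (f x) + sq (g x))) => //.
- by apply: cmeasM; [exact: Lf.1|exact: Lg.1].
- rewrite (_ : _ \o _ = (EFin \o (fun x => sq (f x))) \+ (EFin \o (fun x => sq (g x))))%E//.
  by apply: integrableD => //; exact: L2D_integrable_sq.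
- move=> x _; rewrite /sq /cabs Normc.normcM.
  set a := Normc.normc _; set b := Normc.normc _.
  have : 0 <= (a - b) ^+ 2 by exact: sqr_ge0.
  have : 0 <= (a + b) ^+ 2 by exact: sqr_ge0.
  nra.
Qed.

(** * The inner product of L^2 and the real squared norm *)

Definition ip D f g : C := cint D (fun x => f x * conjc (g x)).

Lemma innerE f g : innerL2 f g = ip setT f g. Proof. by []. Qed.

Lemma ipDl D f g u : measurable D -> L2D D f -> L2D D g -> L2D D u ->
  ip D (fun x => f x + g x) u = ip D f u + ip D g u.
Proof.
move=> mD Lf Lg Lu; rewrite /ip -cintD//; try (by apply: CIntM => //; exact: L2DJ).
by apply: eq_cint => x _; rewrite mulrDl.
Qed.

Lemma ipZl D z f u : measurable D -> L2D D f -> L2D D u ->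
  ip D (fun x => z * f x) u = z * ip D f u.
Proof.
move=> mD Lf Lu; rewrite /ip -cintZ//; last by apply: CIntM => //; exact: L2DJ.
by apply: eq_cint => x _; rewrite mulrA.
Qed.

Lemma ipC D f g : measurable D -> L2D D f -> L2D D g ->
  ip D f g = conjc (ip D g f).
Proof.
move=> mD Lf Lg; rewrite /ip -cintJ//; last by apply: CIntM => //; exact: L2DJ.
by apply: eq_cint => x _; rewrite conjcM conjcK mulrC.
Qed.

Lemma ipDr D f g u : measurable D -> L2D D f -> L2D D g -> L2D D u ->
  ip D u (fun x => f x + g x) = ip D u f + ip D u g.
Proof.
move=> mD Lf Lg Lu; rewrite ipC// ?ipDl//; last exact: L2DD.
by rewrite conjcD -(ipC mD Lu Lf) -(ipC mD Lu Lg).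
Qed.

Lemma ipZr D z f u : measurable D -> L2D D f -> L2D D u ->
  ip D u (fun x => z * f x) = conjc z * ip D u f.
Proof.
move=> mD Lf Lu; rewrite ipC// ?ipZl//; last exact: L2DZ.
by rewrite conjcM -(ipC mD Lu Lf).
Qed.

Lemma ip0l D f : ip D (fun=> 0) f = 0.
Proof. by rewrite -[RHS](cint0 D); apply: eq_cint => x _; rewrite mul0r. Qed.

Lemma ip_suml D I (s : seq I) (F : I -> R -> C) u : measurable D ->
  (forall i, L2D D (F i)) -> L2D D u ->
  ip D (fun x => \sum_(i <- s) F i x) u = \sum_(i <- s) ip D (F i) u.
Proof.
move=> mD iF Lu; elim: s => [|i s IH].
  by under eq_fun do rewrite big_nil; rewrite ip0l big_nil.
under eq_fun do rewrite big_cons.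
by rewrite ipDl// ?IH ?big_cons//; exact: L2D_sum.
Qed.

Lemma ip_sumr D I (s : seq I) (F : I -> R -> C) u : measurable D ->
  (forall i, L2D D (F i)) -> L2D D u ->
  ip D u (fun x => \sum_(i <- s) F i x) = \sum_(i <- s) ip D u (F i).
Proof.
move=> mD iF Lu; rewrite ipC// ?ip_suml//; last exact: L2D_sum.
by rewrite conjc_sum; apply: eq_bigr => i _; rewrite -ipC.
Qed.

Lemma ae_eq_ip D f f' g g' : measurable D ->
  cmeas f -> cmeas f' -> cmeas g -> cmeas g' ->
  {ae mu, forall x, D x -> f x = f' x} -> {ae mu, forall x, D x -> g x = g' x} ->
  ip D f g = ip D f' g'.
Proof.
move=> mD mf mf' mg mg' ff gg; apply: ae_eq_cint => //.
- by apply: cmeasM => //; exact: cmeasJ.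
- by apply: cmeasM => //; exact: cmeasJ.
- by apply: aeS2 ff gg => x h1 h2 Dx; rewrite h1// h2.
Qed.

(** The squared norm as a real number; it carries information only where [sqn] is finite, hence the
    hypothesis of [nrmE]. *)
Definition nrm D f : R := fine (sqn D f).

Lemma nrmE D f : L2D D f -> (nrm D f)%:E = sqn D f.
Proof. by move=> [_ f2]; rewrite /nrm fineK// ge0_fin_numE// sqn_ge0. Qed.

Lemma nrm_ge0 D f : 0 <= nrm D f. Proof. exact/fine_ge0/sqn_ge0. Qed.

Lemma ip_nrm D f : ip D f f = (nrm D f)%:C.
Proof.
rewrite /ip /cint /nrm /sqn /Rintegral; apply/eqP; rewrite eq_complex /=.
apply/andP; split; apply/eqP.
- by congr fine; apply: eq_integral => x _; rewrite mulconjc_sq.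
- rewrite (_ : (\int[mu]_(x in D) _)%E = 0%E)//.
  by rewrite -[RHS](integral0 mu D); apply: eq_integral => x _; rewrite mulconjc_sq.
Qed.

Lemma nrmB D f g : measurable D -> L2D D f -> L2D D g ->
  nrm D (fun x => f x - g x) = nrm D f + nrm D g - 2 * Re (ip D f g).
Proof.
move=> mD Lf Lg.
have : ip D (fun x => f x - g x) (fun x => f x - g x) =
  (nrm D f + nrm D g)%:C - (ip D f g + conjc (ip D f g)).
  under [X in ip D X _ = _]eq_fun do rewrite -mulN1r.
  under [X in ip D _ X = _]eq_fun do rewrite -mulN1r.
  have LN := L2DZ (-1) mD Lg.
  rewrite (ipDl mD Lf LN (L2DD mD Lf LN)) (ipDr mD Lf LN Lf) (ipDr mD Lf LN LN).
  rewrite (ipZr (-1) mD Lg Lf) (ipZl (-1) mD Lg Lf) (ipZl (-1) mD Lg LN).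
  rewrite (ipZr (-1) mD Lg Lg) !ip_nrm (ipC mD Lg Lf) (_ : conjc (-1) = -1 :> C).
    by rewrite rmorphD/=; ring.
  by apply/eqP; rewrite eq_complex /= oppr0 eqxx oppr0 eqxx.
rewrite ip_nrm => /(congr1 Re) /= ->.
by case: (ip D f g) => a b /=; ring.
Qed.

End ComplexL2.

#[global] Arguments cint {R} D f : simpl never.
#[global] Arguments ip {R} D f g : simpl never.
#[global] Arguments sq {R} z : simpl never.
#[global] Arguments sqn {R} D f : simpl never.
#[global] Arguments nrm {R} D f : simpl never.

(** * Fourier series *)

Section Trig.
Variable R : realType.
Local Notation Re := (@complex.Re R).
Local Notation Im := (@complex.Im R).
Local Notation mu := (@lebesgue_measure R).
Local Notation C := (R[i]).
Implicit Types (x y : R).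

Lemma cisD x y : cis (x + y) = cis x * cis y :> C.
Proof.
by rewrite /cis cosD sinD; apply/eqP; rewrite eq_complex /= eqxx addrC eqxx.
Qed.

Lemma cis0 : cis 0 = 1 :> C.
Proof. by rewrite /cis cos0 sin0. Qed.

Lemma cisN x : cis (- x) = conjc (cis x) :> C.
Proof. by rewrite /cis cosN sinN. Qed.

Lemma sq_cis x : sq (cis x : C) = 1.
Proof. by rewrite sqE /= cos2Dsin2. Qed.

Lemma cis2pi (n : int) : cis (n%:~R * (2 * pi)) = 1 :> C.
Proof.
have H (m : nat) : cis (m%:R * (2 * pi)) = 1 :> C.
  elim: m => [|m IH]; first by rewrite mul0r cis0.
  rewrite -natr1 mulrDl mul1r cisD IH mul1r /cis (_ : 2 * pi = pi *+ 2).
    by rewrite cos2pi sin2pi.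
  by rewrite mulr_natl.
case: n => m; first exact: H.
rewrite NegzE rmorphN/= mulNr cisN H.
by apply/eqP; rewrite eq_complex /= oppr0 !eqxx.
Qed.

Lemma cmeas_cis (k : R) : cmeas (fun x => cis (k * x) : C).
Proof.
apply: continuous_cmeas => x.
  apply: continuous_comp; [exact: mulrl_continuous|exact: continuous_cos].
by apply: continuous_comp; [exact: mulrl_continuous|exact: continuous_sin].
Qed.

Lemma sqn_dominated (D : set R) (g : nat -> R -> C) (K : R -> R) :
  measurable D -> (forall n, cmeas (g n)) -> mu.-integrable D (EFin \o K) ->
  {ae mu, forall x, forall n, D x -> sq (g n x) <= K x} ->
  {ae mu, forall x, D x -> (fun n => sq (g n x)) @ \oo --> (0 : R)} ->
  (fun n => sqn D (g n)) @ \oo --> 0%E.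
Proof.
move=> mD mg iK gK g0.
have [] := @dominated_convergence _ _ _ mu D mD
  (fun n x => (sq (g n x))%:E) (cst 0%E) (EFin \o K).
- by move=> n; exact: measurable_Esq.
- exact: measurable_cst.
- apply: aeS g0 => x h Dx; apply/fine_cvgP; split; first by near=> n.
  exact: h.
- exact: iK.
- apply: aeS gK => x h n Dx; rewrite abse_EFin lee_fin ger0_norm ?sq_ge0//; exact: h.
by move=> _ _; rewrite integral0.
Unshelve. all: by end_near. Qed.

Lemma cvg_sqr0 (u : nat -> R) :
  u @ \oo --> (0 : R) -> (fun n => u n ^+ 2) @ \oo --> (0 : R).
Proof.
by move=> u0; rewrite -[X in _ --> X](mulr0 0); under eq_fun do rewrite expr2; exact: cvgM.
Qed.

Lemma bernoulli (u : R) n : -1 <= u -> 1 + n%:R * u <= (1 + u) ^+ n.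
Proof.
move=> u1; elim: n => [|n IH]; first by rewrite mul0r addr0 expr0.
rewrite exprS -natr1.
apply: (@le_trans _ _ ((1 + u) * (1 + n%:R * u))); last first.
  by apply: ler_wpM2l => //; lra.
have : 0 <= n%:R * u ^+ 2 by rewrite mulr_ge0// sqr_ge0.
nra.
Qed.

(** Bernoulli's inequality bounds the expression below by 1 - (2w)^n, and 2w < 1. *)
Lemma step_approx_left (w : R) : 0 <= w < 1 / 2 ->
  (fun n => (1 - w ^+ n) ^+ (2 ^ n)) @ \oo --> (1 : R).
Proof.
move=> /andP[w0 w12].
have w1 n : 0 <= w ^+ n <= 1.
  by rewrite exprn_ge0//= exprn_ile1//; lra.
apply: (@squeeze_cvgr _ _ _ _ (fun n => 1 - (2 * w) ^+ n) (cst 1)).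
- near=> n; apply/andP; split.
    have := @bernoulli (- w ^+ n) (2 ^ n) _.
    rewrite natrX mulrN exprMn; apply.
    by have /andP[] := w1 n; lra.
  by apply: exprn_ile1; have /andP[] := w1 n; lra.
- rewrite -[X in _ --> X]subr0; apply: cvgB; first exact: cvg_cst.
  by apply: cvg_expr; rewrite ger0_norm; lra.
- exact: cvg_cst.
Unshelve. all: by end_near. Qed.

(** (1 - w^n)(1 + w^n) <= 1, while Bernoulli's inequality gives (1 + w^n)^(2^n) >= (2w)^n; hence the
    bound (2w)^(-n), with 2w > 1. *)
Lemma step_approx_right (w : R) : 1 / 2 < w <= 1 ->
  (fun n => (1 - w ^+ n) ^+ (2 ^ n)) @ \oo --> (0 : R).
Proof.
move=> /andP[w12 w1'].
have w1 n : 0 <= w ^+ n <= 1.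
  by rewrite exprn_ge0 ?exprn_ile1//; lra.
apply: (@squeeze_cvgr _ _ _ _ (cst 0) (fun n => (2 * w)^-1 ^+ n)).
- near=> n; apply/andP; split.
    by apply: exprn_ge0; have /andP[] := w1 n; lra.
  have p0 : 0 < (2 * w) ^+ n by apply: exprn_gt0; lra.
  rewrite exprVn -[leRHS]mul1r ler_pdivlMr//.
  apply: (@le_trans _ _ ((1 - w ^+ n) ^+ (2 ^ n) * (1 + w ^+ n) ^+ (2 ^ n))).
    apply: ler_wpM2l; first by apply: exprn_ge0; have /andP[] := w1 n; lra.
    apply: le_trans (@bernoulli (w ^+ n) (2 ^ n) _).
      by rewrite natrX -exprMn lerDr.
    by have /andP[] := w1 n; lra.
  rewrite -exprMn; apply: exprn_ile1; have /andP[] := w1 n; nra.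
- exact: cvg_cst.
- apply: cvg_expr; rewrite ger0_norm ?invr_ge0; last lra.
  by rewrite invf_lt1; lra.
Unshelve. all: by end_near. Qed.

End Trig.

Section FourierSeries.
Variable R : realType.
Variables a b : R.
Hypothesis ab : a < b.
Local Notation Re := (@complex.Re R).
Local Notation Im := (@complex.Im R).
Local Notation mu := (@lebesgue_measure R).
Local Notation C := (R[i]).
Local Notation D := (`]a, b[%classic : set R).
Local Notation T := (b - a).
Let th := 2 * pi / T.
Implicit Types (f g p q : R -> C).

Lemma T_gt0 : 0 < T. Proof. by rewrite subr_gt0. Qed.

Let mD : measurable D. Proof. exact: measurable_itv. Qed.

Definition expi n : R -> C := fun x => cis (n%:~R * th * x).

Lemma expiD m n x : expi (m + n) x = expi m x * expi n x.
Proof. by rewrite /expi -cisD rmorphD/= !mulrDl. Qed.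

Lemma expiN n x : expi (- n) x = conjc (expi n x).
Proof. by rewrite /expi -cisN rmorphN/= !mulNr. Qed.

Lemma expi0 x : expi 0 x = 1.
Proof. by rewrite /expi !mul0r cis0. Qed.

Lemma sq_expi n x : sq (expi n x) = 1. Proof. exact: sq_cis. Qed.

Lemma cmeas_expi n : cmeas (expi n). Proof. exact: cmeas_cis. Qed.

Lemma integrable_cstD (k : R) : mu.-integrable D (EFin \o cst k).
Proof.
apply: measurable_bounded_integrable => //.
  change (mu `]a, b[ < +oo)%E; rewrite lebesgue_measure_itv/= lte_fin ab.
  by rewrite -EFinB ltry.
exact: bounded_cst.
Qed.

Lemma L2D_bounded f (K : R) : cmeas f -> (forall x, D x -> sq (f x) <= K) -> L2D D f.
Proof.
move=> mf fK; split => //.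
have /integrableP[_] := integrable_cstD K.
apply: le_lt_trans; apply: ge0_le_integral => //.
- by move=> x _; rewrite lee_fin sq_ge0.
- exact: measurable_Esq.
- by apply/measurable_EFinP; apply: measurableT_comp => //; exact: measurable_cst.
- move=> x Dx /=; rewrite lee_fin; apply: le_trans (ler_norm _); exact: fK.
Qed.

Lemma L2D_expi n : L2D D (expi n).
Proof. by apply: (@L2D_bounded _ 1); [exact: cmeas_expi|move=> x _; rewrite sq_expi]. Qed.

Lemma Rintegral_deriv (F f : R -> R) : (forall x : R, is_derive x (1 : R) F (f x)) ->
  continuous f -> \int[mu]_(x in D) f x = F b - F a.
Proof.
move=> dF cf.
have cF : continuous F.
  by move=> x; apply: differentiable_continuous; apply/derivable1_diffP; apply: ex_derive.
have := @continuous_FTC2 R f F a b ab _ _ _.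
rewrite /Rintegral integral_itv_bndoo; last first.
  by apply: measurable_funTS; apply/measurable_EFinP; exact: continuous_measurable_fun.
move=> -> //.
- exact: continuous_subspaceT.
- split.
  + by move=> x _; exact: ex_derive.
  + by apply: cvg_at_right_filter; exact: cF.
  + by apply: cvg_at_left_filter; exact: cF.
- by move=> x _; rewrite derive1E; exact: derive_val.
Qed.

Lemma cint_expi n : cint D (expi n) = if n == 0 then T%:C else 0.
Proof.
case: eqVneq => [->|n0].
  rewrite /cint; congr (_ +i* _).
  - rewrite (@eq_Rintegral _ _ _ _ _ (cst 1)); last by move=> x _; rewrite expi0.
    rewrite Rintegral_cst// mul1r /= lebesgue_measure_itv/= lte_fin ab//.
  - rewrite (@eq_Rintegral _ _ _ _ _ (cst 0)); last by move=> x _; rewrite expi0.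
    by rewrite Rintegral_cst// mul0r.
set k := n%:~R * th.
have k0 : k != 0.
  rewrite mulf_neq0 ?intr_eq0//.
  by rewrite mulf_neq0 ?invr_eq0 ?gt_eqF// ?pi_gt0// ?mulr_gt0 ?pi_gt0// T_gt0.
have lattice_product : cis (k * b) = cis (k * a) :> C.
  rewrite (_ : k * b = k * a + n%:~R * (2 * pi)); first by rewrite cisD cis2pi mulr1.
  rewrite /k /th; field.
  by rewrite gt_eqF// T_gt0.
case: lattice_product => ccos csin.
rewrite /cint; apply/eqP; rewrite eq_complex /=; apply/andP; split; apply/eqP.
- apply: etrans; [apply: (@Rintegral_deriv (fun x => k^-1 * sin (k * x)))|].
  + move=> x; apply: is_derive_eq; rewrite /expi /=.
    by rewrite -/k [k%:A]mulr1 [LHS]mulrC mulfK.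
  + move=> x; apply: continuous_comp; [exact: mulrl_continuous|exact: continuous_cos].
  + by rewrite /= csin subrr.
- apply: etrans; [apply: (@Rintegral_deriv (fun x => - k^-1 * cos (k * x)))|].
  + move=> x; apply: is_derive_eq; rewrite /expi /=.
    by rewrite -/k [k%:A]mulr1 /GRing.scale/= (mulNr (sin _)) mulrNN mulrCA mulVf ?mulr1.
  + move=> x; apply: continuous_comp; [exact: mulrl_continuous|exact: continuous_sin].
  + by rewrite /= ccos subrr.
Qed.

Lemma ip_expi m n : ip D (expi m) (expi n) = if m == n then T%:C else 0.
Proof.
rewrite /ip; under eq_cint do rewrite -expiN -expiD.
by rewrite cint_expi subr_eq0.
Qed.

(** * Fourier coefficients and partial sums *)

Definition coef f n : C := ip D f (expi n).
Arguments coef f n : simpl never.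

(* The sum over |n| <= M. *)
Definition psum (M : nat) (c : int -> C) : R -> C :=
  fun x => \sum_(i < (M + M).+1) c (i%:Z - M%:Z) * expi (i%:Z - M%:Z) x.

Definition fsum (M : nat) f := psum M (fun n => (T^-1)%:C * coef f n).

Lemma L2D_psum M c : L2D D (psum M c).
Proof.
apply: L2D_sum => // i; apply: L2DZ => //; exact: L2D_expi.
Qed.

Lemma ip_psumr M f c : L2D D f ->
  ip D f (psum M c) = \sum_(i < (M + M).+1) conjc (c (i%:Z - M%:Z)) * coef f (i%:Z - M%:Z).
Proof.
move=> Lf; rewrite ip_sumr//; last by move=> i; apply: L2DZ => //; exact: L2D_expi.
by apply: eq_bigr => i _; rewrite ipZr//; exact: L2D_expi.
Qed.

Lemma idx_inj M (i j : 'I_(M + M).+1) : (i%:Z - M%:Z == j%:Z - M%:Z) = (i == j).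
Proof. by rewrite (inj_eq (@addIr _ _)) eqz_nat. Qed.

Lemma coef_psum M c (j : 'I_(M + M).+1) :
  coef (psum M c) (j%:Z - M%:Z) = T%:C * c (j%:Z - M%:Z).
Proof.
rewrite /coef ip_suml//; last 2 first.
- by move=> i; apply: L2DZ => //; exact: L2D_expi.
- exact: L2D_expi.
rewrite (bigD1 j)//= big1 ?addr0.
  rewrite ipZl//; [|exact: L2D_expi|exact: L2D_expi].
  by rewrite ip_expi eqxx mulrC.
move=> i ij; rewrite ipZl//; [|exact: L2D_expi|exact: L2D_expi].
by rewrite ip_expi idx_inj (negPf ij) mulr0.
Qed.

Lemma conjc_real (r : R) : conjc r%:C = r%:C.
Proof. by apply/eqP; rewrite eq_complex /= oppr0 !eqxx. Qed.

(** Pythagoras for the orthogonal projection on the span of the [expi n], |n| <= M: the inner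
    product of f with its partial sum and the squared norm of the partial sum are the same real
    number. The factor 1/T appears because the exponentials have squared norm T. *)
Lemma nrm_fsum M f : L2D D f ->
  nrm D (fun x => f x - fsum M f x) =
  nrm D f - T^-1 * \sum_(i < (M + M).+1) sq (coef f (i%:Z - M%:Z)).
Proof.
move=> Lf; rewrite nrmB//; last exact: L2D_psum.
set S := \sum_(i < _) _.
have T0 : T != 0 by rewrite gt_eqF// T_gt0.
have SE : (T^-1 * S)%:C = \sum_(i < (M + M).+1)
    (T^-1)%:C * (sq (coef f (i%:Z - M%:Z)))%:C :> C.
  by rewrite rmorphM [in X in _ * X = _]/S rmorph_sum mulr_sumr.
have -> : ip D f (fsum M f) = (T^-1 * S)%:C.
  rewrite ip_psumr// SE; apply: eq_bigr => i _.
  by rewrite conjcM conjc_real -mulrA (mulrC (conjc (coef _ _))) mulconjc_sq.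
have : ip D (fsum M f) (fsum M f) = (T^-1 * S)%:C.
  rewrite ip_psumr; last exact: L2D_psum.
  rewrite SE; apply: eq_bigr => i _.
  rewrite coef_psum (mulrA T%:C) -rmorphM divff// mul1r.
  by rewrite conjcM conjc_real -mulrA (mulrC (conjc (coef _ _))) mulconjc_sq.
rewrite ip_nrm => /(congr1 Re) /= ->; ring.
Qed.

Lemma le_nrm_fsum M f : L2D D f -> nrm D (fun x => f x - fsum M f x) <= nrm D f.
Proof.
move=> Lf; rewrite nrm_fsum// gerBl mulr_ge0// ?invr_ge0 ?(ltW T_gt0)//.
by apply: sumr_ge0 => i _; exact: sq_ge0.
Qed.

(** * Trigonometric polynomials *)

Inductive trigpoly : (R -> C) -> Prop :=
| trigpoly_expi n : trigpoly (expi n)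
| trigpoly_add p q : trigpoly p -> trigpoly q -> trigpoly (fun x => p x + q x)
| trigpoly_scale z p : trigpoly p -> trigpoly (fun x => z * p x).

Lemma trigpoly_cst z : trigpoly (fun=> z).
Proof.
rewrite (_ : (fun=> z) = fun x => z * expi 0 x); last by apply/funext => x; rewrite expi0 mulr1.
by apply: trigpoly_scale; exact: trigpoly_expi.
Qed.

(** Frequencies add under multiplication, so trigonometric polynomials form an algebra; powers of
    [wave] stay inside it. *)
Lemma trigpoly_mul p q : trigpoly p -> trigpoly q -> trigpoly (fun x => p x * q x).
Proof.
move=> + tq; elim=> [n|p1 p2 _ t1 _ t2|z p1 _ t1].
- elim: tq => [m|q1 q2 _ t1 _ t2|z q1 _ t1].
  + by under eq_fun do rewrite -expiD; exact: trigpoly_expi.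
  + by under eq_fun do rewrite mulrDr; exact: trigpoly_add.
  + by under eq_fun do rewrite mulrCA; exact: trigpoly_scale.
- by under eq_fun do rewrite mulrDl; exact: trigpoly_add.
- by under eq_fun do rewrite -mulrA; exact: trigpoly_scale.
Qed.

Lemma trigpoly_exp p k : trigpoly p -> trigpoly (fun x => p x ^+ k).
Proof.
move=> tp; elim: k => [|k IH].
  by under eq_fun do rewrite expr0; exact: trigpoly_cst.
by under eq_fun do rewrite exprS; exact: trigpoly_mul.
Qed.

Lemma L2D_trigpoly p : trigpoly p -> L2D D p.
Proof.
elim=> [n|p1 p2 _ t1 _ t2|z p1 _ t1]; first exact: L2D_expi.
- exact: L2DD.
- exact: L2DZ.
Qed.

Lemma coefD f g n : L2D D f -> L2D D g ->
  coef (fun x => f x + g x) n = coef f n + coef g n.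
Proof. by move=> Lf Lg; rewrite /coef ipDl//; exact: L2D_expi. Qed.

Lemma coefZ z f n : L2D D f -> coef (fun x => z * f x) n = z * coef f n.
Proof. by move=> Lf; rewrite /coef ipZl//; exact: L2D_expi. Qed.

Lemma fsumD M f g x : L2D D f -> L2D D g ->
  fsum M (fun x => f x + g x) x = fsum M f x + fsum M g x.
Proof.
move=> Lf Lg; rewrite /fsum /psum -big_split/=; apply: eq_bigr => i _.
by rewrite coefD// mulrDr mulrDl.
Qed.

Lemma fsumZ M z f x : L2D D f -> fsum M (fun x => z * f x) x = z * fsum M f x.
Proof.
move=> Lf; rewrite /fsum /psum mulr_sumr; apply: eq_bigr => i _.
by rewrite coefZ//; ring.
Qed.

Lemma fsum_trigpoly p : trigpoly p ->
  exists M0, forall M, (M0 <= M)%N -> forall x, fsum M p x = p x.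
Proof.
elim=> [n|p1 p2 tp1 [M1 h1] tp2 [M2 h2]|z p1 tp1 [M1 h1]].
- exists (absz n) => M nM x.
  have nM' : (absz (n + M%:Z)) = n + M%:Z :> int by lia.
  have ltn : (absz (n + M%:Z)%R < (M + M).+1)%N by lia.
  rewrite /fsum /psum (bigD1 (Ordinal ltn))//= big1 ?addr0.
    rewrite nM' addrK /coef ip_expi eqxx -rmorphM/= mulVf ?rmorph1 ?mul1r//.
    by rewrite gt_eqF// T_gt0.
  move=> i /eqP ij; rewrite /coef ip_expi; case: eqP => [e|_]; last by rewrite mulr0 mul0r.
  by case: ij; apply/val_inj => /=; lia.
- exists (maxn M1 M2) => M; rewrite geq_max => /andP[/h1 e1 /h2 e2] x.
  by rewrite fsumD ?e1 ?e2//; exact: L2D_trigpoly.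
- by exists M1 => M /h1 e1 x; rewrite fsumZ ?e1//; exact: L2D_trigpoly.
Qed.

(** * Density of the trigonometric polynomials in L^2 *)

Definition tapprox f := L2D D f /\
  forall e : R, 0 < e -> exists2 p, trigpoly p & nrm D (fun x => f x - p x) < e.

Lemma nrmD_le f g : L2D D f -> L2D D g ->
  nrm D (fun x => f x + g x) <= 2 * nrm D f + 2 * nrm D g.
Proof.
move=> Lf Lg; rewrite -lee_fin EFinD !EFinM !nrmE//; last exact: L2DD.
apply: sqnD_le => //; [exact: Lf.1|exact: Lg.1].
Qed.

Lemma tapprox_trigpoly p : trigpoly p -> tapprox p.
Proof.
move=> tp; split; first exact: L2D_trigpoly.
move=> e e0; exists p => //.
rewrite (_ : (fun x => _) = fun=> 0); last by apply/funext => x; rewrite subrr.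
by rewrite /nrm (_ : sqn D _ = 0%E)// /sqn; under eq_integral do rewrite sq0; rewrite integral0.
Qed.

Lemma tapproxD f g : tapprox f -> tapprox g -> tapprox (fun x => f x + g x).
Proof.
move=> [Lf af] [Lg ag]; split; first exact: L2DD.
(* Quarters, because of the factors 2 in [nrmD_le]. *)
move=> e e0; have e4 : 0 < e / 4 by lra.
have [p tp fp] := af _ e4; have [q tq gq] := ag _ e4.
exists (fun x => p x + q x); first exact: trigpoly_add.
have Lfp := L2DB mD Lf (L2D_trigpoly tp).
have Lgq := L2DB mD Lg (L2D_trigpoly tq).
rewrite (_ : (fun x => _) = (fun x => (f x - p x) + (g x - q x))).
  by apply: le_lt_trans (nrmD_le Lfp Lgq) _; lra.
by apply/funext => x; ring.
Qed.

Lemma nrmZ z f : L2D D f -> nrm D (fun x => z * f x) = sq z * nrm D f.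
Proof.
move=> Lf; apply: EFin_inj; rewrite EFinM !nrmE//; last exact: L2DZ.
by apply: sqnZ => //; exact: Lf.1.
Qed.

Lemma tapproxZ z f : tapprox f -> tapprox (fun x => z * f x).
Proof.
move=> [Lf af]; split; first exact: L2DZ.
move=> e e0; have z0 : 0 < sq z + 1 by have := sq_ge0 z; lra.
have [p tp fp] := af (e / (sq z + 1)) (divr_gt0 e0 z0).
exists (fun x => z * p x); first exact: trigpoly_scale.
have Lfp := L2DB mD Lf (L2D_trigpoly tp).
rewrite (_ : (fun x => _) = fun x => z * (f x - p x)); last first.
  by apply/funext => x; rewrite mulrBr.
rewrite nrmZ//.
move: fp; rewrite ltr_pdivlMr// mulrDr mulr1.
by have := nrm_ge0 D (fun x => f x - p x); nra.
Qed.

Lemma tapprox_limit f : L2D D f ->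
  (forall e : R, 0 < e -> exists2 g, tapprox g & nrm D (fun x => f x - g x) < e) ->
  tapprox f.
Proof.
move=> Lf H; split => // e e0; have e4 : 0 < e / 4 by lra.
have [g [Lg ag] fg] := H _ e4; have [p tp gp] := ag _ e4.
exists p => //.
rewrite (_ : (fun x => _) = (fun x => (f x - g x) + (g x - p x))).
  have Lgp := L2DB mD Lg (L2D_trigpoly tp).
  by apply: le_lt_trans (nrmD_le (L2DB mD Lf Lg) Lgp) _; lra.
by apply/funext => x; ring.
Qed.

Lemma tapprox_dominated f (g : nat -> R -> C) (K : R -> R) : cmeas f ->
  (forall n : nat, tapprox (g n)) -> mu.-integrable D (EFin \o K) ->
  {ae mu, forall x, forall n : nat, D x -> sq (f x - g n x) <= K x} ->
  {ae mu, forall x, D x -> (fun n => sq (f x - g n x)) @ \oo --> (0 : R)} ->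
  tapprox f.
Proof.
move=> mf ag iK fK f0.
have mfg n : cmeas (fun x => f x - g n x) by apply: cmeasB => //; exact: (ag n).1.1.
have cv := sqn_dominated mD mfg iK fK f0.
have Lfg n : L2D D (fun x => f x - g n x).
  split => //.
  have /integrableP[_] := iK; apply: le_lt_trans; apply: ae_ge0_le_integral => //.
  - by move=> x _; rewrite lee_fin sq_ge0.
  - exact: measurable_Esq.
  - by apply: measurableT_comp => //; exact: (measurable_int mu).
  - apply: aeS fK => x h Dx /=; rewrite lee_fin; apply: le_trans (ler_norm _); exact: h.
apply: tapprox_limit.
  rewrite (_ : f = (fun x => (f x - g 0%N x) + g 0%N x)).
    by apply: L2DD => //; exact: (ag _).1.
  by apply/funext => x; rewrite subrK.
move=> e e0; move/fine_cvgP : cv => [_] /cvgr0Pnorm_lt /(_ e e0) [n _] /(_ n (leqnn n)) /= h.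
by exists (g n) => //; apply: le_lt_trans h; rewrite ler_norm.
Qed.

Lemma tapprox_sum I (s : seq I) (F : I -> R -> C) :
  (forall i, tapprox (F i)) -> tapprox (fun x => \sum_(i <- s) F i x).
Proof.
move=> aF; elim: s => [|i s IH].
  rewrite (_ : (fun x => _) = fun=> 0); last by apply/funext => x; rewrite big_nil.
  exact/tapprox_trigpoly/trigpoly_cst.
rewrite (_ : (fun x => _) = fun x => F i x + \sum_(j <- s) F j x).
  exact: tapproxD.
by apply/funext => x; rewrite big_cons.
Qed.

Definition ind (A : set R) : R -> C := fun x => if x \in A then 1 else 0.

Lemma ind_real A x : ind A x = (\1_A x)%:C.
Proof. by rewrite /ind indicE; case: (x \in A). Qed.

Lemma cmeas_ind A : measurable A -> cmeas (ind A).
Proof.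
move=> mA; rewrite (_ : ind A = fun x => (\1_A x)%:C).
  by apply: cmeas_real; exact: measurable_indic.
by apply/funext => x; exact: ind_real.
Qed.

Lemma eq_tapprox f g : cmeas f -> tapprox g -> (forall x, D x -> f x = g x) -> tapprox f.
Proof.
move=> mf [Lg ag] fg; have Lf : L2D D f by apply: (L2D_ae mD mf Lg); exact: aeW.
split=> // e /ag [p tp gp]; exists p => //.
by rewrite /nrm (@eq_sqn _ _ _ (fun x => g x - p x))// => x Dx; rewrite fg.
Qed.

(* A trigonometric polynomial with values in [0, 1] that is, in ]a, b[, below 1/2 on
   the left of c and above on the right; hence (1 - wave^n)^(2^n) tends to the indicator of ]-oo, c[. *)
Definition wave (c x : R) : R :=
  1 / 2 - (cos (th * x - th * ((a + c) / 2)) - cos (th * (c - a) / 2)) / 4.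

Lemma trigpoly_wave c : trigpoly (fun x => (wave c x)%:C).
Proof.
set s := th * ((a + c) / 2); set d := cos (th * (c - a) / 2).
rewrite (_ : (fun x => _) = fun x =>
   (1 / 2 + d / 4)%:C + ((- (1 / 8))%:C * cis (- s) * expi 1 x +
                          (- (1 / 8))%:C * cis s * expi (-1) x)).
  apply: trigpoly_add; first exact: trigpoly_cst.
  by apply: trigpoly_add; apply: trigpoly_scale; exact: trigpoly_expi.
apply/funext => x; rewrite /wave -/s -/d /expi mulr1z !mul1r rmorphN1 mulN1r mulNr.
rewrite !cisN /cis cosB.
apply/eqP; rewrite eq_complex /= ?oppr0 ?mul0r ?mulr0; apply/andP.
by split; apply/eqP; field.
Qed.

Lemma wave_bound c x : 0 <= wave c x <= 1.
Proof.
rewrite /wave; set u := th * x - _; set v := th * (c - a) / 2.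
have := cos_geN1 u; have := cos_le1 u; have := cos_geN1 v; have := cos_le1 v; lra.
Qed.

(** Product-to-sum formula. On ]a, b[ the first sine is positive and the second has the sign of c -
    x, so that [wave c] crosses 1/2 exactly at c. *)
Lemma waveE c x :
  wave c x = 1 / 2 - sin (th * (x - a) / 2) * sin (th * (c - x) / 2) / 2.
Proof.
rewrite /wave; set p := th * (x - a) / 2; set q := th * (c - x) / 2.
rewrite (_ : th * x - _ = p - q); last by rewrite /p /q; field.
rewrite (_ : th * (c - a) / 2 = p + q); last by rewrite /p /q; field.
by rewrite cosB cosD; field.
Qed.

Lemma sin_half_gt0 u : 0 < u < T -> 0 < sin (th * u / 2).
Proof.
move=> /andP[u0 uT]; apply: sin_gt0_pi.
have T0 := T_gt0; have pi0 := @pi_gt0 R.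
rewrite (_ : th * u / 2 = pi * (u / T)); last by rewrite /th; field; rewrite gt_eqF.
have v0 : 0 < u / T by rewrite divr_gt0.
have v1 : u / T < 1 by rewrite ltr_pdivrMr// mul1r.
rewrite mulr_gt0//=; nra.
Qed.

Lemma wave_lt c x : a < x < b -> a < c < b -> x < c -> wave c x < 1 / 2.
Proof.
move=> /andP[ax xb] /andP[ac cb] xc; rewrite waveE.
have := @sin_half_gt0 (x - a); have := @sin_half_gt0 (c - x).
set s := sin _; set t := sin _ => h1 h2.
have {}h1 : 0 < s by apply: h1; lra.
have {}h2 : 0 < t by apply: h2; lra.
by have := mulr_gt0 h1 h2; lra.
Qed.

Lemma wave_gt c x : a < x < b -> a < c < b -> c < x -> 1 / 2 < wave c x.
Proof.
move=> /andP[ax xb] /andP[ac cb] cx; rewrite waveE.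
have := @sin_half_gt0 (x - a); have := @sin_half_gt0 (x - c).
rewrite (_ : th * (c - x) / 2 = - (th * (x - c) / 2)); last by field.
rewrite sinN.
set s := sin _; set t := sin _ => h1 h2.
have {}h1 : 0 < s by apply: h1; lra.
have {}h2 : 0 < t by apply: h2; lra.
by have := mulr_gt0 h1 h2; lra.
Qed.

Lemma tapprox_ray c : tapprox (ind `]-oo, c[%classic).
Proof.
have mc : cmeas (ind `]-oo, c[%classic) by apply: cmeas_ind; exact: measurable_itv.
have [ca|ac] := leP c a.
  apply: (@eq_tapprox _ (fun=> 0)) => //; first exact/tapprox_trigpoly/trigpoly_cst.
  move=> x /=; rewrite in_itv/= => /andP[ax xb].
  by rewrite /ind mem_setE in_itv/= ltNge (ltW (le_lt_trans ca ax)).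
have [bc|cb] := leP b c.
  apply: (@eq_tapprox _ (fun=> 1)) => //; first exact/tapprox_trigpoly/trigpoly_cst.
  move=> x /=; rewrite in_itv/= => /andP[ax xb].
  by rewrite /ind mem_setE in_itv/= (lt_le_trans xb).
pose g (n : nat) x : R := (1 - wave c x ^+ n) ^+ (2 ^ n).
have g01 n x : 0 <= g n x <= 1.
  have /andP[w0 w1] := wave_bound c x.
  have : 0 <= 1 - wave c x ^+ n <= 1.
    by rewrite subr_ge0 exprn_ile1//= gerBl exprn_ge0.
  by move=> /andP[h0 h1]; rewrite /g exprn_ge0//= exprn_ile1.
apply: (@tapprox_dominated _ (fun n x => (g n x)%:C) (cst 1)) => //.
- move=> n; apply: tapprox_trigpoly.
  rewrite (_ : (fun x => _) = fun x => (1 + (-1) * (wave c x)%:C ^+ n) ^+ (2 ^ n)).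
    apply: trigpoly_exp; apply: trigpoly_add; first exact: trigpoly_cst.
    by apply: trigpoly_scale; apply: trigpoly_exp; exact: trigpoly_wave.
  by apply/funext => x; rewrite /g rmorphXn rmorphB rmorph1 rmorphXn mulN1r.
- exact: integrable_cstD.
- apply: aeW => x n _; have /andP[h0 h1] := g01 n x.
  rewrite /ind; case: ifP => _.
    rewrite (_ : 1 - (g n x)%:C = (1 - g n x)%:C); last by rewrite rmorphB rmorph1.
    by rewrite sq_real/= exprn_ile1//; lra.
  by rewrite sub0r sqN sq_real/= exprn_ile1.
(* At c itself [wave] equals 1/2 and the powers tend to 1/e; this point is discarded as a null
   set. *)
- have : {ae mu, forall x, x != c}.
    exists [set c]; split; [exact: measurable_set1|exact: lebesgue_measure_set1|].
    by move=> x /= /negP; rewrite negbK => /eqP.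
  apply: aeS => x xc; rewrite /= in_itv/= => Dx.
  rewrite /ind mem_setE in_itv/=; case: ltP => h.
    rewrite (_ : (fun n => _) = (fun n => (1 - g n x) ^+ 2)); last first.
      by apply/funext => n; rewrite -sq_real rmorphB rmorph1.
    apply: cvg_sqr0; rewrite -[X in _ --> X](subrr (1 : R)).
    apply: cvgB; first exact: cvg_cst.
    apply: step_approx_left; rewrite wave_lt ?ac//.
    by have /andP[-> _] := wave_bound c x.
  rewrite (_ : (fun n => _) = (fun n => (g n x) ^+ 2)); last first.
    by apply/funext => n; rewrite sub0r sqN sq_real.
  apply: cvg_sqr0.
  apply: step_approx_right; rewrite wave_gt ?ac//.
    by have /andP[_ ->] := wave_bound c x.
  by rewrite lt_neqAle h eq_sym xc.
Qed.

(** Dynkin's theorem: the rays are stable under intersection and generate the Borel sets, and the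
    sets with an approximable indicator are stable under complements and countable disjoint
    unions. *)
Lemma tapprox_ind A : measurable A -> tapprox (ind A).
Proof.
move=> mA.
have E := RGenInftyO.measurableE R.
have mA' : <<s (@RGenInftyO.G R) >> A.
  by change ((RGenInftyO.G (R:=R)).-sigma.-measurable A); rewrite -E.
pose P (A : set R) := measurable A -> tapprox (ind A).
suff : P A by exact.
apply: (@dynkin_induction _ _ _ P _ _ _ _ _ _ _ mA').
- exact: E.
- move=> _ _ [x ->] [y ->]; exists (Num.min x y).
  by apply/seteqP; split => z /=; rewrite !in_itv/= lt_min; [move=> [-> ->]|move=> /andP[]].
- move=> _; apply: (@eq_tapprox _ (fun=> 1)).
  + exact: cmeas_ind.
  + exact/tapprox_trigpoly/trigpoly_cst.
  + by move=> x _; rewrite /ind mem_setT.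
- move=> _ [x ->] _; exact: tapprox_ray.
- move=> S mS PS mCS; apply: (@eq_tapprox _ (fun x => 1 + (-1) * ind S x)).
  + exact: cmeas_ind.
  + apply: tapproxD; first exact/tapprox_trigpoly/trigpoly_cst.
    by apply: tapproxZ; exact: PS.
  + by move=> x _; rewrite /ind in_setC; case: (x \in S); ring.
- move=> F mF tF PF mUF.
  (* By disjointness at most one F k contains x, so the partial sums at x jump from 0 to 1 once, or
     stay 0. *)
  have E1 x : (exists2 k, F k x & forall n, \sum_(i < n) ind (F i) x = (k < n)%N%:R) \/
      (~ (\bigcup_k F k) x /\ forall n, \sum_(i < n) ind (F i) x = 0).
    have [[k _ Fk]|nF] := pselect ((\bigcup_k F k) x); [left|right].
      exists k => //; elim=> [|n IH]; first by rewrite big_ord0.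
      rewrite big_ord_recr /= IH ltnS /ind; case: ifPn => [/set_mem Fn|Fn].
        have -> : n = k by apply: tF => //; exists x.
        by rewrite ltnn leqnn add0r.
      rewrite addr0 [in RHS]leq_eqVlt; case: eqP => //= kn.
      by move: Fn; rewrite -kn notin_setE.
    split=> // n; apply: big1 => i _; rewrite /ind; case: ifPn => // /set_mem Fi.
    by case: nF; exists i.
  apply: (@tapprox_dominated _ (fun n x => \sum_(i < n) ind (F i) x) (cst 1)).
  + exact: cmeas_ind.
  + by move=> n; apply: tapprox_sum => i; apply: PF.
  + exact: integrable_cstD.
  + apply: aeW => x n _; case: (E1 x) => [[k Fk ->]|[nF ->]]; rewrite /ind.
      rewrite ifT; last by rewrite inE; exists k.
      by case: ltnP => _; rewrite ?subrr ?subr0 ?sq0// -[1]/(1%:C) sq_real expr1n.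
    rewrite ifF ?subr0 ?sq0//; apply/negP => /set_mem; exact: nF.
  + apply: aeW => x _; case: (E1 x) => [[k Fk H]|[nF H]]; apply: cvg_near_cst; near=> n; rewrite H /ind.
      rewrite ifT; last by rewrite inE; exists k.
      have -> : (k < n)%N by near: n; exact: nbhs_infty_gt.
      by rewrite subrr sq0.
    rewrite ifF ?subr0 ?sq0//; apply/negP => /set_mem; exact: nF.
Unshelve. all: by end_near. Qed.

(** Simple functions g_n increase to r, and (r - g_n)^2 <= r^2 dominates the error. *)
Lemma tapprox_nneg (r : R -> R) : measurable_fun setT r -> (forall x, 0 <= r x) ->
  L2D D (fun x => (r x)%:C) -> tapprox (fun x => (r x)%:C).
Proof.
move=> mr r0 Lr.
have mr' : measurable_fun setT (EFin \o r) by apply/measurable_EFinP.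
pose g (n : nat) := nnsfun_approx measurableT mr' n.
pose gr (n : nat) (x : R) : R := g n x.
apply: (@tapprox_dominated _ (fun n x => (gr n x)%:C) (fun x => sq (r x)%:C)).
- exact: cmeas_real.
- move=> n.
  rewrite (_ : (fun x => _) = fun x =>
      \sum_(y <- finmap.enum_fset (fset_set (range (g n)))) y%:C * ind (g n @^-1` [set y]) x).
    apply: tapprox_sum => y; apply: tapproxZ; apply: tapprox_ind.
    exact: measurable_funPTI.
  apply/funext => x; rewrite /gr (fimfunE (g n)) fsbig_finite//= rmorph_sum; apply: eq_bigr => y _.
  by rewrite rmorphM ind_real.
- exact: L2D_integrable_sq.
- apply: aeW => x n _; rewrite -rmorphB !sq_real/=.
  have h0 : 0 <= g n x by [].
  have h1 : g n x <= r x.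
    rewrite -lee_fin /g nnsfun_approxE.
    by apply: (@le_approx _ _ _ _ (EFin \o r)) => // z _; rewrite /= lee_fin.
  by rewrite /gr; have := r0 x; nra.
- apply: aeW => x _.
  rewrite (_ : (fun n => _) = (fun n => (r x - g n x) ^+ 2)); last first.
    by apply/funext => n; rewrite -sq_real rmorphB.
  apply: cvg_sqr0; rewrite -[X in _ --> X](subrr (r x)).
  apply: cvgB; first exact: cvg_cst.
  have /fine_cvgP[_] := @cvg_nnsfun_approx _ _ _ _ measurableT _ mr' (fun x _ => r0 x) x I.
  exact.
Qed.

(** Splitting into real and imaginary parts, and these into positive and negative parts, each
    bounded by |f|. *)
Lemma tapprox_L2D f : L2D D f -> tapprox f.
Proof.
move=> [[f1 f2] Lf].
have Lr (r : R -> R) : (forall x, r x ^+ 2 <= sq (f x)) -> measurable_fun setT r ->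
    L2D D (fun x => (r x)%:C).
  move=> rf mr; split; first exact: cmeas_real.
  apply: le_lt_trans Lf; apply: le_sqn => //; first exact: cmeas_real.
  by apply: aeW => x _; rewrite sq_real.
have H (r : R -> R) : (forall x, r x ^+ 2 <= sq (f x)) -> measurable_fun setT r ->
    tapprox (fun x => (r x)%:C).
  move=> rf mr.
  rewrite (_ : (fun x => _) = fun x => (r^\+ x)%:C + (-1) * (r^\- x)%:C); last first.
    apply/funext => x; rewrite mulN1r -rmorphB; congr (_ %:C).
    by have /(congr1 (fun h => h x)) /= <- := funrposBneg r.
  have mp := measurable_funrpos mr; have mn := measurable_funrneg mr.
  apply: tapproxD; [|apply: tapproxZ]; apply: tapprox_nneg => //; apply: Lr => // x;
    apply: le_trans (rf x); rewrite /funrpos /funrneg /Num.max; case: ifP => _;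
    rewrite ?sqrrN ?expr0n ?sqr_ge0 ?lexx//.
rewrite (_ : f = fun x => (Re (f x))%:C + 'i%C * (Im (f x))%:C); last first.
  by apply/funext => x; case: (f x) => u v; apply/eqP; rewrite eq_complex /=; apply/andP;
    split; apply/eqP; ring.
apply: tapproxD; [|apply: tapproxZ]; apply: H => // x; rewrite sqE.
  by rewrite lerDl sqr_ge0.
by rewrite lerDr sqr_ge0.
Qed.

(** If p is a trigonometric polynomial close to f and M is large, p is its own partial sum; the
    error for f is then the error for f - p, which is at most the squared norm of f - p. *)
Lemma sqn_fsum_cvg f : L2D D f ->
  (fun M => nrm D (fun x => f x - fsum M f x)) @ \oo --> (0 : R).
Proof.
move=> Lf; apply/cvgr0Pnorm_lt => e e0; have e4 : 0 < e / 4 by lra.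
have [_ /(_ e e0) [p tp pe]] := tapprox_L2D Lf.
have [M0 hM] := fsum_trigpoly tp; near=> M.
have Lp := L2D_trigpoly tp; have Lfp := L2DB mD Lf Lp.
rewrite ger0_norm ?nrm_ge0//; apply: le_lt_trans pe.
rewrite (_ : (fun x => f x - fsum M f x) =
    fun x => (f x - p x) - fsum M (fun y => f y - p y) x).
  exact: le_nrm_fsum.
apply/funext => x.
rewrite (_ : (fun y => f y - p y) = fun y => f y + (-1) * p y); last first.
  by apply/funext => y; rewrite mulN1r.
rewrite fsumD//; last exact: L2DZ.
rewrite fsumZ// hM; last by near: M; exact: nbhs_infty_ge.
by ring.
Unshelve. all: by end_near. Qed.

Theorem parseval f : L2D D f ->
  (fun M => \sum_(i < (M + M).+1) sq (coef f (i%:Z - M%:Z))) @ \oo --> T * nrm D f.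
Proof.
move=> Lf; have T0 : T != 0 by rewrite gt_eqF// T_gt0.
rewrite (_ : (fun M => _) =
    fun M => T * (nrm D f - nrm D (fun x => f x - fsum M f x))); last first.
  by apply/funext => M; rewrite nrm_fsum//; field.
rewrite -[in X in _ --> X](subr0 (nrm D f)).
apply: cvgMr; apply: cvgB; first exact: cvg_cst.
exact: sqn_fsum_cvg.
Qed.

End FourierSeries.

(** * Translations and periodization *)

Section Translation.
Variable R : realType.
Local Notation mu := (@lebesgue_measure R).
Local Notation C := (R[i]).

Lemma measurable_shift (c : R) : measurable_fun setT (fun x : R => x + c).
Proof.
by apply: measurable_funD; [exact: measurable_id|exact: measurable_cst].
Qed.

(** The pushforward by a translation agrees with Lebesgue measure on half-open intervals, and this
    determines it. *)
Lemma lebesgue_measure_shift (c : R) (A : set R) : measurable A ->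
  mu ((fun x => x + c) @^-1` A) = mu A.
Proof.
move=> mA.
pose sh := (fun x : R => x + c) : measurableTypeR R -> measurableTypeR R.
have msh : measurable_fun setT sh by exact: measurable_shift.
change (pushforward mu sh A = mu A).
apply/esym/lebesgue_measure_unique => //= _ [[a b]] _ <-.
rewrite /pushforward /sh /= (_ : (fun x => x + c) @^-1` _ = `]a - c, b - c]%classic).
  rewrite !lebesgue_measure_itv/= !lte_fin ltrD2r -!EFinB.
  by rewrite (_ : b - c - (a - c) = b - a)//; ring.
by apply/seteqP; split => x /=; rewrite !in_itv/= ltrBlDr lerBrDr.
Qed.

Lemma ge0_integral_shift (c : R) (D : set R) (f : R -> \bar R) : measurable D ->
  measurable_fun D f -> (forall x, (0 <= f x)%E) ->
  (\int[mu]_(x in (fun x : R => x + c)%R @^-1` D) f (x + c)%R = \int[mu]_(x in D) f x)%E.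
Proof.
move=> mD mf f0.
pose sh := (fun x : R => x + c) : measurableTypeR R -> measurableTypeR R.
have msh : measurable_fun setT sh by exact: measurable_shift.
rewrite -[LHS](@ge0_integral_pushforward _ _ _ _ _ sh msh mu D f)//; last first.
by apply: eq_measure_integral => //= A mA AS; exact: lebesgue_measure_shift.
Qed.

Lemma ae_shift (c : R) (P : R -> Prop) :
  {ae mu, forall x, P x} -> {ae mu, forall x, P (x + c)}.
Proof.
move=> [N [mN N0 PN]]; exists ((fun x => x + c) @^-1` N); split.
- by rewrite -[X in measurable X]setTI; exact: measurable_shift.
- by rewrite -[RHS]N0; exact: lebesgue_measure_shift.
- by move=> x /= Px; apply: PN.
Qed.

Lemma ae_forall_int (P : int -> R -> Prop) :
  (forall n, {ae mu, forall x, P n x}) -> {ae mu, forall x, forall n, P n x}.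
Proof.
move=> H; have h1 := ae_foralln (fun n : nat => H n%:Z).
have h2 := ae_foralln (fun n : nat => H (- n%:Z)).
apply: aeS2 h1 h2 => x H1 H2 [] n; first exact: H1.
by rewrite NegzE; exact: H2.
Qed.

(** A countable union of translated null sets is null. This gives access to a whole coset x + h Z at
    once, as the matrices of the frame operator require. *)
Lemma ae_lattice (h : R) (P : R -> Prop) :
  {ae mu, forall x, P x} -> {ae mu, forall x, forall n : int, P (x + n%:~R * h)}.
Proof. by move=> H; apply: ae_forall_int => n; exact: ae_shift. Qed.

Lemma integral_periodize (h : R) (g : R -> \bar R) (m n : nat) : 0 < h ->
  measurable_fun setT g -> (forall x, (0 <= g x)%E) ->
  (\int[mu]_(x in `[0%R, h[) \sum_(i < n) g (x + (i%:Z - m%:Z)%:~R * h)%R =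
   \int[mu]_(x in `[((- m%:Z)%:~R * h)%R, ((n%:Z - m%:Z)%:~R * h)%R[%classic) g x)%E.
Proof.
move=> h0 mg g0.
rewrite ge0_integral_sum//; last first.
  move=> i; apply: measurable_funTS.
  by apply: (measurableT_comp mg); exact: measurable_shift.
elim: n => [|n IH].
  by rewrite big_ord0 sub0r set_itvco0 integral_set0.
rewrite big_ord_recr/= IH.
rewrite (_ : `[(- m%:Z)%:~R * h, (n.+1%:Z - m%:Z)%:~R * h[%classic =
  `[(- m%:Z)%:~R * h, (n%:Z - m%:Z)%:~R * h[%classic `|`
  `[(n%:Z - m%:Z)%:~R * h, (n.+1%:Z - m%:Z)%:~R * h[%classic); last first.
  rewrite -itv_bndbnd_setU// bnd_simp ler_wpM2r ?(ltW h0)// ler_int; lia.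
rewrite ge0_integral_setU//; last 2 first.
- exact: measurable_funTS.
- apply/disj_setPS => x [] /=; rewrite !in_itv/= => /andP[_ h1] /andP[h2 _].
  by move: (le_lt_trans h2 h1); rewrite ltxx.
congr (_ + _)%E.
rewrite -[RHS](ge0_integral_shift ((n%:Z - m%:Z)%:~R * h))//; last exact: measurable_funTS.
have E : (n.+1%:Z - m%:Z)%:~R = (n%:Z - m%:Z)%:~R + 1 :> R.
  by rewrite -addn1 PoszD addrAC rmorphD.
rewrite E mulrDl mul1r; set z := _ * h.
congr (integral _ _ _); apply/seteqP; split => x /=; rewrite !in_itv/= => /andP[h1 h2];
  apply/andP; split; lra.
Qed.

(** The sum over |k| <= M integrates g over [-M h, (M + 1) h[, and these intervals increase to the
    line. *)
Lemma integral_lattice (h : R) (g : R -> \bar R) : 0 < h ->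
  measurable_fun setT g -> (forall x, (0 <= g x)%E) ->
  (fun M : nat => \int[mu]_(x in `[0%R, h[)
      \sum_(i < (M + M).+1) g (x + (i%:Z - M%:Z)%:~R * h)%R)%E @ \oo -->
  (\int[mu]_x g x)%E.
Proof.
move=> h0 mg g0.
pose F (M : nat) : set R :=
  `[(- M%:Z)%:~R * h, ((M + M).+1%:Z - M%:Z)%:~R * h[%classic.
rewrite (_ : (fun M : nat => _) = fun M => \int[mu]_(x in F M) g x)%E; last first.
  by apply/funext => M; rewrite integral_periodize.
have <- : \bigcup_M F M = setT; last first.
  apply: ge0_nondecreasing_set_cvg_integral => //.
  - move=> M N MN; rewrite subsetEset; apply: subset_itv; rewrite bnd_simp.
      by rewrite ler_wpM2r ?(ltW h0)// ler_int; lia.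
    by rewrite ler_wpM2r ?(ltW h0)// ler_int; lia.
  - by move=> M; exact: measurable_itv.
  - by move=> M; exact: measurable_funTS.
apply/seteqP; split => // x _.
exists (absz (Num.floor (`|x| / h)) + 1)%N => //=.
have xh : `|x| < (absz (Num.floor (`|x| / h)) + 1)%:R * h.
  rewrite -ltr_pdivrMr// natrD.
  have fl0 : (0 <= Num.floor (`|x| / h))%R by rewrite floor_ge0 divr_ge0// ltW.
  by have := floorD1_gt (`|x| / h); rewrite rmorphD/= natr_absz (ger0_norm fl0).
move: xh; set k := (_ + 1)%N; move: k => k xh.
rewrite /F/= in_itv/= rmorphN/= mulNr.
have xk : x < k%:R * h by apply: le_lt_trans (ler_norm _) xh.
have xk' : - (k%:R * h) < x by rewrite ltrNl; apply: le_lt_trans xh; rewrite -normrN ler_norm.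
rewrite ltW//=; apply: lt_trans xk _.
have -> : (k + k).+1%:Z - k%:Z = k%:Z + 1 by lia.
by rewrite ltr_pM2r// intrD ltrDl.
Qed.

End Translation.

(** * The Fourier transform of compactly supported functions *)

Section Plancherel.
Variable R : realType.
Local Notation Re := (@complex.Re R).
Local Notation Im := (@complex.Im R).
Local Notation mu := (@lebesgue_measure R).
Local Notation C := (R[i]).
Implicit Types (f g u v G : R -> C).

(** On this class the transform is an absolutely convergent integral. It contains the truncations of
    L^2 functions as well as, after a change on a null set, the transforms of band-limited
    functions. *)
Definition csupp u := L2D setT u /\ exists S : R, forall x, S < `|x| -> u x = 0.

Let mT : measurable (setT : set R) := measurableT.

Lemma csupp_comb2 (k : C -> C -> C) u v : k 0 0 = 0 ->
  L2D setT (fun x => k (u x) (v x)) -> csupp u -> csupp v ->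
  csupp (fun x => k (u x) (v x)).
Proof.
move=> k0 L [Lu [S uS]] [Lv [S' vS]]; split => //.
exists (Num.max S S') => x; rewrite gt_max => /andP[h1 h2].
by rewrite uS// vS.
Qed.

Lemma csuppD u v : csupp u -> csupp v -> csupp (fun x => u x + v x).
Proof.
by move=> cu cv; apply: (@csupp_comb2 (fun z w => z + w)); rewrite ?addr0//;
  apply: L2DD => //; [exact: cu.1|exact: cv.1].
Qed.

Lemma csuppB u v : csupp u -> csupp v -> csupp (fun x => u x - v x).
Proof.
by move=> cu cv; apply: (@csupp_comb2 (fun z w => z - w)); rewrite ?subr0//;
  apply: L2DB => //; [exact: cu.1|exact: cv.1].
Qed.

Lemma csuppZ (z : C) u : csupp u -> csupp (fun x => z * u x).
Proof.
by move=> cu; apply: (@csupp_comb2 (fun w _ => z * w) u u); rewrite ?mulr0//;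
  apply: L2DZ => //; exact: cu.1.
Qed.

Lemma csuppJ u : csupp u -> csupp (fun x => conjc (u x)).
Proof.
move=> cu; apply: (@csupp_comb2 (fun w _ => conjc w) u u) => //; first exact: conjc0.
by apply: L2DJ => //; exact: cu.1.
Qed.

Lemma csupp0 : csupp (fun=> 0).
Proof. by split; [exact: L2D0|exists 0]. Qed.

Lemma csupp_sum I (s : seq I) (F : I -> R -> C) :
  (forall i, csupp (F i)) -> csupp (fun x => \sum_(i <- s) F i x).
Proof.
move=> cF; elim: s => [|i s IH].
  rewrite (_ : (fun x => _) = fun=> 0); first exact: csupp0.
  by apply/funext => x; rewrite big_nil.
rewrite (_ : (fun x => _) = fun x => F i x + \sum_(j <- s) F j x).
  exact: csuppD.
by apply/funext => x; rewrite big_cons.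
Qed.

Lemma csupp_mul_bounded u g (K : R) : csupp u -> cmeas g -> (forall x, sq (g x) <= K) ->
  csupp (fun x => g x * u x).
Proof.
move=> [[mu_ Lu] [S uS]] mg gK; split; last by exists S => x /uS ->; rewrite mulr0.
split; first exact: cmeasM.
apply: (@le_lt_trans _ _ (K%:E * sqn setT u)%E); last first.
  apply: lte_mul_pinfty => //; rewrite lee_fin.
  exact: le_trans (sq_ge0 (g 0)) (gK 0).
rewrite /sqn -ge0_integralZl//; first last.
- by rewrite lee_fin (le_trans (sq_ge0 (g 0))).
- by move=> x _; rewrite lee_fin sq_ge0.
- exact: measurable_Esq.
apply: ge0_le_integral => //.
- by move=> x _; rewrite lee_fin sq_ge0.
- by apply: measurable_Esq; exact: cmeasM.
- by apply: measurable_funeM; exact: measurable_Esq.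
- by move=> x _; rewrite -EFinM lee_fin sqM ler_wpM2r// sq_ge0.
Qed.

Lemma csupp_interval u : csupp u ->
  exists2 S : R, 0 < S & forall x, x \notin `]- S, S[%classic -> u x = 0.
Proof.
move=> [_ [S uS]]; exists (`|S| + 1); first by have := normr_ge0 S; lra.
move=> x; rewrite mem_setE in_itv/= => h; apply: uS.
rewrite ltNge; apply: contra h => h; rewrite -ltr_norml.
by have := ler_norm S; lra.
Qed.

Lemma cabs_le_sq (z : C) : cabs z <= 1 + sq z.
Proof. by rewrite /sq; set t := cabs z; have := sqr_ge0 (t - 1); nra. Qed.

(** |u| <= 1 + |u|^2 on a bounded interval containing the support: L^2 is contained in L^1 there,
    with one dominating function that serves for continuity under the integral and for Fubini's
    theorem. *)
Lemma csupp_bound u : csupp u -> exists p : R -> R,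
  mu.-integrable setT (EFin \o p) /\ forall x, cabs (u x) <= p x.
Proof.
move=> cu; have [S S0 uS] := csupp_interval cu.
exists (fun x => sq (u x) + \1_(`]- S, S[%classic) x); split.
  pose i1 : R -> R := \1_(`]- S, S[%classic).
  rewrite (_ : _ \o _ = (EFin \o (fun x => sq (u x))) \+ (EFin \o i1))%E//.
  apply: integrableD => //; first by apply: L2D_integrable_sq => //; exact: cu.1.
  exact: integrable_indic_itv.
move=> x; rewrite indicE; case: (boolP (x \in _)) => [_|/uS ->].
  by rewrite addrC; exact: cabs_le_sq.
by rewrite sq0 /cabs Normc.normc0 addr0.
Qed.

Lemma csupp_CInt u g : csupp u -> cmeas g -> (forall x, sq (g x) <= 1) ->
  CInt setT (fun x => u x * g x).
Proof.
move=> cu mg g1; have [p [ip up]] := csupp_bound cu.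
apply: (CInt_le _ _ ip) => //; first by apply: cmeasM => //; exact: cu.1.1.
move=> x _; apply: le_trans (up x); rewrite /cabs Normc.normcM.
rewrite ler_piMr//; first by case: (u x) => ? ?; exact: sqrtr_ge0.
have : sq (g x) <= 1 by [].
rewrite /sq /cabs; set t := Normc.normc _.
have : 0 <= t by rewrite /t; case: (g x) => ? ?; exact: sqrtr_ge0.
nra.
Qed.

(** * The transform and its inverse as integrals *)

Local Notation kappa := ((Num.sqrt (2 * pi))^-1)%:C.

Lemma fourierL1E u xi : fourierL1 u xi =
  kappa * cint setT (fun t => u t * cis (- (t * xi))).
Proof. by []. Qed.

Definition fourierL1inv G : R -> C := fun t =>
  kappa * cint setT (fun xi => G xi * cis (t * xi)).

Lemma fourierL1inv_int G t : fourierL1inv G t =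
  kappa * cint setT (fun xi => G xi * cis (t * xi)).
Proof. by []. Qed.

Opaque fourierL1 fourierL1inv.

Lemma cmeas_cisNM (x : R) : cmeas (fun t : R => cis (- (t * x)) : C).
Proof.
rewrite (_ : (fun t => _) = fun t => cis ((- x) * t)); first exact: cmeas_cis.
by apply/funext => t; rewrite mulNr mulrC.
Qed.

Lemma CInt_fourier u xi : csupp u -> CInt setT (fun t => u t * cis (- (t * xi))).
Proof.
move=> cu; apply: csupp_CInt => //; first exact: cmeas_cisNM.
by move=> x; rewrite sq_cis.
Qed.

Lemma fourierL1D u v xi : csupp u -> csupp v ->
  fourierL1 (fun x => u x + v x) xi = fourierL1 u xi + fourierL1 v xi.
Proof.
move=> cu cv; rewrite !fourierL1E -mulrDr -cintD//; try exact: CInt_fourier.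
by congr (_ * _); apply: eq_cint => x _; rewrite mulrDl.
Qed.

Lemma fourierL1Z (z : C) u xi : csupp u ->
  fourierL1 (fun x => z * u x) xi = z * fourierL1 u xi.
Proof.
move=> cu; rewrite !fourierL1E mulrCA; congr (_ * _).
rewrite -(cintZ z mT (CInt_fourier xi cu)).
by apply: eq_cint => x _; rewrite mulrA.
Qed.

Lemma fourierL1B u v xi : csupp u -> csupp v ->
  fourierL1 (fun x => u x - v x) xi = fourierL1 u xi - fourierL1 v xi.
Proof.
move=> cu cv; rewrite -[in RHS]mulN1r -fourierL1Z// -fourierL1D//; last exact: csuppZ.
rewrite (_ : (fun x => _) = fun x => u x + -1 * v x)//.
by apply/funext => x; rewrite mulN1r.
Qed.

(** Through this conjugation every property of the inverse transform follows from one of the direct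
    transform. *)
Lemma fourierL1invE G t : csupp G ->
  fourierL1inv G t = conjc (fourierL1 (fun x => conjc (G x)) t).
Proof.
move=> cG; have E := cintJ mT (CInt_fourier t (csuppJ cG)).
have F := fourierL1E (fun x => conjc (G x)) t; rewrite F.
rewrite conjcM -E fourierL1inv_int.
congr (_ * _).
  by apply/eqP; rewrite eq_complex /= oppr0 !eqxx.
by apply: eq_cint => x _; rewrite conjcM conjcK -cisN opprK [t * x]mulrC.
Qed.

(** The transform is even continuous, by dominated convergence. Its real and imaginary parts are
    both multiples of integrals of A(t) cos(t xi) + B(t) sin(t xi), with (A, B) = (Re u, Im u) and
    (Im u, - Re u). *)
Lemma cmeas_fourierL1 u : csupp u -> cmeas (fourierL1 u).
Proof.
move=> cu.
have H (A B : R -> R) : measurable_fun setT A -> measurable_fun setT B ->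
    (forall x, `|A x| <= cabs (u x)) -> (forall x, `|B x| <= cabs (u x)) ->
    measurable_fun setT (fun xi => \int[mu]_t (A t * cos (t * xi) + B t * sin (t * xi))).
  move=> mA mB Au Bu; have [p [ip up]] := csupp_bound cu.
  have mcs (k : R -> R) (x : R) : continuous k -> measurable_fun setT (fun t : R => k (t * x)).
    move=> ck; apply: continuous_measurable_fun => t.
    by apply: continuous_comp; [exact: mulrr_continuous|exact: ck].
  have mAB x : measurable_fun setT (fun t => A t * cos (t * x) + B t * sin (t * x)).
    apply: measurable_funD; apply: measurable_funM => //; apply: mcs.
      exact: continuous_cos.
    exact: continuous_sin.
  have bd x t : `|A t * cos (t * x) + B t * sin (t * x)| <= 2 * p t.
    apply: (le_trans (ler_normD _ _)); rewrite !normrM.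
    have := cos_max (t * x); have := sin_max (t * x); have := Au t; have := Bu t.
    have := up t; have := normr_ge0 (A t); have := normr_ge0 (B t).
    have := normr_ge0 (cos (t * x)); have := normr_ge0 (sin (t * x)); nra.
  have ip2 : mu.-integrable setT (EFin \o (fun x => 2 * p x)) by exact: integrable_mulE.
  apply: continuous_measurable_fun => x.
  apply: (@continuity_under_integral R _ _ mu
    (fun xi t => A t * cos (t * xi) + B t * sin (t * xi)) setT measurableT
    (x - 1) (x + 1) _ _ (fun t => 2 * p t) ip2 _ x).
  - move=> xi _; apply: le_integrable ip2 => //; first by apply/measurable_EFinP; exact: mAB.
    by move=> t _ /=; rewrite lee_fin (le_trans (bd xi t))// ler_norm.
  - apply: aeW => t _ xi _; apply: cvgD; apply: cvgM; try exact: cvg_cst.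
      by apply: continuous_comp; [exact: mulrl_continuous|exact: continuous_cos].
    by apply: continuous_comp; [exact: mulrl_continuous|exact: continuous_sin].
  - by move=> xi _; apply: aeW => t _; exact: bd.
  - by rewrite inE/= in_itv/=; apply/andP; split; lra.
have aRe z : `|Re z| <= cabs z.
  by case: z => a b /=; rewrite /cabs /= -(sqrtr_sqr a) ler_wsqrtr// lerDl sqr_ge0.
have aIm z : `|Im z| <= cabs z.
  by case: z => a b /=; rewrite /cabs /= -(sqrtr_sqr b) ler_wsqrtr// lerDr sqr_ge0.
have [m1 m2] := cu.1.1.
rewrite (_ : fourierL1 u = fun xi => kappa * cint setT (fun t => u t * cis (- (t * xi)))); last first.
  by apply/funext => xi; exact: fourierL1E.
apply: cmeasM; first exact: cmeas_cst.
split.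
- rewrite (_ : _ \o _ = fun xi => \int[mu]_t ((Re \o u) t * cos (t * xi) + (Im \o u) t * sin (t * xi))).
    by apply: H => // x; rewrite /= ?aRe ?aIm.
  apply/funext => xi /=; apply: eq_Rintegral => t _; rewrite /cis cosN sinN.
  by case: (u t) => a b /=; ring.
- rewrite (_ : _ \o _ = fun xi => \int[mu]_t ((Im \o u) t * cos (t * xi) + (- (Re \o u) t) * sin (t * xi))).
    apply: H => // [|x|x]; rewrite /= ?normrN ?aRe ?aIm//.
    exact: measurable_funN.
  apply/funext => xi /=; apply: eq_Rintegral => t _; rewrite /cis cosN sinN.
  by case: (u t) => a b /=; ring.
Qed.

Lemma sq_kappa : sq (kappa : C) = (2 * pi)^-1.
Proof.
rewrite sq_real exprVn sqr_sqrtr//.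
by rewrite mulr_ge0// pi_ge0.
Qed.

(** Since u vanishes outside ]-S, S[, the integral extends to the line and the exponents add: the
    coefficients are samples of the transform. *)
Lemma coef_fourier u (S xi : R) n : 0 < S -> csupp u ->
  (forall x, x \notin `]- S, S[%classic -> u x = 0) ->
  kappa * coef (- S) S (fun t => u t * cis (- (t * xi))) n =
  fourierL1 u (xi + n%:~R * (2 * pi / (S - - S))).
Proof.
move=> S0 cu uS; rewrite fourierL1E /coef /ip; congr (_ * _).
rewrite cint_mkcond; apply: eq_cint => t _; rewrite /expi -cisN; case: ifPn => [_|/uS ->].
  by rewrite -mulrA -cisD; congr (_ * cis _); ring.
by rewrite mul0r.
Qed.

Lemma sqn_support u (S : R) (g : R -> C) :
  (forall x, x \notin `]- S, S[%classic -> u x = 0) -> (forall x, sq (g x) = 1) ->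
  sqn `]- S, S[ (fun x => u x * g x) = sqn setT u.
Proof.
move=> uS g1; rewrite sqn_mkcond; apply: eq_sqn => x _; case: ifPn => [_|/uS ->//].
by rewrite sqM g1 mulr1.
Qed.

Lemma L2D_support u (S : R) (g : R -> C) : csupp u -> cmeas g ->
  (forall x, x \notin `]- S, S[%classic -> u x = 0) -> (forall x, sq (g x) = 1) ->
  L2D `]- S, S[ (fun x => u x * g x).
Proof.
move=> cu mg uS g1; split; first by apply: cmeasM => //; exact: cu.1.1.
by rewrite sqn_support//; exact: cu.1.2.
Qed.

(* Parseval's identity on ]-S, S[ for the function t |-> u(t) exp(-i t xi). *)
Lemma plancherel_lattice u (S xi : R) : 0 < S -> csupp u ->
  (forall x, x \notin `]- S, S[%classic -> u x = 0) ->
  let th := 2 * pi / (S - - S) in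
  let s := fun M : nat => \sum_(i < (M + M).+1) sq (fourierL1 u (xi + (i%:Z - M%:Z)%:~R * th)) in
  (forall M, s M <= th^-1 * nrm setT u) /\ s @ \oo --> th^-1 * nrm setT u.
Proof.
move=> S0 cu uS th s; have SS : - S < S by lra.
have g1 x : sq (cis (- (x * xi)) : C) = 1 by rewrite sq_cis.
set v := (fun t => u t * cis (- (t * xi))).
have Lv : L2D `]- S, S[ v by apply: L2D_support => //; exact: cmeas_cisNM.
have E : (S - - S) * nrm `]- S, S[ v * (2 * pi)^-1 = th^-1 * nrm setT u.
  have p0 : (pi : R) != 0 by rewrite gt_eqF ?pi_gt0.
  have S2 : S - - S != 0 by rewrite gt_eqF//; lra.
  rewrite /nrm sqn_support// /th; move: (pi : R) p0 => P p0; field.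
  by rewrite S2 p0.
have sE M : s M = (2 * pi)^-1 * \sum_(i < (M + M).+1) sq (coef (- S) S v (i%:Z - M%:Z)).
  by rewrite mulr_sumr; apply: eq_bigr => i _; rewrite -coef_fourier// sqM sq_kappa.
split.
  move=> M; rewrite sE -E mulrC; apply: ler_wpM2r.
    by rewrite invr_ge0 mulr_ge0// pi_ge0.
  have := nrm_ge0 `]- S, S[ (fun x => v x - fsum (- S) S M v x).
  have SS0 : 0 < S - - S by lra.
  by rewrite nrm_fsum// subr_ge0 mulrC ler_pdivrMr// mulrC.
rewrite (_ : s = fun M => (2 * pi)^-1 *
    \sum_(i < (M + M).+1) sq (coef (- S) S v (i%:Z - M%:Z))); last exact/funext.
rewrite -E (mulrC _ (2 * pi)^-1); apply: cvgMr; exact: parseval.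
Qed.

(* Integrate plancherel_lattice over one period in xi. *)
Lemma sqn_fourierL1 u : csupp u -> sqn setT (fourierL1 u) = sqn setT u.
Proof.
move=> cu; have [S S0 uS] := csupp_interval cu.
set th := 2 * pi / (S - - S).
have th0 : 0 < th by rewrite divr_gt0 ?mulr_gt0 ?pi_gt0//; lra.
have mF := cmeas_fourierL1 cu.
have := @integral_lattice R th (fun x => (sq (fourierL1 u x))%:E) th0
  (measurable_Esq mF) (fun x => _).
move=> /(_ (fun x => sq_ge0 _)) H1.
set c := th^-1 * nrm setT u.
have c0 : 0 <= c by rewrite mulr_ge0 ?nrm_ge0// invr_ge0 ltW.
have ic : mu.-integrable (`[0%R, th[%classic : set R) (EFin \o cst c).
  apply: measurable_bounded_integrable => //; last exact: bounded_cst.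
  change (mu (`[0%R, th[%classic : set R) < +oo)%E; rewrite lebesgue_measure_itv/= lte_fin th0.
  by rewrite -EFinB ltry.
pose s (M : nat) (x : R) : \bar R :=
  (\sum_(i < (M + M).+1) (sq (fourierL1 u (x + (i%:Z - M%:Z)%:~R * th)))%:E)%E.
have sE M x : s M x = (\sum_(i < (M + M).+1) sq (fourierL1 u (x + (i%:Z - M%:Z)%:~R * th)))%:E.
  by rewrite /s sumEFin.
have ms M : measurable_fun (`[0%R, th[%classic : set R) (s M).
  apply: emeasurable_sum => i; apply/measurable_EFinP; apply: measurable_funTS.
  by apply: measurable_sq; apply: cmeas_comp => //; exact: measurable_shift.
(* The partial sums are bounded by their limit c, which does not depend on xi, so the limit passes
   under the integral; c times the period is the squared norm of u. *)
have [] := @dominated_convergence _ _ _ mu (`[0%R, th[%classic : set R)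
  (measurable_itv _) s (EFin \o cst c) (EFin \o cst c) ms (measurable_int mu ic) _ ic.
- apply: aeW => x _; have [_] := plancherel_lattice x S0 cu uS.
  rewrite -/th => h; rewrite (_ : s^~ x = fun M => (\sum_(i < (M + M).+1)
    sq (fourierL1 u (x + (i%:Z - M%:Z)%:~R * th)))%:E).
    by apply: cvg_EFin; [exact: nearW|exact: h].
  by apply/funext => M; exact: sE.
- apply: aeW => x M _; have [h _] := plancherel_lattice x S0 cu uS.
  rewrite sE /= lee_fin ger0_norm ?h//.
  by apply: sumr_ge0 => i _; exact: sq_ge0.
move=> _ _ H2.
have : (\int[mu]_(x in `[0%R, th[) (EFin \o cst c) x)%E = sqn setT u.
  have -> : EFin \o cst c = cst c%:E by [].
  rewrite integral_cst//= lebesgue_measure_itv/= lte_fin th0 sube0 -EFinM /c.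
  by rewrite mulrAC mulVf ?gt_eqF// mul1r nrmE//; exact: cu.1.
move=> <-; apply: (cvg_unique _ H1 H2); exact: ereal_hausdorff.
Qed.

Lemma L2D_fourierL1 u : csupp u -> L2D setT (fourierL1 u).
Proof.
by move=> cu; split; [exact: cmeas_fourierL1|rewrite sqn_fourierL1//; exact: cu.1.2].
Qed.

Lemma nrm_fourierL1 u : csupp u -> nrm setT (fourierL1 u) = nrm setT u.
Proof. by move=> cu; rewrite /nrm sqn_fourierL1. Qed.

(** Polarization: [nrmB] yields the real part of the inner product, and the real part for (u, i v)
    is the imaginary part for (u, v). *)
Lemma ip_fourierL1 u v : csupp u -> csupp v ->
  ip setT (fourierL1 u) (fourierL1 v) = ip setT u v.
Proof.
have HRe f g : csupp f -> csupp g ->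
    Re (ip setT (fourierL1 f) (fourierL1 g)) = Re (ip setT f g).
  move=> cf cg; have := nrm_fourierL1 (csuppB cf cg).
  rewrite (_ : fourierL1 _ = fun x => fourierL1 f x - fourierL1 g x); last first.
    by apply/funext => x; exact: fourierL1B.
  rewrite !nrmB//; [|exact: cf.1|exact: cg.1|exact: L2D_fourierL1|exact: L2D_fourierL1].
  rewrite (nrm_fourierL1 cf) (nrm_fourierL1 cg); lra.
move=> cu cv; have := HRe u v cu cv.
have := HRe u (fun x => 'i%C * v x) cu (csuppZ _ cv).
rewrite (_ : fourierL1 (fun x => 'i%C * v x) = fun x => 'i%C * fourierL1 v x); last first.
  by apply/funext => x; exact: fourierL1Z.
rewrite (ipZr _ mT cv.1 cu.1) (ipZr _ mT (L2D_fourierL1 cv) (L2D_fourierL1 cu)).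
case: (ip _ _ _) (ip _ _ _) => [a b] [c d] /=.
rewrite !mul0r !sub0r !mulN1r !opprK => -> ->.
by [].
Qed.

Lemma L2D_fourierL1inv G : csupp G -> L2D setT (fourierL1inv G).
Proof.
move=> cG; rewrite (_ : fourierL1inv G = fun t => conjc (fourierL1 (fun x => conjc (G x)) t)).
  by apply: L2DJ; apply: L2D_fourierL1; exact: csuppJ.
by apply/funext => t; exact: fourierL1invE.
Qed.

Lemma ip_fourierL1inv u v : csupp u -> csupp v ->
  ip setT (fourierL1inv u) (fourierL1inv v) = ip setT u v.
Proof.
have ipJ f g : ip setT (fun x => conjc (f x)) (fun x => conjc (g x)) = ip setT g f.
  by apply: eq_cint => x _; rewrite conjcK mulrC.
move=> cu cv.
rewrite (_ : fourierL1inv u = fun t => conjc (fourierL1 (fun x => conjc (u x)) t)); last first.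
  by apply/funext => t; exact: fourierL1invE.
rewrite (_ : fourierL1inv v = fun t => conjc (fourierL1 (fun x => conjc (v x)) t)); last first.
  by apply/funext => t; exact: fourierL1invE.
by rewrite ipJ ip_fourierL1 ?ipJ//; exact: csuppJ.
Qed.

Lemma sqn_fourierL1inv u : csupp u -> sqn setT (fourierL1inv u) = sqn setT u.
Proof.
move=> cu; rewrite -!nrmE; [|exact: cu.1|exact: L2D_fourierL1inv].
by have := ip_fourierL1inv cu cu; rewrite !ip_nrm => /(congr1 Re) /= ->.
Qed.

Lemma fourierL1invD u v xi : csupp u -> csupp v ->
  fourierL1inv (fun x => u x + v x) xi = fourierL1inv u xi + fourierL1inv v xi.
Proof.
move=> cu cv; rewrite !fourierL1invE//; last exact: csuppD.
rewrite -conjcD -fourierL1D; [|exact: csuppJ|exact: csuppJ].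
rewrite (_ : (fun x => conjc (u x + v x)) = fun x => conjc (u x) + conjc (v x))//.
by apply/funext => x; rewrite conjcD.
Qed.

Lemma fourierL1invZ (z : C) u xi : csupp u ->
  fourierL1inv (fun x => z * u x) xi = z * fourierL1inv u xi.
Proof.
move=> cu; rewrite !fourierL1invE//; last exact: csuppZ.
rewrite -[z in RHS]conjcK -conjcM -fourierL1Z; last exact: csuppJ.
rewrite (_ : (fun x => conjc (z * u x)) = fun x => conjc z * conjc (u x))//.
by apply/funext => x; rewrite conjcM.
Qed.

Lemma fourierL1invB u v xi : csupp u -> csupp v ->
  fourierL1inv (fun x => u x - v x) xi = fourierL1inv u xi - fourierL1inv v xi.
Proof.
move=> cu cv; rewrite -[in RHS]mulN1r -fourierL1invZ// -fourierL1invD//; last exact: csuppZ.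
rewrite (_ : (fun x => _) = fun x => u x + -1 * v x)//.
by apply/funext => x; rewrite mulN1r.
Qed.

Lemma fourierL1inv_shift G (a t : R) :
  fourierL1inv G (t + a) = fourierL1inv (fun x => cis (a * x) * G x) t.
Proof.
rewrite !fourierL1inv_int; congr (_ * _); apply: eq_cint => x _.
by rewrite mulrDl cisD; ring.
Qed.

(** * Fubini's theorem and the adjoint of the transform *)

Lemma Rintegral_fubini (K : R * R -> R) (P Q : R -> R) : measurable_fun setT K ->
  mu.-integrable setT (EFin \o P) -> mu.-integrable setT (EFin \o Q) ->
  (forall z, `|K z| <= P z.1 * Q z.2) ->
  \int[mu]_x \int[mu]_y K (x, y) = \int[mu]_y \int[mu]_x K (x, y).
Proof.
move=> mK iP iQ KPQ.
have mEK : measurable_fun setT (EFin \o K) by exact/measurable_EFinP.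
have iPx x : mu.-integrable setT (EFin \o (fun y => K (x, y))).
  apply: (@le_integrable _ _ _ mu setT measurableT _ (EFin \o (fun y => P x * Q y))) => //.
  - by apply/measurable_EFinP; apply: measurableT_comp => //; exact: measurable_pair1.
  - by move=> y _ /=; rewrite lee_fin (le_trans (KPQ (x, y)))// ler_norm.
  - exact: integrable_mulE.
have iQy y : mu.-integrable setT (EFin \o (fun x => K (x, y))).
  apply: (@le_integrable _ _ _ mu setT measurableT _ (EFin \o (fun x => Q y * P x))) => //.
  - by apply/measurable_EFinP; apply: measurableT_comp => //; exact: measurable_pair2.
  - by move=> x _ /=; rewrite lee_fin mulrC (le_trans (KPQ (x, y)))// ler_norm.
  - exact: integrable_mulE.
have iK : (mu \x mu)%E.-integrable setT (EFin \o K).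
  apply/(integrable12ltyP mu mu mEK).
  apply: (@le_lt_trans _ _ (\int[mu]_x (`|P x|%:E * \int[mu]_y `|(Q y)%:E|))%E).
    apply: ge0_le_integral => //.
    - by move=> x _; exact: integral_ge0.
    - apply: (@measurable_fun_fubini_tonelli_F _ _ _ _ _ mu (fun z => `|(K z)%:E|%E)) => //.
      exact: measurableT_comp.
    - apply: emeasurable_funM => //; apply: measurableT_comp => //.
      apply: measurableT_comp => //; apply/measurable_EFinP; exact: (measurable_int mu iP).
    - move=> x _; rewrite -ge0_integralZl//.
      + apply: ge0_le_integral => //.
        * by apply: measurableT_comp => //; exact: (measurable_int mu (iPx x)).
        * by apply: measurable_funeM; apply: measurableT_comp => //; exact: (measurable_int mu iQ).
        * move=> y _; rewrite -EFinM lee_fin (le_trans (KPQ (x, y)))//= -normrM.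
          exact: ler_norm.
      + by apply: measurableT_comp => //; exact: (measurable_int mu iQ).
  have /integrableP[mQ fQ] := iQ; have /integrableP[mP fP] := iP.
  rewrite ge0_integralZr//.
  - apply: lte_mul_pinfty => //; first exact: integral_ge0.
    by rewrite ge0_fin_numE ?integral_ge0.
  - by apply/measurable_EFinP; apply: measurableT_comp => //; exact/measurable_EFinP.
  - exact: integral_ge0.
have := Fubini iK => /(congr1 fine).
rewrite /Rintegral => E.
transitivity (fine (\int[mu]_x \int[mu]_y (EFin \o K) (x, y))%E).
  congr fine; apply: eq_integral => x _; rewrite fineK//.
  exact: integrable_fin_num (iPx x).
rewrite E; congr fine; apply: eq_integral => y _; rewrite fineK//.
exact: integrable_fin_num (iQy y).
Qed.

(* Both sides are the integral of u(t) conj(G(xi)) exp(-i t xi). *)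
Lemma ip_fourierL1_adjoint u G : csupp u -> csupp G ->
  ip setT (fourierL1 u) G = ip setT u (fourierL1inv G).
Proof.
move=> cu cG.
pose k (z : R * R) : C := kappa * (u z.1 * conjc (G z.2) * cis (- (z.1 * z.2))).
suff H : cint setT (fun x => cint setT (fun t => k (t, x))) =
         cint setT (fun t => cint setT (fun x => k (t, x))).
  rewrite /ip; transitivity (cint setT (fun x => cint setT (fun t => k (t, x)))).
    apply: eq_cint => x _; rewrite fourierL1E mulrC.
    have CI := CInt_fourier x cu.
    rewrite -(cintZ _ mT CI) -(cintZ _ mT (CIntZ _ mT CI)).
    by apply: eq_cint => t _; rewrite /k /=; ring.
  rewrite H; apply: eq_cint => t _.
  rewrite (fourierL1invE t cG) conjcK fourierL1E.
  have CI := CInt_fourier t (csuppJ cG).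
  rewrite -(cintZ _ mT CI) -(cintZ _ mT (CIntZ _ mT CI)).
  by apply: eq_cint => x _; rewrite /k /= (mulrC x); ring.
set r : R := (Num.sqrt (2 * pi))^-1 in k *.
pose a := Re \o u; pose b := Im \o u; pose c := Re \o G; pose d := Im \o G.
(* p and q are the real and imaginary parts of u(t) conj(G(xi)). *)
pose p (z : R * R) : R := a z.1 * c z.2 + b z.1 * d z.2.
pose q (z : R * R) : R := b z.1 * c z.2 - a z.1 * d z.2.
have kRe z : Re (k z) = r * (p z * cos (z.1 * z.2) + q z * sin (z.1 * z.2)).
  rewrite /k /p /q /a /b /c /d /= /cis cosN sinN.
  by case: (u z.1) (G z.2) => ? ? [? ?] /=; ring.
have kIm z : Im (k z) = r * (q z * cos (z.1 * z.2) - p z * sin (z.1 * z.2)).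
  rewrite /k /p /q /a /b /c /d /= /cis cosN sinN.
  by case: (u z.1) (G z.2) => ? ? [? ?] /=; ring.
have m1 (e : R -> R) : measurable_fun setT e -> measurable_fun setT (fun z : R * R => e z.1).
  by move=> me; apply: (measurableT_comp me); exact: measurable_fst.
have m2 (e : R -> R) : measurable_fun setT e -> measurable_fun setT (fun z : R * R => e z.2).
  by move=> me; apply: (measurableT_comp me); exact: measurable_snd.
have m12 : measurable_fun setT (fun z : R * R => z.1 * z.2).
  by apply: measurable_funM; [exact: measurable_fst|exact: measurable_snd].
have mcos : measurable_fun setT (fun z : R * R => cos (z.1 * z.2)).
  apply: (measurableT_comp _ m12); apply: continuous_measurable_fun; exact: continuous_cos.
have msin : measurable_fun setT (fun z : R * R => sin (z.1 * z.2)).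
  apply: (measurableT_comp _ m12); apply: continuous_measurable_fun; exact: continuous_sin.
have [ma mb] := cu.1.1; have [mc md] := cG.1.1.
have mp : measurable_fun setT p.
  by apply: measurable_funD; apply: measurable_funM; [exact: m1|exact: m2|exact: m1|exact: m2].
have mq : measurable_fun setT q.
  by apply: measurable_funB; apply: measurable_funM; [exact: m1|exact: m2|exact: m1|exact: m2].
have mRe : measurable_fun setT (Re \o k).
  rewrite (_ : _ \o _ = fun z => r * (p z * cos (z.1 * z.2) + q z * sin (z.1 * z.2))).
    apply: measurable_funM; first exact: measurable_cst.
    by apply: measurable_funD; exact: measurable_funM.
  by apply/funext => z; exact: kRe.
have mIm : measurable_fun setT (Im \o k).
  rewrite (_ : _ \o _ = fun z => r * (q z * cos (z.1 * z.2) - p z * sin (z.1 * z.2))).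
    apply: measurable_funM; first exact: measurable_cst.
    by apply: measurable_funB; exact: measurable_funM.
  by apply/funext => z; exact: kIm.
have [P [iP uP]] := csupp_bound cu; have [Q [iQ GQ]] := csupp_bound cG.
have r0 : 0 <= r by rewrite invr_ge0 sqrtr_ge0.
have iP' : mu.-integrable setT (EFin \o (fun x => r * P x)) by exact: integrable_mulE.
have cabs_ge0 (z : C) : 0 <= cabs z by case: z => ? ?; exact: sqrtr_ge0.
have kb z : cabs (k z) <= (r * P z.1) * Q z.2.
  rewrite /k /cabs !Normc.normcM -/cabs -[leRHS]mulrA.
  have -> : Normc.normc r%:C = r by rewrite /= expr0n addr0 sqrtr_sqr ger0_norm.
  apply: ler_wpM2l => //.
  have -> : Normc.normc (cis (- (z.1 * z.2))) = 1 :> R.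
    by rewrite /= cos2Dsin2 sqrtr1.
  rewrite mulr1.
  have -> : Normc.normc (conjc (G z.2)) = cabs (G z.2).
    by case: (G z.2) => ? ?; rewrite /cabs /= sqrrN.
  by apply: ler_pM; [exact: cabs_ge0|exact: cabs_ge0|exact: uP|exact: GQ].
have aRe (z : C) : `|Re z| <= cabs z.
  by case: z => e f /=; rewrite /cabs /= -(sqrtr_sqr e) ler_wsqrtr// lerDl sqr_ge0.
have aIm (z : C) : `|Im z| <= cabs z.
  by case: z => e f /=; rewrite /cabs /= -(sqrtr_sqr f) ler_wsqrtr// lerDr sqr_ge0.
have E1 (k' : R * R -> C) : cint setT (fun x => cint setT (fun t => k' (t, x))) =
  (\int[mu]_x \int[mu]_t (Re \o k') (t, x)) +i* (\int[mu]_x \int[mu]_t (Im \o k') (t, x)) by [].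
have E2 (k' : R * R -> C) : cint setT (fun t => cint setT (fun x => k' (t, x))) =
  (\int[mu]_t \int[mu]_x (Re \o k') (t, x)) +i* (\int[mu]_t \int[mu]_x (Im \o k') (t, x)) by [].
clearbody k.
have F1 := Rintegral_fubini mRe iP' iQ (fun z => le_trans (aRe _) (kb z)).
have F2 := Rintegral_fubini mIm iP' iQ (fun z => le_trans (aIm _) (kb z)).
by rewrite E1 E2 F1 F2.
Qed.

(** * The transform on L^2 as a limit over truncations *)

Lemma csupp_truncate n f : L2D setT f -> csupp (truncate n f).
Proof.
move=> [mf Lf]; have mt : cmeas (truncate n f).
  apply: cmeas_if => //; last exact: cmeas_cst.
  apply: measurable_fun_ler; last exact: measurable_cst.
  exact: normr_measurable.
split; last by exists n%:R => x; rewrite /truncate ltNge => /negPf ->.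
split => //; apply: le_lt_trans Lf; apply: le_sqn => //; apply: aeW => x _.
by rewrite /truncate; case: ifP => _ //; rewrite sq0 sq_ge0.
Qed.

Lemma truncate_cvg f : L2D setT f ->
  (fun n => sqn setT (fun x => f x - truncate n f x)) @ \oo --> 0%E.
Proof.
move=> Lf; apply: (@sqn_dominated R setT _ (fun x => sq (f x))) => //.
- by move=> n; apply: cmeasB; [exact: Lf.1|exact: (csupp_truncate n Lf).1.1].
- exact: L2D_integrable_sq.
- apply: aeW => x n _; rewrite /truncate; case: ifP => _; last by rewrite subr0.
  by rewrite subrr sq0 sq_ge0.
- apply: aeW => x _; apply: cvg_near_cst; near=> n.
  rewrite /truncate ifT ?subrr ?sq0//.
  near: n; exists (Num.trunc `|x|).+1 => // n /= xn.
  apply/ltW/(lt_le_trans (truncnS_gt _)); by rewrite ler_nat.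
Unshelve. all: by end_near. Qed.

(* |F f_n - G|^2 = |f_n|^2 - 2 Re <f_n, f> + |f|^2 = |f - f_n|^2 *)
Lemma is_fourierL2_inv G : csupp G -> is_fourierL2 (fourierL1inv G) G.
Proof.
move=> cG; set f := fourierL1inv G; have Lf : L2D setT f by exact: L2D_fourierL1inv.
split; first by apply/L2E; exact: cG.1.
have := truncate_cvg Lf; rewrite (_ : (fun n => sqnormL2 _) =
    fun n => sqn setT (fun x => f x - truncate n f x))//.
apply/funext => n; have ct := csupp_truncate n Lf.
have LFt := L2D_fourierL1 ct.
rewrite sqnormE -(nrmE (L2DB mT Lf ct.1)) -(nrmE (L2DB mT LFt cG.1)).
congr (_ %:E); rewrite (nrmB mT Lf ct.1) (nrmB mT LFt cG.1).
rewrite (nrm_fourierL1 ct) (ip_fourierL1_adjoint ct cG) -/f.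
have -> : nrm setT G = nrm setT f by rewrite /nrm sqn_fourierL1inv.
have -> : Re (ip setT f (truncate n f)) = Re (ip setT (truncate n f) f).
  by rewrite (ipC mT Lf ct.1); case: (ip _ _ _).
ring.
Qed.

Lemma fourierL1_truncateB n f g xi : L2D setT f -> L2D setT g ->
  fourierL1 (truncate n (fun x => f x - g x)) xi =
  fourierL1 (truncate n f) xi - fourierL1 (truncate n g) xi.
Proof.
move=> Lf Lg; rewrite -fourierL1B; try exact: csupp_truncate.
rewrite (_ : truncate n _ = fun x => truncate n f x - truncate n g x)//.
by apply/funext => x; rewrite /truncate; case: ifP; rewrite ?subr0.
Qed.

Lemma cvge_le0 (a b : nat -> \bar R) : (forall n, 0 <= a n)%E ->
  (forall n, a n <= b n)%E -> b @ \oo --> 0%E -> a @ \oo --> 0%E.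
Proof.
move=> a0 ab b0; apply: (@squeeze_cvge _ _ _ _ (cst 0%E) _ b) => //; last exact: cvg_cst.
by apply: nearW => n; rewrite a0 ab.
Qed.

Lemma cvge_comb0 (a b : nat -> \bar R) : a @ \oo --> 0%E -> b @ \oo --> 0%E ->
  (fun n => 2%:E * a n + 2%:E * b n)%E @ \oo --> 0%E.
Proof.
move=> a0 b0; rewrite -[X in _ --> X](_ : 2%:E * 0 + 2%:E * 0 = 0)%E; last first.
  by rewrite mule0 add0e.
apply: cvgeD; first by rewrite mule0.
  by apply: cvgeZl.
by apply: cvgeZl.
Qed.

Lemma is_fourierL2_unique f F F' : L2D setT f -> is_fourierL2 f F -> is_fourierL2 f F' ->
  {ae mu, forall x, F x = F' x}.
Proof.
move=> Lf [/L2E LF HF] [/L2E LF' HF'].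
have cB := L2DB mT LF LF'.
suff : sqn setT (fun x => F x - F' x) = 0%E.
  move=> /(sqn_eq0 mT cB.1); apply: aeS => x /(_ I) /eqP; rewrite subr_eq0 => /eqP //.
have Lt n := L2D_fourierL1 (csupp_truncate n Lf).
have h n : (sqn setT (fun x => F x - F' x)%R <=
    2%:E * sqnormL2 (fun x => fourierL1 (truncate n f) x - F' x)%R +
    2%:E * sqnormL2 (fun x => fourierL1 (truncate n f) x - F x)%R)%E.
  rewrite !sqnormE; apply: le_trans (sqnB_le mT (L2DB mT (Lt n) LF').1 (L2DB mT (Lt n) LF).1).
  rewrite le_eqVlt; apply/orP; left; apply/eqP; apply: eq_sqn => x _.
  by congr sq; ring.
have c0 := cvge_le0 (fun _ => sqn_ge0 _ _) h (cvge_comb0 HF' HF).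
by apply: (cvg_unique _ (cvg_cst _) c0); exact: ereal_hausdorff.
Qed.

(** The transforms of the truncations of f - g tend to 0, hence so do the truncations, by
    Plancherel's theorem for compact support; but they also tend to f - g. *)
Lemma is_fourierL2_inj f g F : L2D setT f -> L2D setT g ->
  is_fourierL2 f F -> is_fourierL2 g F -> {ae mu, forall x, f x = g x}.
Proof.
move=> Lf Lg [/L2E LF HF] [_ HG].
have cB := L2DB mT Lf Lg.
suff : sqn setT (fun x => f x - g x) = 0%E.
  move=> /(sqn_eq0 mT cB.1); apply: aeS => x /(_ I) /eqP; rewrite subr_eq0 => /eqP //.
have Lt n := L2D_fourierL1 (csupp_truncate n Lf).
have Lt' n := L2D_fourierL1 (csupp_truncate n Lg).
have h n : (sqn setT (truncate n (fun x => f x - g x)%R) <=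
    2%:E * sqnormL2 (fun x => fourierL1 (truncate n f) x - F x)%R +
    2%:E * sqnormL2 (fun x => fourierL1 (truncate n g) x - F x)%R)%E.
  rewrite !sqnormE -(sqn_fourierL1 (csupp_truncate n cB)).
  apply: le_trans (sqnB_le mT (L2DB mT (Lt n) LF).1 (L2DB mT (Lt' n) LF).1).
  rewrite le_eqVlt; apply/orP; left; apply/eqP; apply: eq_sqn => x _.
  by rewrite fourierL1_truncateB//; congr sq; ring.
have c0 := cvge_le0 (fun _ => sqn_ge0 _ _) h (cvge_comb0 HF HG).
have h2 n : (sqn setT (fun x => f x - g x)%R <=
    2%:E * sqn setT (truncate n (fun x => f x - g x)%R) +
    2%:E * sqn setT (fun x => (f x - g x) - truncate n (fun x => f x - g x) x)%R)%E.
  have ct := csupp_truncate n cB.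
  apply: le_trans (sqnD_le mT ct.1.1 (L2DB mT cB ct.1).1).
  rewrite le_eqVlt; apply/orP; left; apply/eqP; apply: eq_sqn => x _.
  by congr sq; ring.
have c1 := cvge_le0 (fun _ => sqn_ge0 _ _) h2 (cvge_comb0 c0 (truncate_cvg cB)).
by apply: (cvg_unique _ (cvg_cst _) c1); exact: ereal_hausdorff.
Qed.

End Plancherel.

Opaque fourierL1 fourierL1inv.

(** * The frame operator in the frequency variable *)

Section Bandlimited.
Variable R : realType.
Local Notation Re := (@complex.Re R).
Local Notation Im := (@complex.Im R).
Local Notation mu := (@lebesgue_measure R).
Local Notation C := (R[i]).
Implicit Types (f g u v G : R -> C).
Let mT : measurable (setT : set R) := measurableT.

Lemma is_fourierL2_ae f F F' : is_fourierL2 f F -> L2D setT f -> L2D setT F' ->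
  {ae mu, forall x, F x = F' x} -> is_fourierL2 f F'.
Proof.
move=> [/L2E LF HF] Lf LF' FF'; split; first exact/L2E.
rewrite (_ : (fun n => sqnormL2 _) =
  fun n => sqnormL2 (fun xi => fourierL1 (truncate n f) xi - F xi))//.
apply/funext => n; have Lt := L2D_fourierL1 (csupp_truncate n Lf).
rewrite !sqnormE; apply: ae_eq_sqn => //.
- exact: (L2DB mT Lt LF').1.
- exact: (L2DB mT Lt LF).1.
- by apply: aeS FF' => x -> _.
Qed.

(** F is the transform of f set to 0 outside the band. Having compact support, F is the transform of
    its own inverse transform, which must agree with f by injectivity. *)
Lemma bandlimited_repr (omega : R) f : bandlimited omega f ->
  exists F, [/\ csupp F, forall x, x \notin `[- omega, omega]%classic -> F x = 0,
    {ae mu, forall x, fourier f x = F x} & {ae mu, forall x, f x = fourierL1inv F x}].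
Proof.
move=> [/L2E Lf Ff Fs]; have [/L2E LF _] := Ff.
pose F x := if x \in `[- omega, omega]%classic then fourier f x else 0.
have FE : {ae mu, forall x, fourier f x = F x}.
  apply: aeS Fs => x H; rewrite /F; case: ifPn => // xn; apply: H.
  by apply: contraNnot xn => /mem_set.
have mF : cmeas F.
  apply: cmeas_if => //; last exact: cmeas_cst.
    apply: (measurable_fun_bool true) => //; rewrite setTI.
    rewrite (_ : _ @^-1` _ = `[- omega, omega]%classic); first exact: measurable_itv.
    by apply/seteqP; split => x /=; [move=> /set_mem|move=> /mem_set].
  exact: LF.1.
have LF' : L2D setT F by apply: (L2D_ae mT mF LF); apply: aeS FE => x ->.
have cF : csupp F.
  split => //; exists `|omega| => x xo; rewrite /F ifF//; apply/negP.
  rewrite inE /= in_itv/= => /andP[h1 h2].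
  have := ler_norm omega; have : `|x| <= omega by rewrite ler_norml h1.
  lra.
exists F; split => //; first by move=> x; rewrite /F => /negPf ->.
apply: (is_fourierL2_inj Lf (L2D_fourierL1inv cF) _ (is_fourierL2_inv cF)).
exact: is_fourierL2_ae Ff Lf LF' FE.
Qed.

Lemma bandlimited_inv (omega : R) G : csupp G ->
  (forall x, x \notin `[- omega, omega]%classic -> G x = 0) ->
  bandlimited omega (fourierL1inv G) /\
  {ae mu, forall x, fourier (fourierL1inv G) x = G x}.
Proof.
move=> cG Gs; have Lf := L2D_fourierL1inv cG; have HG := is_fourierL2_inv cG.
have Ff : is_fourierL2 (fourierL1inv G) (fourier (fourierL1inv G)).
  (* G is a transform of the function, so the choice made by [fourier] is one as well and not the
     default 0. *)
  by rewrite /fourier; case: xgetP => [F -> //|/(_ G)].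
have E := is_fourierL2_unique Lf Ff HG.
split => //; split => //; first exact/L2E.
by apply: aeS E => x -> xn; apply: Gs; apply/negP => /set_mem.
Qed.

Lemma sqn_shift (c : R) u : cmeas u -> sqn setT (fun x => u (x + c)) = sqn setT u.
Proof.
move=> mu_; rewrite /sqn -[RHS](@ge0_integral_shift R c setT (fun x => (sq (u x))%:E))//.
- exact: measurable_Esq.
- by move=> x; rewrite lee_fin sq_ge0.
Qed.

Lemma cmeas_shift (c : R) u : cmeas u -> cmeas (fun x => u (x + c)).
Proof. by move=> mu_; apply: cmeas_comp => //; exact: measurable_shift. Qed.

Lemma L2D_shift (c : R) u : L2D setT u -> L2D setT (fun x => u (x + c)).
Proof.
by move=> [mu_ Lu]; split; [exact: cmeas_shift|rewrite sqn_shift].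
Qed.

Lemma L2D_sub (D : set R) u : measurable D -> L2D setT u -> L2D D u.
Proof.
move=> mD [mu_ Lu]; split => //; apply: le_lt_trans Lu; apply: ge0_subset_integral => //.
- exact: measurable_Esq.
- by move=> x _; rewrite lee_fin sq_ge0.
Qed.

(** The sets |n| <= M increase and every finite set of integers lies in one of them; for nonnegative
    terms the unconditional sum is thus the limit of the symmetric partial sums. *)
Lemma esum_int_lim (a : int -> R) (s : R) : (forall n, 0 <= a n) ->
  (fun M : nat => \sum_(i < (M + M).+1) a (i%:Z - M%:Z)) @ \oo --> s ->
  \esum_(n in [set: int]) (a n)%:E = s%:E.
Proof.
move=> a0; set S := (fun M : nat => _) => Ss.
pose Z (M : nat) : set int := (fun i : nat => i%:Z - M%:Z) @` `I_(M + M).+1.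
have finZ M : finite_set (Z M) by apply: finite_image; exact: finite_II.
have ZS M : \sum_(n \in Z M) (a n)%:E = (S M)%:E.
  rewrite -esum_fset//; last by move=> n _; rewrite lee_fin.
  rewrite esum_image; last by move=> i j _ _ /addIr [].
  rewrite esum_fset//; last by move=> n _; rewrite lee_fin.
  by rewrite -fsbig_ord sumEFin.
have memZ M n : Z M n <-> (absz n <= M)%N.
  split; first by move=> [i /= iM <-]; lia.
  by move=> nM; exists (absz (n + M%:Z)) => /=; lia.
have Snd : nondecreasing_seq S.
  move=> M M' MM'; rewrite -lee_fin -!ZS; apply: lee_fsum_nneg_subset => //.
    by move=> n /set_mem /memZ nM; apply/mem_set/memZ; exact: leq_trans MM'.
  by move=> n _; rewrite lee_fin.
have Sle M : S M <= s.
  by rewrite -(cvg_lim _ Ss)//; apply: nondecreasing_cvgn_le => //; apply/cvg_ex; exists s.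
apply/eqP; rewrite eq_le; apply/andP; split.
  rewrite ge_ereal_sup//= => _ [X [finX _] <-].
  pose M := \max_(n <- finmap.enum_fset (fset_set X)) absz n.
  apply: (@le_trans _ _ (S M)%:E); last by rewrite lee_fin.
  rewrite -ZS; apply: lee_fsum_nneg_subset => //; last by move=> n _; rewrite lee_fin.
  move=> n nX; apply/mem_set/memZ; apply: (leq_bigmax_seq n) => //.
  by rewrite in_fset_set.
have SE : (fun M => (S M)%:E) @ \oo --> s%:E by apply: cvg_EFin; [exact: nearW|exact: Ss].
rewrite -(cvg_lim _ SE)//; apply: lime_le; first by apply/cvg_ex; exists s%:E.
apply: nearW => M; rewrite -ZS; apply: esum_ge; exists (Z M) => //.
Qed.

Lemma nrm_le_sum (D : set R) (I : finType) (K : R) u (v : I -> R -> C) : measurable D ->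
  0 <= K -> L2D D u -> (forall i, L2D D (v i)) ->
  {ae mu, forall y, D y -> sq (u y) <= K * \sum_i sq (v i y)} ->
  nrm D u <= K * \sum_i nrm D (v i).
Proof.
move=> mD K0 Lu Lv H; rewrite -lee_fin nrmE// EFinM -sumEFin.
rewrite (eq_bigr (fun i => sqn D (v i))); last by move=> i _; rewrite nrmE.
have mv i : measurable_fun D (fun x => (sq (v i x))%:E) by apply: measurable_Esq; exact: (Lv i).1.
rewrite /sqn -ge0_integral_sum//; last by move=> i x _; rewrite lee_fin sq_ge0.
rewrite -ge0_integralZl//; last 2 first.
- exact: emeasurable_sum.
- by move=> x _; apply: sume_ge0 => i _; rewrite lee_fin sq_ge0.
apply: ae_ge0_le_integral => //.
- by move=> x _; rewrite lee_fin sq_ge0.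
- by apply: measurable_Esq; exact: Lu.1.
- move=> x _; apply: mule_ge0; first by rewrite lee_fin.
  by apply: sume_ge0 => i _; rewrite lee_fin sq_ge0.
- by apply: measurable_funeM; exact: emeasurable_sum.
- by apply: (aeS _ H) => y h Dy; rewrite sumEFin -EFinM lee_fin; exact: h.
Qed.

Lemma fourierL1inv_sum I (s : seq I) (F : I -> R -> C) x : (forall i, csupp (F i)) ->
  fourierL1inv (fun y => \sum_(i <- s) F i y) x = \sum_(i <- s) fourierL1inv (F i) x.
Proof.
move=> cF; elim: s => [|i s IH].
  rewrite big_nil (_ : (fun y => _) = fun y => 0 * (0 : C)); last first.
    by apply/funext => y; rewrite big_nil mul0r.
  by rewrite (fourierL1invZ _ _ (csupp0 R)) mul0r.
rewrite big_cons -IH -fourierL1invD//; last exact: csupp_sum.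
rewrite (_ : (fun y => _) = fun y => F i y + \sum_(j <- s) F j y)//.
by apply/funext => y; rewrite big_cons.
Qed.

End Bandlimited.

Section Frame.
Variable R : realType.
Local Notation Re := (@complex.Re R).
Local Notation Im := (@complex.Im R).
Local Notation mu := (@lebesgue_measure R).
Local Notation C := (R[i]).
Implicit Types (f g u v G F : R -> C).
Let mT : measurable (setT : set R) := measurableT.

Variables (l N : nat) (omega h t0 : R).
Hypotheses (h0 : 0 < h) (ht : t0 = 2 * pi / h) (o0 : 0 < omega) (oh : omega < l%:R * h).
Local Notation D := (`]0, h[%classic : set R).
Let mD : measurable D. Proof. exact: measurable_itv. Qed.
(** For i = 0, ..., 2l - 1 the cells D + c i fill [-l h, l h[ up to a null set, and this interval
    contains the band because omega < l h. *)
Local Notation c i := ((i%:Z - l%:Z)%:~R * h).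

Definition osupp F := csupp F /\ forall x, x \notin `[- omega, omega]%classic -> F x = 0.

Lemma osuppB F G : osupp F -> osupp G -> osupp (fun x => F x - G x).
Proof.
by move=> [cF sF] [cG sG]; split; [exact: csuppB|move=> x xn; rewrite sF// sG// subr0].
Qed.

Lemma osuppZ (z : C) F : osupp F -> osupp (fun x => z * F x).
Proof.
by move=> [cF sF]; split; [exact: csuppZ|move=> x xn; rewrite sF// mulr0].
Qed.

Lemma osupp_sum I (s : seq I) (F : I -> R -> C) :
  (forall i, osupp (F i)) -> osupp (fun x => \sum_(i <- s) F i x).
Proof.
move=> oF; split; first by apply: csupp_sum => i; exact: (oF i).1.
by move=> x xn; apply: big1 => i _; exact: (oF i).2.
Qed.

Lemma osupp_mul F g (K : R) : osupp F -> cmeas g -> (forall x, sq (g x) <= K) ->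
  osupp (fun x => g x * F x).
Proof.
move=> [cF sF] mg gK; split; first exact: csupp_mul_bounded cF mg gK.
by move=> x xn; rewrite sF// mulr0.
Qed.

Lemma expi_t0 n x : expi 0 h n x = cis (n%:~R * t0 * x).
Proof. by rewrite /expi subr0 -ht. Qed.

Lemma expi_periodic n (k : int) x : expi 0 h n (x + k%:~R * h) = expi 0 h n x.
Proof.
rewrite /expi subr0 mulrDr cisD.
have -> : n%:~R * (2 * pi / h) * (k%:~R * h) = (n * k)%:~R * (2 * pi).
  by rewrite rmorphM/=; field; rewrite gt_eqF.
by rewrite cis2pi mulr1.
Qed.

Lemma sqn_setT_D u (S : set R) : measurable S -> (forall x, x \notin S -> u x = 0) ->
  sqn setT u = sqn S u.
Proof.
move=> mS uS; rewrite [RHS]sqn_mkcond; apply: eq_sqn => x _.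
by case: ifPn => // /uS ->.
Qed.

Lemma sqn_lattice u : cmeas u -> (forall x, x \notin `[- omega, omega]%classic -> u x = 0) ->
  sqn setT u = (\sum_(i < l + l) sqn D (fun y => u (y + c i)%R))%E.
Proof.
move=> mu_ us.
rewrite (@sqn_setT_D _ `[(- l%:Z)%:~R * h, ((l + l)%N%:Z - l%:Z)%:~R * h[%classic)//; last first.
  move=> x xn; apply: us; apply: contra xn; rewrite !mem_setE !in_itv/=.
  have -> : (l + l)%N%:Z - l%:Z = l%:Z by lia.
  have -> : (- l%:Z)%:~R = - l%:R :> R by rewrite mulrNz.
  have -> : l%:Z%:~R = l%:R :> R by [].
  move=> /andP[h1 h2]; apply/andP; split; last exact: le_lt_trans h2 oh.
  by apply: le_trans h1; rewrite mulNr lerN2 ltW.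
rewrite /sqn -(integral_periodize _ _ h0 (measurable_Esq mu_)); last first.
  by move=> x; rewrite lee_fin sq_ge0.
rewrite ge0_integral_sum//; last 2 first.
- move=> i; apply: measurable_funTS; apply: measurable_Esq; exact: cmeas_shift.
- by move=> i x _; rewrite lee_fin sq_ge0.
apply: eq_bigr => i _; rewrite [RHS]integral_itv_obnd_cbnd//.
apply: measurable_funTS; apply: measurable_Esq; exact: cmeas_shift.
Qed.

Lemma L2D_lattice u (i : nat) : osupp u -> L2D D (fun y => u (y + c i)).
Proof. by move=> [[Lu _] _]; apply: L2D_sub => //; exact: L2D_shift. Qed.

Lemma nrm_lattice u : osupp u ->
  nrm setT u = \sum_(i < l + l) nrm D (fun y => u (y + c i)).
Proof.
move=> ou; apply: EFin_inj; rewrite nrmE; last exact: ou.1.1.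
rewrite sqn_lattice; [|exact: ou.1.1.1|exact: ou.2].
rewrite -sumEFin; apply: eq_bigr => i _; rewrite nrmE//; exact: L2D_lattice.
Qed.

(** Polarization of [nrm_lattice]. *)
Lemma ip_lattice u v : osupp u -> osupp v ->
  ip setT u v = \sum_(i < l + l) ip D (fun y => u (y + c i)) (fun y => v (y + c i)).
Proof.
have HRe f g : osupp f -> osupp g -> Re (ip setT f g) =
    \sum_(i < l + l) Re (ip D (fun y => f (y + c i)) (fun y => g (y + c i))).
  move=> of_ og; have := nrm_lattice (osuppB of_ og).
  rewrite (nrmB mT of_.1.1 og.1.1) (nrm_lattice of_) (nrm_lattice og).
  rewrite (eq_bigr _ (fun (i : 'I_(l + l)) _ => nrmB mD (L2D_lattice i of_) (L2D_lattice i og))).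
  rewrite big_split/= big_split/= sumrN -mulr_sumr; lra.
move=> ou ov; have := HRe u v ou ov.
have := HRe u _ ou (osuppZ 'i%C ov).
rewrite (ipZr _ mT ov.1.1 ou.1.1).
rewrite (eq_bigr (fun i : 'I_(l + l) => Im (ip D (fun y => u (y + c i)) (fun y => v (y + c i))))); last first.
  move=> i _; rewrite (ipZr _ mD (L2D_lattice i ov) (L2D_lattice i ou)).
  by case: (ip _ _ _) => a b /=; rewrite mul0r sub0r mulN1r opprK.
rewrite -(raddf_sum Im) -(raddf_sum Re); set S := \sum_(i < _) _.
case: (ip _ _ _) S => [a b] [a' b'] /=.
by rewrite mul0r sub0r mulN1r opprK => -> ->.
Qed.

(** * The symbol of the frame operator *)

Variables (P : 'I_N -> R -> C) (gamma : R).
Hypotheses (mP : forall j, cmeas (P j)) (Pg : forall j x, sq (P j x) <= gamma)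
  (oP : forall j, osupp (P j)).

(** The bracket product of F and P j, that is the h-periodization of F conj(P j), restricted to one
    cell where the sum is finite. For the column of the values of F on the lattice these are the
    entries of A^* F. *)
Definition lattice_product F (j : 'I_N) : R -> C :=
  fun y => \sum_(i < l + l) F (y + c i) * conjc (P j (y + c i)).

Lemma osupp_mulP F j : osupp F -> osupp (fun x => F x * conjc (P j x)).
Proof.
move=> oF; rewrite (_ : (fun x => _) = fun x => conjc (P j x) * F x); last first.
  by apply/funext => x; rewrite mulrC.
by apply: (osupp_mul (K := gamma) oF (cmeasJ (mP j))) => x; rewrite sqJ.
Qed.

Lemma L2D_lattice_product F j : osupp F -> L2D D (lattice_product F j).
Proof.
move=> oF; apply: L2D_sum => // i; exact: (L2D_lattice i (osupp_mulP j oF)).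
Qed.

(** t0 h = 2 pi makes the exponential h-periodic, so it factors out of the sum over the lattice. *)
Lemma coef_lattice_product F j n : osupp F ->
  ip setT F (fun x => cis (n%:~R * t0 * x) * P j x) = coef 0 h (lattice_product F j) n.
Proof.
move=> oF.
have oE : osupp (fun x => cis (n%:~R * t0 * x) * P j x).
  by apply: (osupp_mul (oP j) (cmeas_cis _)) => x; rewrite sq_cis.
have LFP (i : nat) := L2D_lattice i (osupp_mulP j oF).
rewrite (ip_lattice oF oE) /coef /lattice_product ip_suml//; last exact: L2D_expi.
apply: eq_bigr => i _; apply: eq_cint => y _.
by rewrite -expi_t0 expi_periodic conjcM; ring.
Qed.

Variable Phi : 'I_N -> R -> C.
Hypothesis PhiL : forall j, L2D setT (Phi j).
Hypothesis PhiE : forall j, {ae mu, forall x, Phi j x = fourierL1inv (P j) x}.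

Lemma tau_Phi j (a : R) : {ae mu, forall x, tau a (Phi j) x =
  fourierL1inv (fun x => cis (a * x) * P j x) x}.
Proof.
have := ae_shift a (PhiE j); apply: aeS => x; rewrite /tau => ->.
exact: fourierL1inv_shift.
Qed.

Lemma osupp_cisP j (a : R) : osupp (fun x => cis (a * x) * P j x).
Proof. by apply: (osupp_mul (oP j) (cmeas_cis _)) => x; rewrite sq_cis. Qed.

Lemma inner_coef f F j n : L2D setT f -> osupp F ->
  {ae mu, forall x, f x = fourierL1inv F x} ->
  innerL2 f (tau (n%:~R * t0) (Phi j)) = coef 0 h (lattice_product F j) n.
Proof.
move=> Lf oF fF; rewrite innerE -coef_lattice_product//.
have oE := osupp_cisP j (n%:~R * t0).
rewrite -(ip_fourierL1inv oF.1 oE.1); apply: ae_eq_ip => //.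
- exact: Lf.1.
- exact: (L2D_fourierL1inv oF.1).1.
- exact: (L2D_shift _ (PhiL j)).1.
- exact: (L2D_fourierL1inv oE.1).1.
- by apply: aeS fF => x ->.
- by apply: aeS (tau_Phi j (n%:~R * t0)) => x ->.
Qed.

(** Parseval's identity for each [lattice_product]; h is the length of the period. *)
Lemma frame_sum f F : L2D setT f -> osupp F ->
  {ae mu, forall x, f x = fourierL1inv F x} ->
  (\sum_(j < N) \esum_(n in [set: int])
     ((cabs (innerL2 f (tau (n%:~R * t0) (Phi j)))) ^+ 2)%:E)%E =
  (h * \sum_(j < N) nrm D (lattice_product F j))%:E.
Proof.
move=> Lf oF fF; rewrite mulr_sumr -sumEFin; apply: eq_bigr => j _.
rewrite (eq_esum (b := fun n : int => (sq (coef 0 h (lattice_product F j) n))%:E)); last first.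
  by move=> n _; rewrite (inner_coef _ _ Lf oF fF).
apply: esum_int_lim => [n|]; first exact: sq_ge0.
have := @parseval R 0 h h0 _ (L2D_lattice_product j oF).
by rewrite subr0.
Qed.

Lemma reduce_modP y (k : int) : D y -> reduce_mod h (y + k%:~R * h) = y.
Proof.
rewrite /= in_itv/= => /andP[y0 yh]; rewrite /reduce_mod.
have -> : Num.floor ((y + k%:~R * h) / h) = k.
  apply/eqP; rewrite floor_eq mulrDl mulfK ?gt_eqF// rmorphD/=.
  apply/andP; split; first by rewrite lerDr divr_ge0// ltW.
  by rewrite addrC ltrD2l ltr_pdivrMr// mul1r.
by rewrite addrK.
Qed.

Lemma measurable_reduce_mod : measurable_fun setT (reduce_mod h).
Proof.
have mfl : measurable_fun setT (fun x : R => (Num.floor (x / h))%:~R : R).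
  apply: nondecreasing_measurable => // x y xy; rewrite ler_int; apply: le_floor.
  by rewrite ler_pM2r// invr_gt0.
rewrite (_ : reduce_mod h = (fun x => x) \- (fun x => (Num.floor (x / h))%:~R * h))//.
apply: measurable_funB => //; apply: measurable_funM => //; exact: measurable_cst.
Qed.

(** The function h A A^* F: the periodic factor A^* F is evaluated at the representative of x in [0,
    h[. *)
Definition frame_symbol F : R -> C := fun x => h%:C * \sum_j lattice_product F j (reduce_mod h x) * P j x.

(** The transform of a partial sum of the frame series: each lattice product is replaced by a
    partial sum of its Fourier series. The factor h cancels the 1/h in [fsum]. *)
Definition frame_partial_symbol F (M : nat) : R -> C := fun x =>
  \sum_j h%:C * fsum 0 h M (lattice_product F j) x * P j x.

Lemma cmeas_lattice_product F j : osupp F -> cmeas (lattice_product F j).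
Proof. by move=> oF; exact: (L2D_lattice_product j oF).1. Qed.

Lemma L2D_mulP u j (i : nat) : L2D D u -> L2D D (fun y => u y * P j (y + c i)).
Proof.
move=> Lu; rewrite (_ : (fun x => _) = fun x => P j (x + c i) * u x); last first.
  by apply/funext => x; rewrite mulrC.
have [mu_ fu] := Lu; split; first by apply: cmeasM => //; exact: cmeas_shift.
apply: (@le_lt_trans _ _ (gamma%:E * sqn D u)%E); last first.
  by apply: lte_mul_pinfty => //; rewrite lee_fin; exact: le_trans (sq_ge0 (P j 0)) (Pg j 0).
rewrite /sqn -ge0_integralZl//; first last.
- by rewrite lee_fin (le_trans (sq_ge0 (P j 0))).
- by move=> x _; rewrite lee_fin sq_ge0.
- exact: measurable_Esq.
apply: ge0_le_integral => //.
- by move=> x _; rewrite lee_fin sq_ge0.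
- by apply: measurable_Esq; apply: cmeasM => //; exact: cmeas_shift.
- by apply: measurable_funeM; exact: measurable_Esq.
- by move=> x _; rewrite -EFinM lee_fin sqM ler_wpM2r// sq_ge0.
Qed.

Lemma frame_symbol_lattice F y (i : nat) : D y ->
  frame_symbol F (y + c i) = h%:C * \sum_j lattice_product F j y * P j (y + c i).
Proof. by move=> Dy; rewrite /frame_symbol reduce_modP. Qed.

Lemma osupp_lattice u : cmeas u -> (forall x, x \notin `[- omega, omega]%classic -> u x = 0) ->
  (forall i : nat, L2D D (fun y => u (y + c i))) -> osupp u.
Proof.
move=> mu_ us Lu; split => //; split.
  by split => //; rewrite sqn_lattice//; apply: lte_sum_pinfty => i _; exact: (Lu i).2.
exists omega => x xo; apply: us; apply/negP; rewrite mem_setE in_itv/= => /andP[h1 h2].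
by move: xo; rewrite ltNge ler_norml h1 h2.
Qed.

Lemma osupp_frame_symbol F : osupp F -> osupp (frame_symbol F).
Proof.
move=> oF; apply: osupp_lattice.
- apply: cmeasM; first exact: cmeas_cst.
  apply: cmeas_sum => j; apply: cmeasM => //; apply: cmeas_comp; last exact: measurable_reduce_mod.
  exact: cmeas_lattice_product.
- by move=> x xn; rewrite /frame_symbol big1 ?mulr0// => j _; rewrite (oP j).2// mulr0.
- move=> i; apply: (@L2D_ae _ D _ (fun y => h%:C * \sum_j lattice_product F j y * P j (y + c i))) => //.
  + apply: cmeas_shift; apply: cmeasM; first exact: cmeas_cst.
    apply: cmeas_sum => j; apply: cmeasM => //; apply: cmeas_comp; last exact: measurable_reduce_mod.
    exact: cmeas_lattice_product.
  + apply: L2DZ => //; apply: L2D_sum => // j; apply: L2D_mulP; exact: L2D_lattice_product.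
  + by apply: aeW => y Dy; exact: frame_symbol_lattice.
Qed.

Lemma osupp_partial_symbol F M : osupp F -> osupp (frame_partial_symbol F M).
Proof.
move=> oF; apply: osupp_sum => j.
rewrite (_ : (fun x => _) = fun x => h%:C * (fsum 0 h M (lattice_product F j) x * P j x)); last first.
  by apply/funext => x; rewrite mulrA.
apply: osuppZ.
rewrite (_ : (fun x => _) = fun x => \sum_(i < (M + M).+1)
   ((h - 0)^-1)%:C * coef 0 h (lattice_product F j) (i%:Z - M%:Z) *
   (cis ((i%:Z - M%:Z)%:~R * t0 * x) * P j x)).
  by apply: osupp_sum => i; apply: osuppZ; exact: osupp_cisP.
apply/funext => x; rewrite /fsum /psum mulr_suml; apply: eq_bigr => i _.
by rewrite expi_t0 mulrA.
Qed.

Lemma partial_sum_partial_symbol f F M : L2D setT f -> osupp F ->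
  {ae mu, forall x, f x = fourierL1inv F x} ->
  {ae mu, forall x, frame_partial_sum t0 Phi M f x = fourierL1inv (frame_partial_symbol F M) x}.
Proof.
move=> Lf oF fF.
have H : {ae mu, forall x, forall n : int, forall j : 'I_N,
    tau (n%:~R * t0) (Phi j) x = fourierL1inv (fun x => cis (n%:~R * t0 * x) * P j x) x}.
  apply: ae_forall_int => n; have := @ae_foralln _ _ R mu
    (fun (k : nat) x => forall j : 'I_N, k = j ->
      tau (n%:~R * t0) (Phi j) x = fourierL1inv (fun x => cis (n%:~R * t0 * x) * P j x) x).
  move=> E; apply: (aeS _ (E _)); first by move=> x Ex j; exact: Ex.
  move=> k; have [kN|kN] := ltnP k N.
    by apply: (aeS _ (tau_Phi (Ordinal kN) (n%:~R * t0))) => x Ex j kj;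
      rewrite (_ : j = Ordinal kN)//; exact/val_inj.
  by apply: aeW => x j kj; move: kN; rewrite kj leqNgt ltn_ord.
apply: aeS H => x H; rewrite /frame_partial_sum.
have cE j (i : 'I_(M + M).+1) : csupp (fun y => coef 0 h (lattice_product F j) (i%:Z - M%:Z) *
    (cis ((i%:Z - M%:Z)%:~R * t0 * y) * P j y)).
  by apply: csuppZ; exact: (osupp_cisP j _).1.
rewrite (_ : frame_partial_symbol F M = fun y => \sum_j \sum_(i < (M + M).+1) coef 0 h (lattice_product F j) (i%:Z - M%:Z) *
    (cis ((i%:Z - M%:Z)%:~R * t0 * y) * P j y)); last first.
  apply/funext => y; apply: eq_bigr => j _; rewrite /fsum /psum mulr_sumr mulr_suml.
  apply: eq_bigr => i _; rewrite expi_t0 subr0 !mulrA -rmorphM/= divff ?gt_eqF//.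
  by rewrite mul1r.
rewrite fourierL1inv_sum; last by move=> j; apply: csupp_sum => i; exact: cE.
apply: eq_bigr => j _; rewrite fourierL1inv_sum; last by move=> i; exact: cE.
apply: eq_bigr => i _; rewrite H (inner_coef _ _ Lf oF fF).
by rewrite fourierL1invZ//; exact: (osupp_cisP j _).1.
Qed.

Lemma fsum_periodic M u y (k : int) :
  fsum 0 h M u (y + k%:~R * h) = fsum 0 h M u y.
Proof. by apply: eq_bigr => i _; rewrite expi_periodic. Qed.

(** On every cell the error is a combination of the P j, which are bounded, with the errors of the
    Fourier series of the lattice products as coefficients; by periodicity these are the same on all
    cells. *)
Lemma frame_partial_symbol_cvg F : osupp F ->
  (fun M => sqn setT (fun x => frame_partial_symbol F M x - frame_symbol F x)) @ \oo --> 0%E.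
Proof.
move=> oF.
(* 2l cells, the factor h of the symbol squared, and N gamma from Cauchy-Schwarz over the generators
   and |P j|^2 <= gamma. *)
pose K : R := (l + l)%:R * (h ^+ 2 * (N%:R * gamma)).
pose b (M : nat) : R := K * \sum_j nrm D (fun y => lattice_product F j y - fsum 0 h M (lattice_product F j) y).
have g0 (j : 'I_N) : 0 <= gamma by exact: le_trans (sq_ge0 (P j 0)) (Pg j 0).
(* gamma >= 0 is read off a generator; if there is none, the product is 0. *)
have Ng0 : 0 <= N%:R * gamma.
  have [->|N0] := eqVneq N 0%N; first by rewrite mul0r.
  by rewrite mulr_ge0// (g0 (cast_ord (prednK _) ord0))//; rewrite lt0n.
have LS j M := L2DB mD (L2D_lattice_product j oF) (L2D_psum h0 M (fun n => ((h - 0)^-1)%:C * coef 0 h (lattice_product F j) n)).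
have bd M : (sqn setT (fun x => frame_partial_symbol F M x - frame_symbol F x)%R <= (b M)%:E)%E.
  have oB := osuppB (osupp_partial_symbol M oF) (osupp_frame_symbol oF).
  rewrite -(nrmE oB.1.1) lee_fin (nrm_lattice oB).
  set S := \sum_j nrm D (fun y => lattice_product F j y - fsum 0 h M (lattice_product F j) y).
  rewrite (_ : b M = \sum_(i < l + l) h ^+ 2 * (N%:R * gamma) * S); last first.
    by rewrite sumr_const card_ord -[RHS]mulr_natl /b /K -/S !mulrA.
  apply: ler_sum => i _; apply: nrm_le_sum => //.
  - by rewrite mulr_ge0// sqr_ge0.
  - exact: (L2D_lattice i oB).
  - by move=> j; exact: (LS j M).
  - apply: aeW => y Dy; rewrite frame_symbol_lattice// /frame_partial_symbol mulr_sumr -sumrB.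
    apply: le_trans (sq_sum_le _) _; rewrite mulr_sumr mulr_sumr; apply: ler_sum => j _.
    rewrite fsum_periodic -mulrA -mulrBr -mulrBl sqM sqM sq_real.
    rewrite -sqN opprB; set z := sq (_ - _).
    have z0 : 0 <= z by exact: sq_ge0.
    have := Pg j (y + c i); have := sq_ge0 (P j (y + c i)); set w := sq (P j _) => w0 wg.
    rewrite (_ : _ * _ = (N%:R * h ^+ 2 * z) * w); last by ring.
    rewrite [leRHS](_ : _ = (N%:R * h ^+ 2 * z) * gamma); last by ring.
    apply: ler_wpM2l => //; apply: mulr_ge0 => //; apply: mulr_ge0; first exact: ler0n.
    exact: sqr_ge0.
apply: (cvge_le0 (b := fun M => (b M)%:E)) => //; first by move=> M; exact: sqn_ge0.
apply: cvg_EFin; first exact: nearW.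
rewrite -[X in _ --> X](mulr0 K); apply: cvgMr.
rewrite -[X in _ --> X](_ : \sum_(j < N) 0 = 0); last by rewrite big1.
apply: cvg_big => [|j _]; first exact: add_continuous.
exact: (sqn_fsum_cvg h0 (L2D_lattice_product j oF)).
Qed.

(** By Plancherel's theorem the frame series of f tends to g exactly when the partial symbols of F
    tend to G in L^2; their limit is [frame_symbol F]. *)
Lemma frame_operatorP f F g G : L2D setT f -> osupp F -> L2D setT g -> osupp G ->
  {ae mu, forall x, f x = fourierL1inv F x} ->
  {ae mu, forall x, g x = fourierL1inv G x} ->
  frame_operator t0 Phi f g <-> {ae mu, forall x, G x = frame_symbol F x}.
Proof.
move=> Lf oF Lg oG fF gG.
have oS := osupp_frame_symbol oF.
have mps M : cmeas (frame_partial_sum t0 Phi M f).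
  apply: cmeas_sum => j; apply: cmeas_sum => i; apply: cmeasM; first exact: cmeas_cst.
  exact: (L2D_shift _ (PhiL j)).1.
have E M : sqnormL2 (fun x => frame_partial_sum t0 Phi M f x - g x) =
    sqn setT (fun x => frame_partial_symbol F M x - G x).
  have oT := osupp_partial_symbol M oF.
  rewrite sqnormE -(sqn_fourierL1inv (csuppB oT.1 oG.1)); apply: ae_eq_sqn => //.
  - by apply: cmeasB => //; exact: Lg.1.
  - exact: (L2D_fourierL1inv (csuppB oT.1 oG.1)).1.
  - apply: aeS2 (partial_sum_partial_symbol M Lf oF fF) gG => x -> -> _.
    by rewrite (fourierL1invB _ oT.1 oG.1).
rewrite /frame_operator (_ : (fun M => sqnormL2 _) =
  fun M => sqn setT (fun x => frame_partial_symbol F M x - G x)); last exact/funext.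
split.
- move=> H0; have cB := L2DB mT oG.1.1 oS.1.1.
  suff : sqn setT (fun x => G x - frame_symbol F x) = 0%E.
    move=> /(sqn_eq0 mT cB.1); apply: aeS => x /(_ I) /eqP; rewrite subr_eq0 => /eqP //.
  have h' M : (sqn setT (fun x => G x - frame_symbol F x)%R <=
      2%:E * sqn setT (fun x => frame_partial_symbol F M x - frame_symbol F x)%R +
      2%:E * sqn setT (fun x => frame_partial_symbol F M x - G x)%R)%E.
    have oT := osupp_partial_symbol M oF.
    apply: le_trans (sqnB_le mT (osuppB oT oS).1.1.1 (osuppB oT oG).1.1.1).
    rewrite le_eqVlt; apply/orP; left; apply/eqP; apply: eq_sqn => x _.
    by congr sq; ring.
  have c0 := cvge_le0 (fun _ => sqn_ge0 _ _) h' (cvge_comb0 (frame_partial_symbol_cvg oF) H0).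
  by apply: (cvg_unique _ (cvg_cst _) c0); exact: ereal_hausdorff.
- move=> GS; have := frame_partial_symbol_cvg oF; rewrite (_ : (fun M => sqn setT (fun x => _ - frame_symbol F x)) =
    fun M => sqn setT (fun x => frame_partial_symbol F M x - G x))//.
  apply/funext => M; have oT := osupp_partial_symbol M oF; apply: ae_eq_sqn => //.
  + exact: (osuppB oT oS).1.1.1.
  + exact: (osuppB oT oG).1.1.1.
  + by apply: aeS GS => x -> _.
Qed.

(** * Frame bounds and uniqueness from a bounded dual matrix *)

Variables (Pd : 'I_N -> R -> C) (b : R).
(** [Pd_biorth] is h B A^* = 1 on the indices of the band, and [Pd_dual] is A = h A A^* B. *)
Hypotheses (oPd : forall j, osupp (Pd j))
  (Pdb : {ae mu, forall x, forall j, sq (Pd j x) <= b})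
  (Pd_biorth : {ae mu, forall x, forall k : int,
     h%:C * \sum_j Pd j x * conjc (P j (x + k%:~R * h)) =
     if (k == 0) && (x \in `]- omega, omega[%classic) then 1 else 0})
  (Pd_dual : forall m, {ae mu, forall x, P m x = frame_symbol (Pd m) x}).

Lemma ae_neq (a : R) : {ae mu, forall x, x != a}.
Proof.
exists [set a]; split; [exact: measurable_set1|exact: lebesgue_measure_set1|].
by move=> x /= /negP; rewrite negbK => /eqP.
Qed.

(** F = h B (A^* F), by exchanging the sums over the lattice and over the generators. *)
Lemma reconstruct F : osupp F -> {ae mu, forall y, D y -> forall i : nat, (i < l + l)%N ->
  F (y + c i) = h%:C * \sum_j lattice_product F j y * Pd j (y + c i)}.
Proof.
(* F lives on the closed band but [Pd_biorth] gives 1 only on the open one; the translates of the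
   endpoints are discarded. *)
move=> oF; have H0 := ae_lattice h (aeS2 (fun x => @conj _ _) (ae_neq (- omega)) (ae_neq omega)).
apply: aeS2 (ae_lattice h Pd_biorth) H0 => y H1 H2 Dy i il.
rewrite mulr_sumr /lattice_product.
transitivity (\sum_(i' < l + l) F (y + c i') *
    (h%:C * \sum_j Pd j (y + c i) * conjc (P j (y + c i')))); last first.
  under eq_bigr do rewrite mulr_sumr mulr_sumr.
  rewrite exchange_big/=; apply: eq_bigr => j _; rewrite mulr_suml mulr_sumr.
  by apply: eq_bigr => i' _; ring.
have E (i' : 'I_(l + l)) : y + c i' = (y + c i) + (i'%:Z - i%:Z)%:~R * h.
  by rewrite -addrA -mulrDl -rmorphD/=; congr (_ + _%:~R * _); lia.
rewrite (bigD1 (Ordinal il))//= [X in _ = _ + X]big1 ?addr0.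
  have := H1 (i%:Z - l%:Z) 0; rewrite mul0r addr0 eqxx/= => ->.
  case: ifPn => [_|xn]; first by rewrite mulr1.
  rewrite mulr0; apply: oF.2; apply: contra xn; rewrite !mem_setE !in_itv/=.
  have [n1 n2] := H2 (i%:Z - l%:Z); rewrite !le_eqVlt eq_sym (negPf n1)/= (negPf n2)/=.
  exact.
move=> i' ii'; rewrite (E i').
rewrite H1 [_ == 0](_ : _ = false) ?mulr0//.
apply/negbTE; rewrite subr_eq0 eqz_nat; apply: contra ii' => /eqP ii'.
by apply/eqP/val_inj.
Qed.

(** Cauchy-Schwarz in [reconstruct], on each of the 2l cells. The absolute value of b makes the
    constant nonnegative, whatever the sign of b. *)
Lemma frame_lower F : osupp F ->
  nrm setT F <= (l + l)%:R * (h ^+ 2 * (N%:R * `|b|)) * \sum_j nrm D (lattice_product F j).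
Proof.
move=> oF; rewrite (nrm_lattice oF).
set S := \sum_j nrm D (lattice_product F j); rewrite (_ : _ * S = \sum_(i < l + l) h ^+ 2 * (N%:R * `|b|) * S); last first.
  by rewrite sumr_const card_ord -[RHS]mulr_natl !mulrA.
apply: ler_sum => i _; apply: nrm_le_sum => //.
- by rewrite !mulr_ge0// ltW.
- exact: L2D_lattice.
- by move=> j; exact: L2D_lattice_product.
- apply: aeS2 (reconstruct oF) (ae_lattice h Pdb) => y H1 H2 Dy.
  rewrite (H1 Dy i (ltn_ord i)).
  rewrite sqM sq_real -[leRHS]mulrA; apply: ler_wpM2l; first exact: sqr_ge0.
  apply: le_trans (sq_sum_le _) _; rewrite -[leRHS]mulrA; apply: ler_wpM2l => //.
  rewrite mulr_sumr; apply: ler_sum => j _; rewrite sqM mulrC.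
  apply: ler_wpM2r; first exact: sq_ge0.
  exact: le_trans (H2 _ _) (ler_norm _).
Qed.

Lemma frame_upper F : osupp F ->
  \sum_j nrm D (lattice_product F j) <= N%:R * ((l + l)%:R * `|gamma|) * nrm setT F.
Proof.
move=> oF; rewrite (nrm_lattice oF).
set S := \sum_(i < l + l) nrm D (fun y => F (y + c i)); rewrite (_ : _ * S = \sum_(j < N) (l + l)%:R * `|gamma| * S); last first.
  by rewrite sumr_const card_ord -[RHS]mulr_natl !mulrA.
apply: ler_sum => j _; apply: (@nrm_le_sum _ _ _ _ _ (fun (i : 'I_(l + l)) y => F (y + c i))) => //.
- exact: L2D_lattice_product.
- by move=> i; exact: L2D_lattice.
- apply: aeW => y Dy; apply: le_trans (sq_sum_le _) _.
  rewrite -[leRHS]mulrA; apply: ler_wpM2l => //.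
  rewrite mulr_sumr; apply: ler_sum => i _; rewrite sqM sqJ mulrC.
  apply: ler_wpM2r; first exact: sq_ge0.
  exact: le_trans (Pg _ _) (ler_norm _).
Qed.

Lemma bandlimited_osupp f : bandlimited omega f ->
  exists F, [/\ L2D setT f, osupp F, {ae mu, forall x, fourier f x = F x} &
    {ae mu, forall x, f x = fourierL1inv F x}].
Proof.
move=> bf; have [F [cF sF fF f_F]] := bandlimited_repr bf.
by exists F; split => //; case: bf => /L2E.
Qed.

Lemma is_frame_abs : is_frame omega t0 Phi.
Proof.
(* The added 1 makes K1 positive, so that h / K1 is a lower frame bound. *)
pose K1 : R := (l + l)%:R * (h ^+ 2 * (N%:R * `|b|)) + 1.
pose K2 : R := N%:R * ((l + l)%:R * `|gamma|).
have K10 : 0 < K1 by rewrite /K1; apply: ltr_wpDl => //; rewrite !mulr_ge0// ltW.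
(* The upper bound is h K2; the maximum secures that it is at least the lower one. *)
exists (h / K1), (Num.max (h / K1) (h * K2)); split; first exact: divr_gt0.
  by rewrite le_max lexx.
move=> f /bandlimited_osupp[F [Lf oF _ fF]] /=.
rewrite (frame_sum Lf oF fF).
have -> : sqnormL2 f = (nrm setT F)%:E.
  rewrite nrmE; last exact: oF.1.1.
  rewrite sqnormE -(sqn_fourierL1inv oF.1); apply: ae_eq_sqn => //.
  - exact: Lf.1.
  - exact: (L2D_fourierL1inv oF.1).1.
  - by apply: aeS fF => x -> _.
have h1 := frame_lower oF; have h2 := frame_upper oF.
set S := \sum_j _ in h1 h2 *.
have n0 : 0 <= nrm setT F by exact: nrm_ge0.
have S0 : 0 <= S by apply: sumr_ge0 => j _; exact: nrm_ge0.
rewrite -!EFinM !lee_fin; split.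
  rewrite -mulrA; apply: ler_wpM2l; first exact: ltW.
  rewrite ler_pdivrMl//; apply: le_trans h1 _; apply: ler_wpM2r => //.
  by rewrite lerDl.
apply: (@le_trans _ _ (h * K2 * nrm setT F)).
  by rewrite -mulrA; apply: ler_wpM2l => //; exact: ltW.
by apply: ler_wpM2r => //; rewrite le_max lexx orbT.
Qed.

Lemma dual_exists : dual_generators omega t0 Phi (fun m => fourierL1inv (Pd m)).
Proof.
move=> m; have [bP _] := bandlimited_inv (oPd m).1 (oPd m).2; split => //.
apply/(frame_operatorP (L2D_fourierL1inv (oPd m).1) (oPd m) (PhiL m) (oP m)) => //.
exact: aeW.
Qed.

(** If A A^* z = 0, then the squared norm of A^* z is z^* A A^* z = 0; hence A^* z = 0 and z = h B
    A^* z = 0. *)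
Lemma frame_symbol_inj F G : osupp F -> osupp G -> {ae mu, forall x, frame_symbol F x = frame_symbol G x} ->
  {ae mu, forall x, F x = G x}.
Proof.
move=> oF oG E; have oB := osuppB oF oG; set B := (fun x => F x - G x) in oB.
suff : nrm setT B = 0.
  move=> n0; have : sqn setT B = 0%E by rewrite -nrmE ?n0//; exact: oB.1.1.
  move=> /(sqn_eq0 mT oB.1.1.1); apply: aeS => x /(_ I) /eqP; rewrite subr_eq0 => /eqP //.
rewrite (nrm_lattice oB); apply: big1 => i _.
rewrite /nrm (_ : sqn D _ = 0%E)//.
rewrite (_ : 0%E = sqn D (fun=> 0)); last first.
  by rewrite /sqn; under [RHS]eq_integral do rewrite sq0; rewrite integral0.
apply: ae_eq_sqn => //; [exact: (L2D_lattice i oB).1|exact: cmeas_cst|].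
apply: aeS2 (reconstruct oB) (ae_lattice h E) => y H1 H2 Dy.
have hC : (h%:C : C) != 0 by rewrite eq_complex /= eqxx andbT gt_eqF.
have perB j : lattice_product B j y = lattice_product F j y - lattice_product G j y.
  by rewrite /lattice_product -sumrB; apply: eq_bigr => i' _; rewrite mulrBl.
have Z (i' : nat) : \sum_j lattice_product B j y * P j (y + c i') = 0.
  have := H2 (i'%:Z - l%:Z); rewrite !frame_symbol_lattice// => /(mulfI hC) HH.
  under eq_bigr do rewrite perB mulrBl.
  by rewrite sumrB HH subrr.
(* The squared norm of A^* z, expanded as z^* A A^* z. *)
have S0 : \sum_j (sq (lattice_product B j y))%:C = 0 :> C.
  rewrite (eq_bigr (fun j => \sum_(i' < l + l) conjc (B (y + c i')) * (lattice_product B j y * P j (y + c i')))).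
    by rewrite exchange_big/= big1// => i' _; rewrite -mulr_sumr Z mulr0.
  move=> j _; rewrite -mulconjc_sq {2}/lattice_product conjc_sum mulr_sumr; apply: eq_bigr => i' _.
  by rewrite conjcM conjcK; ring.
have per0 j : lattice_product B j y = 0.
  apply: sq_eq0; apply/eqP; move: S0; rewrite -rmorph_sum => /eqP.
  rewrite eq_complex /= => /andP[]; rewrite psumr_eq0; last by move=> *; exact: sq_ge0.
  by move=> /allP /(_ j) /(_ (mem_index_enum _)) /=.
rewrite (H1 Dy i (ltn_ord i)).
by rewrite big1 ?mulr0// => j _; rewrite per0 mul0r.
Qed.

Lemma dual_unique Phis m : dual_generators omega t0 Phi Phis ->
  {ae mu, forall x, fourier (Phis m) x = Pd m x}.
Proof.
move=> /(_ m) [/bandlimited_osupp[F [Lf oF fF f_F]]].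
move=> /(frame_operatorP Lf oF (PhiL m) (oP m) f_F (PhiE m)) PF.
have := frame_symbol_inj oF (oPd m) (aeS2 (fun x e1 e2 => etrans (esym e1) e2) PF (Pd_dual m)).
by apply: aeS2 fF => x -> ->.
Qed.

End Frame.

(** * Cross products and dual matrices *)

Section CrossAlgebra.
Variable R : realType.
Local Notation C := R[i].

Lemma row'0_col_mx n (v : 'rV[C]_(1 + n)) (M : 'M[C]_(n, 1 + n)) j :
  row' 0 (col' j (col_mx v M)) = col' j M.
Proof.
apply/matrixP => i k; rewrite !mxE; case: splitP => i' /=.
  by case: i' => [[]].
by move=> ii'; congr (M _ _); apply/val_inj; case: ii'.
Qed.

Lemma col_mx0E n (v : 'rV[C]_(1 + n)) (M : 'M[C]_(n, 1 + n)) j : col_mx v M 0 j = v 0 j.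
Proof. by rewrite (_ : 0 = lshift n 0 :> 'I_(1 + n)) ?col_mxEu//; exact/val_inj. Qed.

Lemma crossE n (U : 'I_n -> 'rV[C]_n.+1) j :
  cross U 0 j = (-1) ^+ j * \det (col' j (\matrix_r U r)).
Proof.
rewrite mxE (expand_det_row _ (0 : 'I_(1 + n))) (bigD1 j)//= big1 ?addr0.
  by rewrite col_mx0E mxE !eqxx mul1r /cofactor add0n row'0_col_mx.
by move=> k kj; rewrite col_mx0E mxE (negPf kj) andbF mul0r.
Qed.

Lemma cross_dot n (U : 'I_n -> 'rV[C]_n.+1) (v : 'rV[C]_n.+1) :
  \sum_m v 0 m * cross U 0 m = \det (col_mx (v : 'rV_(1 + n)) (\matrix_r U r)).
Proof.
rewrite (expand_det_row _ (0 : 'I_(1 + n))); apply: eq_bigr => j _.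
by rewrite crossE col_mx0E /cofactor add0n row'0_col_mx.
Qed.

Lemma cross_dot_alternate n (U : 'I_n -> 'rV[C]_n.+1) i :
  \sum_m U i 0 m * cross U 0 m = 0.
Proof.
rewrite cross_dot; apply: (@determinant_alternate _ _ _ (lshift n 0) (rshift 1 i)) => // k.
by rewrite col_mxEu col_mxEd mxE.
Qed.

Lemma eq_cross n (U V : 'I_n -> 'rV[C]_n.+1) : U =1 V -> cross U = cross V.
Proof. by move=> UV; congr cross; apply/funext. Qed.

(** Both sides are determinants of w and the rows of A, with w and row r exchanged. This is the
    origin of the minus sign in front of E. *)
Lemma cross_dot_swap n (A : 'M[C]_(n, n.+1)) (w : 'rV[C]_n.+1) r :
  \sum_m A r m * cross (fun i => if i == r then w else row i A) 0 m =
  - \sum_m w 0 m * cross (fun i => row i A) 0 m.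
Proof.
transitivity (\sum_m (row r A) 0 m * cross (fun i => if i == r then w else row i A) 0 m).
  by apply: eq_bigr => m _; rewrite [row r A 0 m]mxE.
rewrite !cross_dot; set M := col_mx (w : 'rV_(1 + n)) _.
rewrite (_ : col_mx _ _ = xrow (lshift n 0) (rshift 1 r) M).
  rewrite xrowE det_mulmx det_perm odd_tperm.
  by rewrite (_ : lshift n 0 != rshift 1 r)//= expr1 mulN1r.
have ME i k : xrow (lshift n 0) (rshift 1 r) M i k = M (tperm (lshift n 0) (rshift 1 r) i) k.
  by rewrite /xrow mxE.
apply/matrixP => i k; rewrite ME; case: (splitP i) => j ij.
  have -> : i = lshift n 0 by apply/val_inj; rewrite /= ij ord1.
  by rewrite tpermL col_mxEu /M col_mxEd !mxE.
have -> : i = rshift 1 j by apply/val_inj.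
have [->|jr] := eqVneq j r; first by rewrite tpermR col_mxEd /M col_mxEu mxE eqxx.
rewrite tpermD; last 2 first.
- by apply/eqP => /(congr1 val).
- by apply: contra jr => /eqP /rshift_inj ->.
by rewrite /M !col_mxEd !mxE (negPf jr) !mxE.
Qed.

(** Of the sign (-1)^(r + m) of a cofactor the cross product contains (-1)^m; the remaining (-1)^r
    is the sign in the formulas on K_- and K_+. *)
Lemma cross_cofactor n (A : 'M[C]_n.+1) (r m : 'I_n.+1) :
  (-1) ^+ r * cross (fun i => row (lift r i) A) 0 m = cofactor A r m.
Proof.
rewrite crossE mulrA -exprD /cofactor; congr (_ * \det _).
by apply/matrixP => i j; rewrite !mxE.
Qed.

Lemma cross_conjc n (A : 'M[C]_(n, n.+1)) :
  cross (fun i => row i (mx_conjc A)) = mx_conjc (cross (fun i => row i A)).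
Proof.
apply/rowP => j; rewrite [RHS]mxE !crossE conjcM -[conjc (\det _)](det_map_mx conjc).
rewrite (rmorphXn conjc) (rmorphN1 conjc); congr (_ * \det _).
by apply/matrixP => i k; rewrite !mxE.
Qed.

(** * Invertible square matrices *)

Section SquareDual.
Variables (n : nat) (h : C) (A : 'M[C]_n.+1).
Hypotheses (h0 : h != 0) (detA : \det A != 0).

(** Row r of the inverse of h A^*, by Cramer's rule. *)
Definition square_dual (r : 'I_n.+1) : 'rV[C]_n.+1 :=
  ((-1) ^+ r / (h * \det (mx_conjc A))) *: cross (fun i => row (lift r i) (mx_conjc A)).

Lemma det_conjc_neq0 : \det (mx_conjc A) != 0.
Proof. by rewrite /mx_conjc det_map_mx fmorph_eq0. Qed.

Lemma square_dual_biorth r r' :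
  h * \sum_m square_dual r 0 m * conjc (A r' m) = (r == r')%:R.
Proof.
have d0 := det_conjc_neq0.
have /matrixP/(_ r' r) := mul_mx_adj (mx_conjc A); rewrite !mxE eq_sym => H.
apply: (mulfI d0); rewrite -mulr_natr in H; rewrite -H mulrA mulr_sumr.
apply: eq_bigr => m _; rewrite [(\adj _) _ _]mxE -cross_cofactor.
rewrite /square_dual mxE [mx_conjc A r' m]mxE.
by field; rewrite h0 d0.
Qed.

(** A left inverse of a square matrix is a right inverse: h B A^* = 1 implies h A^* B = 1, which is
    multiplied by A from the left. *)
Lemma square_dual_reproduce s m :
  h * \sum_j (\sum_r square_dual r 0 m * conjc (A r j)) * A s j = A s m.
Proof.
pose B := \matrix_(r, m) square_dual r 0 m.
have BA : (h *: B) *m (mx_conjc A)^T = 1%:M.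
  apply/matrixP => r r'; rewrite -scalemxAl mxE [RHS]mxE -square_dual_biorth mxE.
  by congr (_ * _); apply: eq_bigr => k _; rewrite !mxE.
have := congr1 (fun M => (A *m M) s m) (mulmx1C BA); rewrite mulmx1 => {1}<-.
rewrite mxE mulr_sumr; apply: eq_bigr => j _; rewrite mxE mulrA [RHS]mulrC; congr (_ * _).
rewrite mulr_sumr; apply: eq_bigr => r _.
by rewrite [(h *: B) r m]mxE [B r m]mxE [_^T j r]mxE [mx_conjc A r j]mxE; ring.
Qed.
End SquareDual.

(** * Matrices of full rank with one more column than rows *)

Section DeficientDual.
Variables (n : nat) (h : C) (A : 'M[C]_(n, n.+1)).
Let w : 'rV[C]_n.+1 := cross (fun i => row i A).
Let w2 : R := \sum_m sq (w 0 m).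
Hypotheses (h0 : h != 0) (w20 : w2 != 0).

(** These are the rows of the adjoint of the Moore-Penrose inverse of A, divided by h. *)
Definition deficient_dual (r : 'I_n) : 'rV[C]_n.+1 :=
  (- (h * w2%:C)^-1) *: cross (fun i => if i == r then w else row i (mx_conjc A)).

Let w2C : w2%:C != 0 :> C.
Proof. by rewrite eq_complex /= eqxx andbT. Qed.

Let w2E : \sum_m w 0 m * conjc (w 0 m) = w2%:C.
Proof.
by rewrite /w2 [RHS](rmorph_sum (real_complex R)); apply: eq_bigr => m _; exact: mulconjc_sq.
Qed.

Let Aw i : \sum_m A i m * w 0 m = 0.
Proof.
rewrite -[RHS](cross_dot_alternate (fun i => row i A) i).
by apply: eq_bigr => m _; rewrite [row i A 0 m]mxE.
Qed.

(** For r' = r, exchanging w with the row it has replaced gives - |w|^2; for r' != r the determinant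
    has two equal rows. *)
Lemma deficient_dual_biorth r r' :
  h * \sum_m deficient_dual r 0 m * conjc (A r' m) = (r == r')%:R.
Proof.
pose X r' := \sum_m mx_conjc A r' m *
  cross (fun i => if i == r then w else row i (mx_conjc A)) 0 m.
have -> : h * \sum_m deficient_dual r 0 m * conjc (A r' m) = - X r' / w2%:C.
  rewrite mulr_sumr /X mulNr mulr_suml -sumrN; apply: eq_bigr => m _.
  rewrite [deficient_dual r 0 m]mxE [mx_conjc A r' m]mxE.
  by field; rewrite h0 w2C.
case: (eqVneq r' r) => [->|r'r].
  rewrite /X cross_dot_swap cross_conjc.
  rewrite (eq_bigr (fun m => w 0 m * conjc (w 0 m))) ?opprK ?w2E ?divff//.
  by move=> m _; rewrite [mx_conjc _ 0 m]mxE.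
rewrite (_ : X r' = 0) ?oppr0 ?mul0r 1?eq_sym ?(negPf r'r)//.
rewrite -[RHS](cross_dot_alternate (fun i => if i == r then w else row i (mx_conjc A)) r').
by apply: eq_bigr => m _; rewrite (negPf r'r) [row _ _ 0 m]mxE.
Qed.

Let At := (mx_conjc A)^T.
(** A square matrix with the columns w and the conjugated rows of A. As det T = |w|^2 is not 0, an
    identity of matrices can be checked on these columns. *)
Let T := row_mx w^T At.

Let detT : \det T = w2%:C.
Proof.
have -> : T = (col_mx w (mx_conjc A))^T by rewrite tr_col_mx.
rewrite (@det_tr _ (1 + n)) -w2E.
have := cross_dot (fun i => row i (mx_conjc A)) w.
rewrite (_ : \matrix_r row r _ = mx_conjc A); last by apply/matrixP => i j; rewrite !mxE.
move=> <-; rewrite cross_conjc; apply: eq_bigr => m _.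
by rewrite [mx_conjc _ 0 m]mxE.
Qed.

(* Times |w|^2, both sides are the determinant of the product of the matrix with
   rows conj w, A and its adjoint; w is orthogonal to the rows of conj A. *)
Lemma det_gram : \det (A *m mx_adjoint A) = w2%:C.
Proof.
apply: (mulfI w2C).
have -> : w2%:C * \det (A *m At) =
    \det (col_mx (mx_conjc w) A *m row_mx w^T At).
  rewrite mul_col_row (_ : A *m w^T = 0); last first.
    apply/matrixP => i j; rewrite !mxE -[RHS](Aw i); apply: eq_bigr => m _.
    by rewrite mxE ord1.
  rewrite det_ublock; congr (_ * _).
  rewrite det_mx11 mxE -w2E; apply: eq_bigr => m _; rewrite !mxE mulrC.
  by [].
rewrite det_mulmx detT; congr (_ * _).
rewrite -[A in col_mx _ A](_ : \matrix_r row r A = A); last by apply/matrixP => i j; rewrite !mxE.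
rewrite -cross_dot -w2E; apply: eq_bigr => m _.
by rewrite [mx_conjc _ 0 m]mxE mulrC.
Qed.

(** h A A^* B - A vanishes on the columns of A^*, since h B A^* = 1, and on w, since A w = 0 and B w
    = 0; these columns span the whole space. *)
Lemma deficient_dual_reproduce s m :
  h * \sum_j (\sum_r deficient_dual r 0 m * conjc (A r j)) * A s j = A s m.
Proof.
pose B := \matrix_(r, m) deficient_dual r 0 m.
have BA : (h *: B) *m At = 1%:M.
  apply/matrixP => r r'; rewrite -scalemxAl mxE [RHS]mxE -deficient_dual_biorth mxE.
  by congr (_ * _); apply: eq_bigr => k _; rewrite !mxE.
have Awt : A *m w^T = 0.
  apply/matrixP => i j; rewrite !mxE -[RHS](Aw i); apply: eq_bigr => k _.
  by rewrite mxE ord1.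
have Bwt : B *m w^T = 0.
  apply/matrixP => i j; rewrite !mxE ord1.
  rewrite -[RHS](mulr0 (- (h * w2%:C)^-1)).
  rewrite -[X in _ = _ * X](cross_dot_alternate (fun k => if k == i then w else row k (mx_conjc A)) i).
  rewrite mulr_sumr; apply: eq_bigr => k _.
  by rewrite eqxx [B i k]mxE [_^T k 0]mxE [deficient_dual i 0 k]mxE; ring.
have AX : A *m (At *m (h *: B) - 1%:M) = 0.
  have Tu : T \in unitmx by rewrite unitmxE detT unitfE.
  have : A *m (At *m (h *: B) - 1%:M) *m T = 0.
    rewrite -mulmxA /T mul_mx_row !mulmxBl !mul1mx -!mulmxA BA mulmx1 subrr.
    by rewrite -scalemxAl Bwt scaler0 mulmx0 sub0r mul_mx_row mulmxN Awt mulmx0 oppr0 row_mx0.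
  by move=> /(congr1 (mulmx^~ (invmx T))) /=; rewrite mul0mx mulmxK.
move: AX; rewrite mulmxBr mulmx1 => /eqP; rewrite subr_eq0 => /eqP H.
have := congr1 (fun M : 'M[C]_(n, n.+1) => M s m) H => /= {1}<-.
rewrite mxE mulr_sumr; apply: eq_bigr => j _; rewrite mxE mulrA [RHS]mulrC; congr (_ * _).
rewrite mulr_sumr; apply: eq_bigr => r _.
by rewrite [(h *: B) r m]mxE [B r m]mxE [_^T j r]mxE [mx_conjc A r j]mxE; ring.
Qed.

End DeficientDual.

(** * Scaling and bounds of determinants and cross products *)

Lemma cross_scale n (a : C) (U : 'I_n -> 'rV[C]_n.+1) :
  cross (fun i => a *: U i) = a ^+ n *: cross U.
Proof.
apply/rowP => j; rewrite [RHS]mxE !crossE mulrCA -detZ; congr (_ * \det _).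
by apply/matrixP => i k; rewrite !mxE.
Qed.

Lemma sq1 : sq (1 : C) = 1.
Proof. by rewrite -[1](_ : 1%:C = 1)// sq_real expr1n. Qed.

Lemma sq_sign k : sq ((-1) ^+ k : C) = 1.
Proof. by rewrite -signr_odd; case: odd; rewrite ?expr1 ?sqN ?expr0 sq1. Qed.

Lemma sq_prod (I : Type) (t : seq I) (P : pred I) (F : I -> C) :
  sq (\prod_(i <- t | P i) F i) = \prod_(i <- t | P i) sq (F i).
Proof. by apply: (big_morph _ _ sq1) => z z'; exact: sqM. Qed.

(** In Leibniz' formula there are n! terms, of squared modulus at most g^n when the entries have
    squared modulus at most g; the square of the sum costs another n!. *)
Definition det_bound n (g : R) : R := #|{perm 'I_n}|%:R ^+ 2 * g ^+ n.

Lemma sq_det_le n (M : 'M[C]_n) (g : R) :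
  (forall i j, sq (M i j) <= g) -> sq (\det M) <= det_bound n g.
Proof.
move=> Mg; rewrite /determinant (big_enum_val (fun s : {perm 'I_n} => _)) /=.
apply: le_trans (sq_sum_le _) _; rewrite /det_bound expr2 -mulrA.
apply: ler_wpM2l => //.
apply: (@le_trans _ _ (\sum_(i < #|{perm 'I_n}|) g ^+ n)); last first.
  by rewrite sumr_const card_ord mulr_natl.
apply: ler_sum => s _; rewrite sqM sq_sign mul1r sq_prod.
apply: (@le_trans _ _ (\prod_(i < n) g)); last by rewrite prodr_const card_ord.
by apply: ler_prod => i _; rewrite sq_ge0 Mg.
Qed.

Lemma sq_cross_le n (U : 'I_n -> 'rV[C]_n.+1) (g : R) m :
  (forall i j, sq (U i 0 j) <= g) -> sq (cross U 0 m) <= det_bound n g.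
Proof.
move=> Ug; by rewrite crossE sqM sq_sign mul1r; apply: sq_det_le => i j; rewrite !mxE.
Qed.

End CrossAlgebra.

(** i <= g i by induction from below, and g i <= i because the values at the n - 1 - i larger
    indices must fit above g i. *)
Lemma increasing_self n (g : 'I_n -> 'I_n) :
  (forall i j : 'I_n, (i < j)%N -> (g i < g j)%N) -> g =1 id.
Proof.
move=> gi i; apply/val_inj/eqP => /=; rewrite eqn_leq; apply/andP; split.
  suff H k : forall i : 'I_n, (i + k < n)%N -> (g i + k < n)%N.
    by have := H (n.-1 - i)%N i; have := ltn_ord i; lia.
  elim: k => [|k IH] {}i; first by rewrite !addn0 => _; exact: ltn_ord.
  move=> ikn; have i1 : (i.+1 < n)%N by lia.
  have := gi i (Ordinal i1) (ltnSn i); have := IH (Ordinal i1); rewrite /=; lia.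
case: i => i ilt /=; elim: i ilt => [//|i IH] ilt.
by apply: leq_ltn_trans (IH (ltnW ilt)) _; exact: gi.
Qed.

(** By cardinality some i is missed; after removing i from the target, f is an increasing map of
    'I_n to itself, hence the identity. *)
Lemma increasing_lift n (f : {ffun 'I_n -> 'I_n.+1}) :
  increasing f -> exists i : 'I_n.+1, forall k, f k = lift i k.
Proof.
move=> /forallP fi.
have fi' (i j : 'I_n) : (i < j)%N -> (f i < f j)%N by have /forallP/(_ j)/implyP := fi i.
have finj : injective f.
  by move=> i j fij; apply/val_inj => /=; case: (ltngtP i j) => // /fi'; rewrite fij ltnn.
have [i iN] : exists i, i \notin codom f.
  apply/existsP; rewrite -negb_forall; apply/negP => /forallP H.
  have Hc : codom f =i 'I_n.+1 by move=> x; rewrite H.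
  by have := card_codom finj; rewrite (eq_card Hc) !card_ord => /eqP; rewrite gtn_eqF.
have /fin_all_exists[g gE] : forall k, exists j, f k = lift i j.
  move=> k; have [|j fk _] := @unlift_some _ i (f k); last by exists j.
  by apply: contra iN => /eqP ->; exact: codom_f.
exists i => k; rewrite gE; congr (lift i _); apply: increasing_self => {}k j kj.
have := fi' _ _ kj; rewrite !gE /= !ltnNge; apply: contra => ?; by rewrite leq_bump2.
Qed.

(* An increasing map from 'I_n to 'I_n.+1 omits a single index, and the minors
   that do not omit the last row vanish. *)
Lemma sum_sq_minors_le (R : realType) n (J : 'M[R[i]]_n.+1) : (0 < n)%N ->
  (forall j, J ord_max j = 0) ->
  sum_sq_minors n J <= #|{ffun 'I_n -> 'I_n.+1}|%:R ^+ 2 *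
    \sum_m sq (cross (fun i => row i (row' ord_max J)) 0 m).
Proof.
move=> n0 J0; set W := \sum_m _.
have W0 : 0 <= W by apply: sumr_ge0 => m _; exact: sq_ge0.
have term (f g : {ffun 'I_n -> 'I_n.+1}) : increasing f -> increasing g ->
    sq (\det (mxsub f g J)) <= W.
  move=> /increasing_lift[a fa] /increasing_lift[b gb].
  have [am|am] := eqVneq a ord_max.
    rewrite /W (bigD1 b)//= (_ : sq (\det _) = sq (cross (fun i => row i (row' ord_max J)) 0 b)).
      by rewrite lerDl; apply: sumr_ge0 => m _; exact: sq_ge0.
    rewrite crossE sqM sq_sign mul1r; congr (sq (\det _)).
    by apply/matrixP => i j; rewrite !mxE fa gb am.
  have [k ak _] := unlift_some am.
  rewrite (_ : \det _ = 0) ?sq0// (expand_det_row _ k) big1// => j _.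
  by rewrite mxE fa -ak J0 mul0r.
rewrite expr2 -mulrA /sum_sq_minors big_mkcond /=.
rewrite mulr_natl -sumr_const; apply: ler_sum => f _.
case: ifPn => [fi|_]; last by rewrite mulr_ge0.
rewrite big_mkcond /= mulr_natl -sumr_const; apply: ler_sum => g _.
by case: ifPn => // gi; exact: term.
Qed.

(** * The dual generators *)

Section Symbols.
Variables (R : realType) (l : nat) (omega h : R).
Local Notation C := R[i].
Local Notation mu := (@lebesgue_measure R).
Let n := (2 * l - 2)%N.
Hypotheses (l2 : (2 <= l)%N) (h0 : 0 < h)
  (hl1 : omega <= (l%:R - 1 / 2) * h) (hl2 : (l%:R - 1) * h < omega).

Local Notation Km := (Kminus l omega h).
Local Notation K := (Kzero l omega h).
Local Notation Kp := (Kplus l omega h).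
Local Notation a := (first_index l omega h).

Let hS1 : omega <= l%:R * h - h / 2.
Proof. by apply: le_trans hl1 _; rewrite mulrBl; lra. Qed.

Let hS2 : l%:R * h - h < omega.
Proof. by apply: le_lt_trans hl2; rewrite mulrBl mul1r. Qed.

(** * The pieces of the cell ]0, h[ and the rows in the band *)

Definition generic (y : R) := [|| y \in Km, y \in K | y \in Kp].

Lemma Km_itv y : (y \in Km) = (0 < y < omega - l%:R * h + h).
Proof. by rewrite mem_setE in_itv/= mulrBl mul1r opprB addrA addrAC. Qed.

Lemma K_itv y : (y \in K) = (omega - l%:R * h + h < y < - omega + l%:R * h).
Proof. by rewrite mem_setE in_itv/= mulrBl mul1r opprB addrA addrAC. Qed.

Lemma Kp_itv y : (y \in Kp) = (- omega + l%:R * h < y < h).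
Proof. by rewrite mem_setE in_itv. Qed.

Lemma ae_generic : {ae mu, forall y, `]0, h[%classic y -> generic y}.
Proof.
apply: aeS2 (ae_neq (omega - l%:R * h + h)) (ae_neq (- omega + l%:R * h)).
move=> y y1 y2; rewrite /= in_itv/= => /andP[y0 yh].
rewrite /generic Km_itv K_itv Kp_itv y0 yh /= andbT.
by case: (ltgtP y (omega - _ + _)) y1 => //= y1 _; case: (ltgtP y (- omega + _)) y2.
Qed.

Lemma generic_D y : generic y -> `]0, h[%classic y.
Proof.
move=> gy; have [y1 y2] : 0 < y /\ y < h.
  by move: h0 hS1 hS2 gy => h_gt0 w1 w2; rewrite /generic Km_itv K_itv Kp_itv => /or3P[] /andP[y1 y2]; split; lra.
by rewrite /= in_itv/= y1.
Qed.

Lemma band_piece (y : R) (k p q : int) :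
  - omega < y + p%:~R * h -> y + (p - 1)%:~R * h <= - omega ->
  y + q%:~R * h < omega -> omega <= y + (q + 1)%:~R * h ->
  (- omega < y + k%:~R * h < omega) = (p <= k <= q).
Proof.
have kh (i j : int) : i <= j -> i%:~R * h <= j%:~R * h.
  by move=> ij; apply: ler_wpM2r; [exact: ltW|rewrite ler_int].
move=> p1 p2 q1 q2; apply/idP/idP => /andP[].
- move=> k1 k2; apply/andP; split; rewrite leNgt; apply/negP => lt.
  + have /kh : k <= p - 1 by move: lt; clear; lia.
    lra.
  + have /kh : q + 1 <= k by move: lt; clear; lia.
    lra.
- by move=> /kh k1 /kh k2; apply/andP; split; lra.
Qed.

(** The indices in the band run from -(l - 1) to l - 1 on K_-, from -(l - 1) to l - 2 on K, and from
    -l to l - 2 on K_+. Counted from [first_index] these are all rows, except for the last one on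
    K. *)
Lemma in_band (y : R) (k : int) : generic y ->
  (y + k%:~R * h \in `]- omega, omega[%classic) =
  [&& 0 <= k - a y, k - a y <= n%:Z & ~~ ((y \in K) && (k - a y == n%:Z))].
Proof.
have lZ : (l%:Z)%:~R = l%:R :> R by rewrite -pmulrn.
move: h0 hS1 hS2 => h_gt0 w1 w2.
rewrite mem_setE in_itv/= /generic /first_index.
have [yp _|yp] := boolP (y \in Kp).
  have yK : (y \in K) = false.
    by apply/negP; move: yp; rewrite K_itv Kp_itv => /andP[? ?] /andP[? ?]; lra.
  rewrite yK /= andbT; move: yp; rewrite Kp_itv => /andP[y1 y2].
  rewrite (@band_piece _ _ (- l%:Z) (l%:Z - 2)); last 4 first.
  - rewrite rmorphN/= ?mulr1z ?lZ; lra.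
  - rewrite rmorphB rmorphN/= ?mulr1z ?lZ; lra.
  - rewrite rmorphB/= ?mulr1z ?lZ; lra.
  - rewrite rmorphD rmorphB/= ?mulr1z ?lZ; lra.
  by move: l2; rewrite /n; clear => l2; apply/idP/idP => /andP[? ?]; apply/andP; lia.
have [yK _|yK] := boolP (y \in K).
  move: yK; rewrite K_itv => /andP[y1 y2].
  rewrite (@band_piece _ _ (- (l%:Z - 1)) (l%:Z - 2)); last 4 first.
  - rewrite rmorphN rmorphB/= ?mulr1z ?lZ; lra.
  - rewrite rmorphB rmorphN rmorphB/= ?mulr1z ?lZ; lra.
  - rewrite rmorphB/= ?mulr1z ?lZ; lra.
  - rewrite rmorphD rmorphB/= ?mulr1z ?lZ; lra.
  by move: l2; rewrite /n; clear => l2; apply/idP/idP; lia.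
rewrite orbF orbF Km_itv => /andP[y1 y2].
rewrite (@band_piece _ _ (- (l%:Z - 1)) (l%:Z - 1)); last 4 first.
- rewrite rmorphN rmorphB/= ?mulr1z ?lZ; lra.
- rewrite rmorphB rmorphN rmorphB/= ?mulr1z ?lZ; lra.
- rewrite rmorphB/= ?mulr1z ?lZ; lra.
- rewrite rmorphD rmorphB/= ?mulr1z ?lZ; lra.
by move: l2; rewrite /n; clear => l2; apply/idP/idP; lia.
Qed.

Variables (P : 'I_n.+1 -> R -> C) (gamma : R).
Hypotheses (mP : forall j, cmeas (P j)) (Pg : forall j x, sq (P j x) <= gamma)
  (oP : forall j x, x \notin `]- omega, omega[%classic -> P j x = 0).

(** The matrix A: the pre-Gramian without the factor sqrt h. *)
Definition symbol (y : R) : 'M[C]_n.+1 :=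
  \matrix_(r, m) P m (y + (a y + r%:Z)%:~R * h).

(** The matrix B. On K a last row of zeros is added, matching that of [symbol], so that B has the
    same shape on all pieces. *)
Definition dual_symbol (y : R) : 'M[C]_n.+1 := \matrix_(r, m)
  if (y \in K) then
    if unlift ord_max r is Some r' then
      deficient_dual h%:C (row' ord_max (symbol y)) r' 0 m else 0
  else square_dual h%:C (symbol y) r 0 m.

Definition nullvec (y : R) : 'rV[C]_n.+1 := cross (fun i => row i (row' ord_max (symbol y))).

Variables (eta sigma : R).
Hypotheses (eta0 : 0 < eta) (sigma0 : 0 < sigma).

Definition regular_point (y : R) := [/\ generic y,
  y \in K -> sigma <= \sum_m sq (nullvec y 0 m) &
  y \notin K -> eta <= sq (\det (symbol y))].

Let hC : (h%:C : C) != 0.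
Proof. by rewrite eq_complex /= eqxx andbT gt_eqF. Qed.

Lemma symbol_last y m : generic y -> y \in K -> symbol y ord_max m = 0.
Proof.
move=> gy yK; rewrite mxE oP// in_band// yK /=.
by rewrite addrAC subrr add0r eqxx !andbF.
Qed.

Lemma row'_symbol y r m :
  row' ord_max (symbol y) r m = symbol y (lift ord_max r) m.
Proof. by rewrite [LHS]mxE. Qed.

Lemma dual_symbol_last y m : y \in K -> dual_symbol y ord_max m = 0.
Proof. by move=> yK; rewrite mxE yK unlift_none. Qed.

Lemma dual_symbol_lift y (yK : y \in K) r m : dual_symbol y (lift ord_max r) m =
  deficient_dual h%:C (row' ord_max (symbol y)) r 0 m.
Proof. by rewrite mxE yK liftK. Qed.

Lemma dual_symbol_square y (yK : y \notin K) r m :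
  dual_symbol y r m = square_dual h%:C (symbol y) r 0 m.
Proof. by rewrite mxE (negPf yK). Qed.

Lemma det_symbol_neq0 y : regular_point y -> y \notin K -> \det (symbol y) != 0.
Proof.
move=> [_ _ H] /H; apply: contraL => /eqP ->.
by rewrite sq0 -ltNge.
Qed.

Lemma nullvec_neq0 y : regular_point y -> y \in K -> \sum_m sq (nullvec y 0 m) != 0.
Proof. by move=> [_ H _] /H; apply: contraL => /eqP ->; rewrite -ltNge. Qed.

Lemma symbol_biorth y r r' : regular_point y ->
  h%:C * \sum_j dual_symbol y r j * conjc (symbol y r' j) =
  ((r == r') && ~~ ((y \in K) && (r == ord_max)))%:R.
Proof.
move=> ny; have [gy _ _] := ny; have [yK|yK] := boolP (y \in K); last first.
  rewrite /= andbT -(square_dual_biorth hC (det_symbol_neq0 ny yK)).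
  by congr (_ * _); apply: eq_bigr => m _; rewrite dual_symbol_square.
rewrite /=; case: (unliftP ord_max r) => [r1 ->|->].
  rewrite [lift _ _ == ord_max]eq_sym (negPf (neq_lift _ _)) andbT.
  case: (unliftP ord_max r') => [r1' ->|->].
    rewrite (inj_eq lift_inj) -(deficient_dual_biorth hC (nullvec_neq0 ny yK)).
    by congr (_ * _); apply: eq_bigr => m _; rewrite dual_symbol_lift// -row'_symbol.
  rewrite [lift _ _ == ord_max]eq_sym (negPf (neq_lift _ _)) big1 ?mulr0// => m _.
  by rewrite symbol_last// conjc0 mulr0.
by rewrite eqxx andbF big1 ?mulr0// => m _; rewrite dual_symbol_last// mul0r.
Qed.

Lemma symbol_reproduce y s m : regular_point y ->
  h%:C * \sum_j (\sum_r dual_symbol y r m * conjc (symbol y r j)) * symbol y s j =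
  symbol y s m.
Proof.
move=> ny; have [gy _ _] := ny; have [yK|yK] := boolP (y \in K); last first.
  rewrite -[RHS](square_dual_reproduce hC (det_symbol_neq0 ny yK)).
  congr (_ * _); apply: eq_bigr => j _; congr (_ * _); apply: eq_bigr => r _.
  by rewrite dual_symbol_square.
case: (unliftP ord_max s) => [s1 ->|->]; last first.
  by rewrite symbol_last// big1 ?mulr0// => j _; rewrite symbol_last// mulr0.
rewrite -[RHS]row'_symbol.
rewrite -[RHS](deficient_dual_reproduce hC (nullvec_neq0 ny yK)).
congr (_ * _); apply: eq_bigr => j _; rewrite -row'_symbol; congr (_ * _).
rewrite (bigD1_ord ord_max)//= dual_symbol_last// mul0r add0r.
by apply: eq_bigr => r _; rewrite dual_symbol_lift// -row'_symbol.
Qed.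

(** The first term bounds the cofactors of A divided by h det A. The second one is for K: the
    factors of the cross product are rows of conj A, with entries bounded by gamma, and w, itself a
    cross product; the denominator is h |w|^2. *)
Definition dual_symbol_bound : R := (h ^+ 2 * eta)^-1 * det_bound n gamma +
  (h ^+ 2 * sigma ^+ 2)^-1 * det_bound n (Num.max gamma (det_bound n gamma)).

Lemma sq_symbol y r m : sq (symbol y r m) <= gamma.
Proof. by rewrite mxE. Qed.

Let det_bound_ge0 (g : R) : 0 <= g -> 0 <= det_bound n g.
Proof. by move=> g0; rewrite /det_bound mulr_ge0// exprn_ge0. Qed.

Let dual_symbol_bound_terms : 0 <= gamma -> 0 <= (h ^+ 2 * eta)^-1 * det_bound n gamma /\
  0 <= (h ^+ 2 * sigma ^+ 2)^-1 * det_bound n (Num.max gamma (det_bound n gamma)).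
Proof.
move=> g0; split.
  by rewrite mulr_ge0 ?det_bound_ge0// invr_ge0 mulr_ge0 ?sqr_ge0 ?ltW.
by rewrite mulr_ge0 ?det_bound_ge0 ?le_max ?g0// invr_ge0 mulr_ge0 ?sqr_ge0.
Qed.

Lemma dual_symbol_bound_ge0 : 0 <= gamma -> 0 <= dual_symbol_bound.
Proof. by move=> /dual_symbol_bound_terms[t1 t2]; exact: addr_ge0. Qed.

Lemma dual_symbol_le y r m : regular_point y -> sq (dual_symbol y r m) <= dual_symbol_bound.
Proof.
move=> ny; have [gy Hs He] := ny.
have g0 : 0 <= gamma by exact: le_trans (sq_ge0 _) (sq_symbol y r m).
have [t1 t2] := dual_symbol_bound_terms g0.
have [yK|yK] := boolP (y \in K); last first.
  rewrite dual_symbol_square// mxE sqM sqM sq_sign mul1r sqV sqM sq_real.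
  rewrite /dual_symbol_bound -[leLHS]addr0; apply: lerD => //.
  have -> : sq (\det (mx_conjc (symbol y))) = sq (\det (symbol y)).
    by rewrite /mx_conjc det_map_mx sqJ.
  have d0 : 0 < sq (\det (symbol y)) by exact: lt_le_trans (He yK).
  have h20 : 0 < h ^+ 2 by exact: exprn_gt0.
  apply: ler_pM; [by rewrite invr_ge0 ltW// mulr_gt0|exact: sq_ge0| |].
    have p1 := mulr_gt0 h20 eta0; have p2 := mulr_gt0 h20 d0.
    by rewrite lef_pV2 ?posrE// ler_pM2l// He.
  by apply: sq_cross_le => i j; rewrite !mxE sqJ.
case: (unliftP ord_max r) => [r1 ->|->]; last first.
  by rewrite dual_symbol_last// sq0 addr_ge0.
rewrite dual_symbol_lift// mxE sqM sqN sqV sqM !sq_real.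
rewrite /dual_symbol_bound -[leLHS]add0r; apply: lerD => //.
have s1 := Hs yK.
have W0 : 0 < \sum_m0 sq (nullvec y 0 m0) by exact: lt_le_trans s1.
have h20 : 0 < h ^+ 2 by exact: exprn_gt0.
apply: ler_pM; [|exact: sq_ge0| |].
- by rewrite invr_ge0 ltW// mulr_gt0// exprn_gt0.
- have p1 := mulr_gt0 h20 (exprn_gt0 2 sigma0); have p2 := mulr_gt0 h20 (exprn_gt0 2 W0).
  rewrite lef_pV2 ?posrE// ler_pM2l//.
  by rewrite ler_pXn2r// nnegrE ltW.
apply: sq_cross_le => i j; case: ifP => _; rewrite le_max.
  by apply/orP; right; apply: sq_cross_le => i' j'; rewrite !mxE.
by rewrite !mxE sqJ Pg.
Qed.

(** * Measurability of the matrices and clipping *)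

Lemma measurable_mem (A : set R) : measurable A -> measurable_fun setT (fun x => x \in A).
Proof.
move=> mA; apply: (measurable_fun_bool true) => //; rewrite setTI.
by rewrite (_ : _ @^-1` _ = A)//; apply/seteqP; split => x /=; [move=> /set_mem|move=> /mem_set].
Qed.

Lemma cmeas_symbol r m : cmeas (fun y => symbol y r m).
Proof.
rewrite (_ : (fun y => _) = fun y => if y \in Kp
    then P m (y + (- l%:Z + r%:Z)%:~R * h) else P m (y + (- (l%:Z - 1) + r%:Z)%:~R * h)).
  by apply: cmeas_if; [apply: measurable_mem; exact: measurable_itv| |]; exact: cmeas_shift.
by apply/funext => y; rewrite mxE /first_index; case: ifP.
Qed.

Lemma cmeas_cross k (U : R -> 'I_k -> 'rV[C]_k.+1) m :
  (forall i j, cmeas (fun y => U y i 0 j)) -> cmeas (fun y => cross (U y) 0 m).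
Proof.
move=> mU; rewrite (_ : (fun y => _) =
    fun y => (-1) ^+ m * \det (col' m (\matrix_r U y r))); last first.
  by apply/funext => y; rewrite crossE.
apply: cmeasM; first exact: cmeas_cst.
apply: cmeas_det => i j; rewrite (_ : (fun y => _) = fun y => U y i 0 (lift m j))//.
by apply/funext => y; rewrite !mxE.
Qed.

Lemma cmeas_nullvec m : cmeas (fun y => nullvec y 0 m).
Proof.
apply: cmeas_cross => i j; rewrite (_ : (fun y => _) = fun y => symbol y (lift ord_max i) j).
  exact: cmeas_symbol.
by apply/funext => y; rewrite -row'_symbol mxE.
Qed.

Lemma cmeas_dual_symbol r m : cmeas (fun y => dual_symbol y r m).
Proof.
have mc i j : cmeas (fun y => mx_conjc (symbol y) i j).
  rewrite (_ : (fun y => _) = fun y => conjc (symbol y i j)).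
    exact/cmeasJ/cmeas_symbol.
  by apply/funext => y; rewrite [LHS]mxE.
rewrite (_ : (fun y => _) = fun y => if y \in K then
    (if unlift ord_max r is Some r' then
      deficient_dual h%:C (row' ord_max (symbol y)) r' 0 m else 0)
    else square_dual h%:C (symbol y) r 0 m); last first.
  by apply/funext => y; rewrite [LHS]mxE.
apply: cmeas_if; first by apply: measurable_mem; exact: measurable_itv.
- case: unlift => [r'|]; last exact: cmeas_cst.
  rewrite (_ : (fun y => _) = fun y => (- (h%:C * (\sum_m sq (nullvec y 0 m))%:C)^-1) *
    cross (fun i => if i == r' then nullvec y else row i (mx_conjc (row' ord_max (symbol y)))) 0 m); last first.
    by apply/funext => y; rewrite [LHS]mxE.
  apply: cmeasM.
    apply: cmeasN; apply: cmeasV; apply: cmeasM; first exact: cmeas_cst.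
    apply: cmeas_real; apply: measurable_sum => k.
    by apply: measurable_sq; exact: cmeas_nullvec.
  apply: cmeas_cross => i j; case: eqP => _; first exact: cmeas_nullvec.
  rewrite (_ : (fun y => _) = fun y => mx_conjc (symbol y) (lift ord_max i) j)//.
  by apply/funext => y; rewrite !mxE.
- rewrite (_ : (fun y => _) = fun y => ((-1) ^+ r / (h%:C * \det (mx_conjc (symbol y)))) *
    cross (fun i => row (lift r i) (mx_conjc (symbol y))) 0 m); last first.
    by apply/funext => y; rewrite [LHS]mxE.
  apply: cmeasM.
    apply: cmeasM; first exact: cmeas_cst.
    by apply: cmeasV; apply: cmeasM; [exact: cmeas_cst|exact: cmeas_det].
  apply: cmeas_cross => i j.
  rewrite (_ : (fun y => _) = fun y => mx_conjc (symbol y) (lift r i) j)//.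
  by apply/funext => y; rewrite [LHS]mxE.
Qed.

(* Makes a support condition and a bound that hold a.e. hold everywhere. *)
Definition clip (b : R) (f : R -> C) (x : R) : C :=
  if (x \in `]- omega, omega[%classic) && (sq (f x) <= b) then f x else 0.

Lemma cmeas_clip b f : cmeas f -> cmeas (clip b f).
Proof.
move=> mf; apply: cmeas_if => //; last exact: cmeas_cst.
apply: measurable_and; first by apply: measurable_mem; exact: measurable_itv.
by apply: measurable_fun_ler; [exact: measurable_sq|exact: measurable_cst].
Qed.

Lemma clip_out b f x : x \notin `]- omega, omega[%classic -> clip b f x = 0.
Proof. by rewrite /clip => /negPf ->. Qed.

Lemma sq_clip_le b f x : 0 <= b -> sq (clip b f x) <= b.
Proof. by move=> b0; rewrite /clip; case: ifP => [/andP[]//|]; rewrite sq0. Qed.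

Lemma osupp_clip b f : 0 < omega -> cmeas f -> 0 <= b -> osupp omega (clip b f).
Proof.
move=> o0 mf b0; have mc := cmeas_clip b mf.
have o2 : - omega < omega by lra.
have cout x : x \notin `[- omega, omega]%classic -> clip b f x = 0.
  move=> xn; apply: clip_out; apply: contra xn; rewrite !mem_setE !in_itv/= => /andP[/ltW -> /ltW ->] //.
split => //; split.
  split => //; have := (@L2D_bounded _ _ _ o2 _ b mc (fun x _ => sq_clip_le f x b0)).2.
  rewrite sqn_mkcond (_ : (fun x => _) = clip b f)//.
  by apply/funext => x; case: ifPn => // /clip_out ->.
exists omega => x xo; apply: cout; apply/negP; rewrite mem_setE in_itv/= => /andP[h1 h2].
by move: xo; rewrite ltNge ler_norml h1 h2.
Qed.

(* The only possible r is k - first_index y, if x = y + k h. *)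
Definition dual_raw m (x : R) : C := let y := reduce_mod h x in
  \sum_(r < n.+1) if x == y + (a y + r%:Z)%:~R * h then dual_symbol y r m else 0.

Definition dual_fourier m : R -> C := clip dual_symbol_bound (dual_raw m).

Lemma cmeas_dual_raw m : cmeas (dual_raw m).
Proof.
apply: cmeas_sum => r; apply: cmeas_if; last exact: cmeas_cst.
- apply: measurable_fun_eqr => //.
  apply: measurable_funD; first exact: measurable_reduce_mod.
  apply: measurable_funM; last exact: measurable_cst.
  rewrite (_ : (fun x => _) = fun x => if reduce_mod h x \in Kp then (- l%:Z + r%:Z)%:~R
     else (- (l%:Z - 1) + r%:Z)%:~R); last by apply/funext => x; rewrite /first_index; case: ifP.
  apply: measurable_fun_ifT; [|exact: measurable_cst|exact: measurable_cst].
  apply: (measurableT_comp (measurable_mem _)); [exact: measurable_itv|exact: measurable_reduce_mod].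
- apply: (cmeas_comp (cmeas_dual_symbol r m)); exact: measurable_reduce_mod.
Qed.

Lemma band_row y (k : int) : generic y -> y + k%:~R * h \in `]- omega, omega[%classic ->
  exists r : 'I_n.+1, k = a y + r%:Z /\ ~~ ((y \in K) && (r == ord_max)).
Proof.
move=> gy; rewrite in_band// => /and3P[k1 k2 k3].
have kn : (absz (k - a y) < n.+1)%N by move: k1 k2; clear; lia.
exists (Ordinal kn); split; first by move: k1; clear; rewrite /=; lia.
apply: contra k3 => /andP[-> /eqP /(congr1 val) /= kE]; rewrite -kE; apply/eqP; move: k1; clear; lia.
Qed.

(** Clipping has no effect here: [dual_symbol_le] gives the bound, and the only row outside the band
    is the last one on K, where B is 0. *)
Lemma dual_fourier_row y (r : 'I_n.+1) m : regular_point y ->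
  dual_fourier m (y + (a y + r%:Z)%:~R * h) = dual_symbol y r m.
Proof.
move=> ny; have [gy _ _] := ny; rewrite /dual_fourier /clip.
have -> : dual_raw m (y + (a y + r%:Z)%:~R * h) = dual_symbol y r m.
  rewrite /dual_raw (reduce_modP h0)//; last exact: generic_D.
  rewrite (bigD1 r)//= eqxx big1 ?addr0// => r' r'r.
  case: eqP => // /addrI /(mulIf (lt0r_neq0 h0)) /intr_inj /addrI [] rr'.
  by case/eqP: r'r; apply/val_inj.
rewrite dual_symbol_le// andbT in_band//.
case: ifPn => // /negP rn.
have [/andP[yK /eqP ->]|yr] := boolP ((y \in K) && (r == ord_max)).
  by rewrite dual_symbol_last.
case: rn; have := ltn_ord r; rewrite addrAC subrr add0r => rn.
apply/and3P; split; [by []|by rewrite lez_nat -ltnS|].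
by apply: contra yr => /andP[-> /eqP[] rE]; apply/eqP/val_inj.
Qed.

Lemma dual_fourier_biorth y (k k' : int) : regular_point y ->
  h%:C * \sum_j dual_fourier j (y + k%:~R * h) * conjc (P j (y + k'%:~R * h)) =
  if (k' == k) && (y + k%:~R * h \in `]- omega, omega[%classic) then 1 else 0.
Proof.
move=> ny; have [gy _ _] := ny.
have [kb|kb] := boolP (y + k%:~R * h \in _); last first.
  by rewrite andbF big1 ?mulr0// => j _; rewrite /dual_fourier clip_out// mul0r.
have [k'b|k'b] := boolP (y + k'%:~R * h \in `]- omega, omega[%classic); last first.
  rewrite andbT ifF; last by apply: contraNF k'b => /eqP ->.
  by rewrite big1 ?mulr0// => j _; rewrite oP// conjc0 mulr0.
have [r [-> yr]] := band_row gy kb; have [r' [-> _]] := band_row gy k'b.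
have := symbol_biorth r r' ny; rewrite yr !andbT => H.
rewrite (_ : (_ == _) = (r == r')); last first.
  by rewrite (inj_eq (addrI _)) eqz_nat eq_sym.
rewrite -(_ : (r == r')%:R = if r == r' then 1 else 0 :> C); last by case: eqP.
rewrite -H; congr (_ * _); apply: eq_bigr => j _.
by rewrite dual_fourier_row// [symbol _ _ _]mxE.
Qed.

(** Both sides sum the same terms, up to one index that lies outside the band. *)
Lemma lattice_product_dual_fourier y j m : regular_point y ->
  lattice_product l h P (dual_fourier m) j y = \sum_r dual_symbol y r m * conjc (symbol y r j).
Proof.
move=> ny; have [gy _ _] := ny.
pose g (k : int) := dual_fourier m (y + k%:~R * h) * conjc (P j (y + k%:~R * h)).
have gout (k : int) : ~~ (0 <= k - a y <= n%:Z) -> g k = 0.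
  by move=> kn; rewrite /g oP ?conjc0 ?mulr0// in_band// andbA negb_and kn.
have grow (r : 'I_n.+1) : dual_symbol y r m * conjc (symbol y r j) = g (a y + r%:Z).
  by rewrite /g dual_fourier_row// [symbol _ _ _]mxE.
transitivity (\sum_(0 <= i < l + l) g (i%:Z - l%:Z)); first by rewrite big_mkord.
(* The lattice sum has 2l terms against 2l - 1 rows. The extra index is l - 1 on K_+ and -l on the
   other pieces. *)
rewrite (_ : l + l = n.+2)%N; last by move: l2; clear; rewrite /n; lia.
under [RHS]eq_bigr do rewrite grow.
rewrite -(big_mkord xpredT (fun r => g (a y + r%:Z))).
have [yp|yp] := boolP (y \in Kp).
  have aE : a y = - l%:Z by rewrite /first_index yp.
  rewrite big_nat_recr//= (gout (n.+1%:Z - l%:Z)) ?addr0; last by move: l2; rewrite aE /n; clear; lia.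
  by apply: eq_bigr => i _; rewrite aE addrC.
have aE : a y = - (l%:Z - 1) by rewrite /first_index (negPf yp).
rewrite [LHS]big_nat_recl// (gout (0%N%:Z - l%:Z)) ?add0r; last by rewrite aE; clear; lia.
by apply: eq_bigr => i _; congr g; rewrite aE; clear; lia.
Qed.

Lemma dual_fourier_reproduce y (k : int) m : regular_point y ->
  P m (y + k%:~R * h) = frame_symbol l h P (dual_fourier m) (y + k%:~R * h).
Proof.
move=> ny; have [gy _ _] := ny; have Dy := generic_D gy.
rewrite /frame_symbol (reduce_modP h0)//.
have [kb|kb] := boolP (y + k%:~R * h \in `]- omega, omega[%classic); last first.
  by rewrite oP// big1 ?mulr0// => j _; rewrite oP// mulr0.
have [r [-> yr]] := band_row gy kb.
rewrite -[LHS](_ : symbol y r m = _); last by rewrite mxE.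
rewrite -(symbol_reproduce r m ny); congr (_ * _); apply: eq_bigr => j _.
by rewrite lattice_product_dual_fourier// [symbol y r j]mxE.
Qed.

Lemma ae_reduce (Q : R -> Prop) : {ae mu, forall y, `]0, h[%classic y -> Q y} ->
  {ae mu, forall x, exists y (k : int), [/\ `]0, h[%classic y, Q y & x = y + k%:~R * h]}.
Proof.
(* The multiples of h reduce to 0, which is not in the open cell; they form a null set. *)
move=> HQ; apply: aeS2 (ae_lattice h HQ) (ae_lattice h (ae_neq 0)) => x H1 H2.
pose k := Num.floor (x / h); have := H1 (- k); have := H2 (- k).
rewrite (_ : x + (- k)%:~R * h = reduce_mod h x); last first.
  by rewrite /reduce_mod rmorphN mulNr.
move=> y0 Qy; have Dy : `]0, h[%classic (reduce_mod h x).
  rewrite /= in_itv/= lt_neqAle eq_sym y0 /= /reduce_mod subr_ge0 ltrBlDr.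
  have := floor_itv (x / h); rewrite intrD => /andP[k1 k2].
  rewrite -/k in k1 k2 *; rewrite ler_pdivlMr// in k1; rewrite ltr_pdivrMr// in k2.
  by rewrite k1/=; apply: lt_le_trans k2 _; rewrite mulrDl mul1r addrC.
exists (reduce_mod h x), k; split => //; first exact: Qy.
by rewrite /reduce_mod subrK.
Qed.

Hypothesis Hnd : {ae mu, forall y, `]0, h[%classic y -> regular_point y}.

Lemma ae_dual_fourier_biorth : {ae mu, forall x, forall k : int,
  h%:C * \sum_j dual_fourier j x * conjc (P j (x + k%:~R * h)) =
  if (k == 0) && (x \in `]- omega, omega[%classic) then 1 else 0}.
Proof.
apply: aeS (ae_reduce Hnd) => x [y [k [_ ny ->]]] k'.
have := dual_fourier_biorth k (k + k') ny.
by rewrite rmorphD/= mulrDl addrA -[X in _ == X]addr0 (inj_eq (addrI _)).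
Qed.

Lemma ae_dual_fourier_reproduce m :
  {ae mu, forall x, P m x = frame_symbol l h P (dual_fourier m) x}.
Proof.
by apply: aeS (ae_reduce Hnd) => x [y [k [_ ny ->]]]; exact: dual_fourier_reproduce.
Qed.

End Symbols.

(** * Index lists with one entry removed *)

Lemma filter_predC1_iota (p m : nat) : (p < m)%N ->
  [seq i <- iota 0 m | i != p] = iota 0 p ++ iota p.+1 (m - p.+1).
Proof.
move=> pm; have -> : iota 0 m = iota 0 p ++ p :: iota p.+1 (m - p.+1).
  by rewrite -[p :: _]/(iota p (m - p.+1).+1) -[p in iota p _]add0n -iotaD; congr iota; lia.
rewrite filter_cat /= eqxx /=; congr (_ ++ _); apply/all_filterP/allP => i;
  by rewrite mem_iota; lia.
Qed.

Lemma nth_filter_predC1_iota (p m i : nat) : (p < m)%N -> (i < m.-1)%N ->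
  nth 0%N [seq i <- iota 0 m | i != p] i = bump p i.
Proof.
move=> pm im; rewrite filter_predC1_iota// nth_cat size_iota /bump.
by case: ltnP => ip; rewrite nth_iota; lia.
Qed.

Lemma zrangeE (a : int) (m : nat) : zrange a (a + m%:Z) = [seq a + i%:Z | i <- iota 0 m.+1].
Proof. by rewrite /zrange lerDl (_ : a + m%:Z - a = m%:Z)// addrAC subrr add0r. Qed.

Lemma int_shift_eq0 (a : int) (r i : nat) : (a - (a + r%:Z) + i%:Z == 0) = (i == r).
Proof. by rewrite opprD addrA subrr add0r addrC subr_eq0 eqz_nat. Qed.

Lemma int_shiftE (a : int) (r i : nat) : a + r%:Z + (a - (a + r%:Z) + i%:Z) = a + i%:Z.
Proof. by lia. Qed.

Lemma sqX (R : realType) (z : R[i]) k : sq (z ^+ k) = sq z ^+ k.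
Proof. by elim: k => [|k IH]; rewrite ?expr0 ?sq1// !exprS sqM IH. Qed.

Section Ae.
Variable R : realType.
Local Notation mu := (@lebesgue_measure R).

Lemma ae_forall_ord N (Q : 'I_N -> R -> Prop) :
  (forall i, {ae mu, forall x, Q i x}) -> {ae mu, forall x, forall i, Q i x}.
Proof.
move=> H; pose Q' k x := if insub k is Some i then Q i x else True.
have H' k : {ae mu, forall x, Q' k x}.
  by rewrite /Q'; case: insub => [i|]; [exact: H|exact: aeW].
by apply: aeS (ae_foralln H') => x + i => /(_ i); rewrite /Q' valK.
Qed.

End Ae.

(** * The dual matrices in terms of D, E and lists of translates *)

Section Formula.
Variables (R : realType) (l : nat) (omega h : R).
Local Notation C := R[i].
Let n := (2 * l - 2)%N.
Hypotheses (l2 : (2 <= l)%N) (h0 : 0 < h).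
Local Notation Km := (Kminus l omega h).
Local Notation K := (Kzero l omega h).
Local Notation Kp := (Kplus l omega h).
Local Notation a := (first_index l omega h).

Variables (P : 'I_n.+1 -> R -> C) (F : R -> 'rV[C]_n.+1) (y : R).
Hypotheses (FP : forall (k : int) m, F (y + k%:~R * h) 0 m = P m (y + k%:~R * h))
  (Dy : `]0, h[%classic y).
Local Notation A := (symbol omega h P y).
Local Notation w2 := (\sum_m sq (nullvec omega h P y 0 m)).

Lemma preGramianE (k : int) :
  preGramian l omega h F (y + k%:~R * h) = (Num.sqrt h)%:C *: A.
Proof.
apply/matrixP => r m; rewrite /preGramian (reduce_modP h0)// !mxE.
by rewrite /tau FP.
Qed.

Let sqC : sq (Num.sqrt h)%:C = h.
Proof. by rewrite sq_real sqr_sqrtr// ltW. Qed.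

Lemma det_preGramian_sq (k : int) :
  sq (\det (preGramian l omega h F (y + k%:~R * h))) = h ^+ n.+1 * sq (\det A).
Proof.
by rewrite preGramianE detZ sqM sqX sqC.
Qed.

(** The 2l - 1 rows contribute h^(l - 1/2) to the determinant, and h^(l - 3/2) in D leaves 1/h. *)
Lemma dual_coefDE (k : int) : \det A != 0 ->
  dual_coefD l omega h F (y + k%:~R * h) = (h%:C * \det (mx_conjc A))^-1.
Proof.
move=> dA; rewrite /dual_coefD preGramianE /mx_adjoint det_tr.
rewrite (_ : mx_conjc (_ *: _) = (Num.sqrt h)%:C *: mx_conjc A); last first.
  by apply/matrixP => r m; rewrite !mxE conjcM conjc_real.
rewrite detZ.
have hC : (h%:C : C) != 0 by rewrite eq_complex /= eqxx andbT gt_eqF.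
have -> : ((Num.sqrt h)%:C ^+ n.+1 : C) = (h `^ (l%:R - 3 / 2))%:C * h%:C.
  rewrite -rmorphXn -rmorphM /=; congr (_%:C).
  (* The exponent is split into a natural number, as l >= 2, and 1/2, so that the real power becomes
     an integral power times sqrt h. *)
  have -> : l%:R - 3 / 2 = (l - 2)%:R + 2^-1 :> R by rewrite natrB//; lra.
  rewrite powRD; last by rewrite gt_eqF// implybT.
  rewrite powR_mulrn ?ltW// powR12_sqrt ?ltW//.
  rewrite (_ : n.+1 = (l - 1) * 2 + 1)%N; last by rewrite /n; lia.
  rewrite exprD expr1 mulnC exprM sqr_sqrtr ?ltW//.
  by rewrite mulrAC -exprSr; congr (_ ^+ _ * _); lia.
have pC : ((h `^ (l%:R - 3 / 2))%:C : C) != 0.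
  by rewrite eq_complex /= eqxx andbT gt_eqF// powR_gt0.
have dA' := det_conjc_neq0 dA.
by field; rewrite pC hC dA'.
Qed.

Lemma row'_preGramian (k : int) :
  preGramian_red l omega h F (y + k%:~R * h) = (Num.sqrt h)%:C *: row' ord_max A.
Proof. by apply/matrixP => r m; rewrite /preGramian_red preGramianE !mxE. Qed.

(** By [det_gram] the Gram determinant of the 2l - 2 rows is h^(2l - 2) |w|^2, and h^(2l - 3) in E
    leaves 1/h. *)
Lemma dual_coefEE (k : int) : w2 != 0 ->
  dual_coefE l omega h F (y + k%:~R * h) = (h%:C * w2%:C)^-1.
Proof.
move=> w20; rewrite /dual_coefE row'_preGramian.
rewrite (_ : mx_adjoint _ = (Num.sqrt h)%:C *: mx_adjoint (row' ord_max A)); last first.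
  by apply/matrixP => r m; rewrite !mxE conjcM conjc_real.
rewrite -scalemxAl -scalemxAr scalerA detZ det_gram//.
have -> : (Num.sqrt h)%:C * (Num.sqrt h)%:C = h%:C :> C.
  by rewrite -rmorphM /= -expr2 sqr_sqrtr// ltW.
have hC : (h%:C : C) != 0 by rewrite eq_complex /= eqxx andbT gt_eqF.
have wC : (w2%:C : C) != 0 by rewrite eq_complex /= eqxx andbT.
rewrite (_ : h%:C ^+ (2 * l - 2) = h%:C ^+ (2 * l - 3) * h%:C :> C); last first.
  by rewrite -exprSr; congr (_ ^+ _); lia.
rewrite rmorphXn /=; have hk : (h%:C ^+ (2 * l - 3) : C) != 0 by rewrite expf_neq0.
by rewrite -/w2; field; rewrite hC wC hk.
Qed.

(** Transfers the lower bound sigma on the minors to |w|^2. The power h^n comes from n rows scaled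
    by sqrt h, after squaring. *)
Lemma sum_sq_minors_symbol (k : int) : (forall m, A ord_max m = 0) ->
  sum_sq_minors n (preGramian l omega h F (y + k%:~R * h)) <=
  #|{ffun 'I_n -> 'I_n.+1}|%:R ^+ 2 * h ^+ n * w2.
Proof.
move=> A0; have n0 : (0 < n)%N by rewrite /n; lia.
apply: le_trans (sum_sq_minors_le n0 _) _.
  by move=> j; rewrite preGramianE mxE A0 mulr0.
rewrite -mulrA; apply: ler_wpM2l; first exact: sqr_ge0.
rewrite le_eqVlt mulr_sumr; apply/orP; left; apply/eqP/eq_bigr => m _.
rewrite (eq_cross (V := fun i => (Num.sqrt h)%:C *: row i (row' ord_max A))); last first.
  by move=> i; apply/rowP => j; rewrite mxE [LHS]mxE preGramianE !mxE.
by rewrite cross_scale mxE sqM sqX sqC.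
Qed.

Lemma conj_rowE (r : 'I_n.+1) :
  mx_conjc (F (y + (a y + r%:Z)%:~R * h)) = row r (mx_conjc A).
Proof. by apply/rowP => m; rewrite !mxE FP. Qed.

Lemma square_dual_formula (r : 'I_n.+1) : \det A != 0 ->
  let k := a y + r%:Z in let x := y + k%:~R * h in
  square_dual h%:C A r = ((-1) ^+ r * dual_coefD l omega h F x) *:
    cross_seq n [seq tau (j%:~R * h) (fun x => mx_conjc (F x)) x
                | j <- zrange (a y - k) (a y - k + n%:Z) & j != 0].
Proof.
move=> dA k x; rewrite /square_dual /x (dual_coefDE _ dA); congr (_ *: _).
rewrite /cross_seq; apply: eq_cross => i.
rewrite zrangeE filter_map -map_comp.
rewrite (eq_filter (a2 := fun i : nat => i != r :> nat)); last first.
  by move=> j /=; rewrite int_shift_eq0.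
have si : (i < size [seq j <- iota 0 n.+1 | j != r :> nat])%N.
  rewrite filter_predC1_iota// size_cat !size_iota; have := ltn_ord i; have := ltn_ord r; lia.
rewrite (nth_map 0%N)// nth_filter_predC1_iota//= -conj_rowE /tau.
by congr (mx_conjc (F _)); rewrite -addrA -mulrDl -rmorphD /= int_shiftE.
Qed.

Lemma nullvecE : nullvec omega h P y =
  cross_seq n [seq tau (j%:~R * h) F y | j <- zrange (a y) (a y + n%:Z - 1)].
Proof.
rewrite /cross_seq /nullvec; apply: eq_cross => i.
have n0 : (0 < n)%N by rewrite /n; lia.
rewrite (_ : a y + n%:Z - 1 = a y + n.-1%:Z); last by lia.
rewrite zrangeE -map_comp (nth_map 0%N) ?size_iota ?prednK//.
rewrite nth_iota ?prednK//; apply/rowP => m; rewrite mxE [LHS]mxE [LHS]mxE /= /tau FP.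
by rewrite /bump leqNgt ltn_ord add0n.
Qed.

(** Here too j = 0 is the row of x; it is now replaced by w. The list ends one step earlier because
    the last row of the matrix is deleted. *)
Lemma deficient_dual_formula (r : 'I_n) : w2 != 0 ->
  let k := a y + r%:Z in let x := y + k%:~R * h in
  deficient_dual h%:C (row' ord_max A) r = (- dual_coefE l omega h F x) *:
    cross_seq n [seq (if j == 0 then nullvec omega h P y
                      else tau (j%:~R * h) (fun x => mx_conjc (F x)) x)
                | j <- zrange (a y - k) (a y - k + n%:Z - 1)].
Proof.
move=> w20 k x; rewrite /deficient_dual /x (dual_coefEE _ w20); congr (_ *: _).
rewrite /cross_seq; apply: eq_cross => i.
have n0 : (0 < n)%N by exact: leq_ltn_trans (ltn_ord r).
rewrite (_ : a y - k + n%:Z - 1 = a y - k + n.-1%:Z); last by lia.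
rewrite zrangeE -map_comp (nth_map 0%N) ?size_iota ?prednK//.
rewrite nth_iota ?prednK//= add0n.
rewrite int_shift_eq0 -[_ == _ :> nat]/(i == r); case: (i == r) => //.
transitivity (row (lift ord_max i) (mx_conjc A)); first by apply/rowP => m; rewrite !mxE.
rewrite -conj_rowE /tau; congr (mx_conjc (F _)); rewrite -addrA -mulrDl -rmorphD /= int_shiftE.
by rewrite /bump leqNgt ltn_ord.
Qed.

End Formula.

(** Only the parity of the exponent matters; q absorbs the difference between the row number and the
    exponent of the theorem. *)
Lemma sign_exprz (F : fieldType) (z : int) (r : nat) (q : int) :
  z = r%:Z + 2 * q -> (-1 : F) ^ z = (-1) ^+ r.
Proof.
move=> ->; rewrite expfzDr ?oppr_eq0 ?oner_eq0// -exprz_exp -[(-1) ^ 2]/((-1) ^+ 2).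
by rewrite sqrrN expr1n exp1rz mulr1.
Qed.

(** The frame property and the existence of dual generators are concluded together with the formula,
    which therefore speaks of an existing family. The number 2l - 1 of generators is written as a
    successor, the form required by [cross]. *)
Theorem theorem4p6 (R : realType) (l : nat) (omega t0 h : R)
    (Phi : 'I_(2 * l - 2).+1 -> R -> R[i]) (delta gamma sigma eta : R) :
  let mu := @lebesgue_measure R in
  let F := fourierv Phi in
  let Fbar := fun x => mx_conjc (F x) in
  let Km := Kminus l omega h in
  let K := Kzero l omega h in
  let Kp := Kplus l omega h in
  let J := preGramian l omega h F in
  let D := dual_coefD l omega h F in
  let E := dual_coefE l omega h F in
  let W := fun x =>
    cross_seq (2 * l - 2)
      [seq tau (j%:~R * h) F x | j <- zrange (- l%:Z + 1) (l%:Z - 2)] in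
  (2 <= l)%N -> 0 < omega -> 0 < t0 -> h = 2 * pi / t0 ->
  omega / (l%:R - 1 / 2) <= h -> h < omega / (l%:R - 1) ->
  (forall j, bandlimited omega (Phi j)) ->
  0 < delta -> 0 < gamma -> 0 < sigma -> 0 < eta ->
  {ae mu, forall x, `]- omega, omega[%classic x ->
    delta <= \sum_j cabs (fourier (Phi j) x) ^+ 2 <= gamma} ->
  {ae mu, forall x, K x -> sigma <= sum_sq_minors (2 * l - 2) (J x)} ->
  {ae mu, forall x, (Km `|` Kp) x -> eta <= cabs (\det (J x))} ->
  [/\ is_frame omega t0 Phi,
      exists Phis, dual_generators omega t0 Phi Phis &
      forall Phis, dual_generators omega t0 Phi Phis ->
      [/\ forall k : int, - (l%:Z - 1) <= k <= l%:Z - 1 ->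
            {ae mu, forall x, shift_set Km (k%:~R * h) x ->
              fourierv Phis x =
                ((-1) ^ (l%:Z + 1 - k) * D x) *:
                cross_seq (2 * l - 2)
                  [seq tau (j%:~R * h) Fbar x
                  | j <- zrange (- l%:Z - k + 1) (l%:Z - k - 1) & j != 0]},
          forall k : int, - (l%:Z - 1) <= k <= l%:Z - 2 ->
            {ae mu, forall x, shift_set K (k%:~R * h) x ->
              fourierv Phis x =
                (- E x) *:
                cross_seq (2 * l - 2)
                  [seq (if j == 0 then tau (- (k%:~R * h)) W x
                        else tau (j%:~R * h) Fbar x)
                  | j <- zrange (- l%:Z - k + 1) (l%:Z - k - 2)]} &
          forall k : int, - l%:Z <= k <= l%:Z - 2 ->
            {ae mu, forall x, shift_set Kp (k%:~R * h) x ->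
              fourierv Phis x =
                ((-1) ^ (l%:Z + k) * D x) *:
                cross_seq (2 * l - 2)
                  [seq tau (j%:~R * h) Fbar x
                  | j <- zrange (- l%:Z - k) (l%:Z - 2 - k) & j != 0]}]].

Proof.
move=> mu F Fbar Km K Kp J D E W l2 o0 t00 hE h1 h2 bPhi delta0 gamma0 sigma0 eta0 HF HK HKm.
have h0 : 0 < h by rewrite hE divr_gt0// mulr_gt0// pi_gt0.
have ht : t0 = 2 * pi / h.
  rewrite hE invf_div mulrC divfK// mulf_neq0 ?pnatr_eq0// gt_eqF// pi_gt0//.
have lR : 2 <= l%:R :> R by rewrite ler_nat.
have hl1 : omega <= (l%:R - 1 / 2) * h.
  by move: h1; rewrite ler_pdivrMr ?[h * _]mulrC//; lra.
have hl2 : (l%:R - 1) * h < omega.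
  by move: h2; rewrite ltr_pdivlMr ?[h * _]mulrC//; lra.
have oh : omega < l%:R * h.
  by apply: le_lt_trans hl1 _; rewrite ltr_pM2r//; lra.
pose n := (2 * l - 2)%N.
(* Each |fourier (Phi j)|^2 is at most the sum over all generators, hence at most gamma almost
   everywhere, and clipping at gamma changes it only on a null set. *)
pose P (j : 'I_n.+1) : R -> R[i] := clip omega gamma (fourier (Phi j)).
have mFou j : cmeas (fourier (Phi j)) by have [_ [/L2E[]]] := bPhi j.
have mP j : cmeas (P j) by exact: cmeas_clip.
have Pg j x : sq (P j x) <= gamma by exact/sq_clip_le/ltW.
have oP j x : x \notin `]- omega, omega[%classic -> P j x = 0 by exact: clip_out.
have osP j : osupp omega (P j) by apply: osupp_clip => //; exact: ltW.
have PF : {ae mu, forall x, forall j, fourier (Phi j) x = P j x}.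
  have H1 := ae_forall_ord (fun j => let: And3 _ _ b := bPhi j in b).
  have H2 := aeS2 (fun x => @conj _ _) (ae_neq (- omega)) (ae_neq omega).
  apply: aeS2 (aeS2 (fun x => @conj _ _) HF H1) H2 => x [Hx H3] [x1 x2] j.
  rewrite /P /clip; have [xo|xo] := boolP (x \in `]- omega, omega[%classic).
    rewrite ifT//=; have /andP[_] := Hx (set_mem xo); apply: le_trans.
    by rewrite (bigD1 j)//= lerDl; apply: sumr_ge0 => i _; exact: sqr_ge0.
  apply: H3 => /mem_set; apply/negP; apply: contra xo; rewrite !mem_setE !in_itv/=.
  by rewrite !le_eqVlt eq_sym (negPf x1) (negPf x2).
have PhiL j : L2D setT (Phi j) by have [/L2E] := bPhi j.
have PhiE j : {ae mu, forall x, Phi j x = fourierL1inv (P j) x}.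
  (* G and P j are two versions of one transform and agree almost everywhere, so their inverse
     transforms agree at every point. *)
  have [G [cG _ FG PhiG]] := bandlimited_repr (bPhi j).
  apply: aeS PhiG => x ->; rewrite !fourierL1inv_int; congr (_ * _).
  apply: ae_eq_cint => //.
  - by apply: cmeasM; [exact: cG.1.1|exact: cmeas_cis].
  - by apply: cmeasM; [exact: mP|exact: cmeas_cis].
  - by apply: aeS2 FG PF => y FGy PFy _; rewrite -FGy PFy.
(* From |det J|^2 = h^(n + 1) |det A|^2. *)
pose eta' := eta ^+ 2 / h ^+ n.+1.
(* The constant of [sum_sq_minors_symbol]; the 1 added to it below keeps the denominator
   positive. *)
pose cn : R := #|{ffun 'I_n -> 'I_n.+1}|%:R ^+ 2 * h ^+ n.
pose sigma' := sigma / (cn + 1).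
have cn0 : 0 < cn + 1 by rewrite ltr_wpDl// mulr_ge0 ?sqr_ge0// exprn_ge0// ltW.
have eta'0 : 0 < eta' by rewrite divr_gt0 ?exprn_gt0.
have sigma'0 : 0 < sigma' by exact: divr_gt0.
have FP y (k : int) m : (forall (k : int) j, fourier (Phi j) (y + k%:~R * h) = P j (y + k%:~R * h)) ->
    F (y + k%:~R * h) 0 m = P m (y + k%:~R * h) by move=> H; rewrite mxE H.
have Hnd : {ae mu, forall y, `]0, h[%classic y -> regular_point omega h P eta' sigma' y}.
  have H := aeS2 (fun x => @conj _ _) HK HKm.
  have H' := aeS2 (fun x => @conj _ _) (ae_generic l omega h) H.
  apply: aeS2 (ae_lattice h PF) H' => y Py [gy [Ky Kmy]] Dy.
  have {}gy := gy Dy; have y0 : y = y + 0%:~R * h by rewrite mul0r addr0.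
  have Fy k m := FP y k m Py.
  split => // [yK|yK].
    have := Ky (set_mem yK); rewrite {1}/J y0 => /le_trans.
    move=> /(_ _ (sum_sq_minors_symbol l2 h0 Fy Dy 0 (fun m => symbol_last l2 h0 hl1 hl2 oP m gy yK))).
    rewrite -y0 -/cn /sigma' ler_pdivrMr// => H1; apply: le_trans H1 _.
    by rewrite mulrC; apply: ler_wpM2l; [apply: sumr_ge0 => m _; exact: sq_ge0|rewrite lerDl].
  have yKK : (Km `|` Kp) y.
    by move: gy yK; rewrite /generic => /or3P[/set_mem|->//|/set_mem]; [left|right].
  have e1 := Kmy yKK; have : eta ^+ 2 <= sq (\det (J y)).
    by rewrite /sq ler_pXn2r// ?nnegrE ?(ltW eta0)// (le_trans (ltW eta0)).
  by rewrite {1}/J y0 (det_preGramian_sq _ h0 Fy Dy) -y0 /eta' ler_pdivrMr ?exprn_gt0// mulrC.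
pose b := dual_symbol_bound l h gamma eta' sigma'.
have b0 : 0 <= b by apply: dual_symbol_bound_ge0 => //; exact: ltW.
pose Pd := dual_fourier omega h P gamma eta' sigma'.
have oPd j : osupp omega (Pd j).
  by apply: osupp_clip => //; exact: cmeas_dual_raw.
have Pdb : {ae mu, forall x, forall j, sq (Pd j x) <= b}.
  by apply: aeW => x j; exact: sq_clip_le.
have biorth := ae_dual_fourier_biorth l2 h0 hl1 hl2 Pg oP eta'0 sigma'0 Hnd.
have repro := ae_dual_fourier_reproduce l2 h0 hl1 hl2 Pg oP eta'0 sigma'0 Hnd.
split.
- exact: (is_frame_abs h0 ht o0 oh mP Pg osP PhiL PhiE Pdb biorth).
- by exists (fun m => fourierL1inv (Pd m)); exact: (dual_exists h0 ht o0 oh mP Pg osP PhiL PhiE oPd repro).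
move=> Phis dPhis.
have FPd : {ae mu, forall x, forall m, fourier (Phis m) x = Pd m x}.
  apply: ae_forall_ord => m.
  exact: (dual_unique h0 ht o0 oh mP Pg osP PhiL PhiE oPd biorth repro m dPhis).
(* Collects at almost every x all that is known on its coset x + h Z, and moves it to the
   representative y in the cell. *)
have pt : {ae mu, forall x, forall y (k : int), `]0, h[%classic y -> x = y + k%:~R * h ->
    [/\ regular_point omega h P eta' sigma' y,
        forall (k : int) m, F (y + k%:~R * h) 0 m = P m (y + k%:~R * h) &
        fourierv Phis x = \row_m Pd m x]}.
  have H := aeS2 (fun x => @conj _ _) (ae_lattice h Hnd) (ae_lattice h PF).
  apply: aeS2 FPd H => x H1 [H2 H3] y k Dy xE; split.
  - have := H2 (- k); rewrite {1 2}xE rmorphN mulNr addrK; exact.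
  - move=> k' m; apply: FP => k'' j.
    rewrite (_ : y + k''%:~R * h = x + (k'' - k)%:~R * h); first exact: H3.
    by rewrite xE rmorphB /=; ring.
  - by apply/rowP => m; rewrite !mxE H1.
(* K_- and K_+ together: they differ only in the value of [first_index]. *)
have square (y : R) (k : int) x : generic l omega h y -> y \notin K ->
    0 <= k - first_index l omega h y <= n%:Z -> x = y + k%:~R * h ->
    regular_point omega h P eta' sigma' y ->
    (forall (k : int) m, F (y + k%:~R * h) 0 m = P m (y + k%:~R * h)) ->
    \row_m Pd m x = ((-1) ^ (k - first_index l omega h y) * D x) *:
      cross_seq n [seq tau (j%:~R * h) Fbar x
        | j <- zrange (first_index l omega h y - k) (first_index l omega h y - k + n%:Z) & j != 0].
  move=> gy yK kn -> ry Fy; have Dy := generic_D h0 hl1 hl2 gy.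
  have rn : (absz (k - first_index l omega h y)%R < n.+1)%N by move: kn; clear; lia.
  have kE : k = first_index l omega h y + (Ordinal rn)%:Z by move: kn; clear; rewrite /=; lia.
  have -> : (-1 : R[i]) ^ (k - first_index l omega h y) = (-1) ^+ Ordinal rn.
    by apply: (@sign_exprz _ _ _ 0); rewrite mulr0 addr0 {1}kE addrAC subrr add0r.
  move: (Ordinal rn) kE => r kE; rewrite kE.
  transitivity (square_dual h%:C (symbol omega h P y) r).
    apply/rowP => m; rewrite mxE /Pd (dual_fourier_row l2 h0 hl1 hl2 Pg eta'0 sigma'0 r m ry).
    exact: dual_symbol_square.
  exact: (square_dual_formula l2 h0 Fy Dy r (det_symbol_neq0 eta'0 ry yK)).
split.
- move=> k k12; apply: aeS pt => x H [y /mem_set yKm /esym xE].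
  have gy : generic l omega h y by rewrite /generic yKm.
  have yKp : (y \in Kp) = false.
    by apply/negP; move: yKm; rewrite Km_itv Kp_itv => /andP[? ?] /andP[? ?]; lra.
  have yK : y \notin K.
    by apply/negP; move: yKm; rewrite Km_itv K_itv => /andP[? ?] /andP[? ?]; lra.
  have [ry Fy ->] := H y k (generic_D h0 hl1 hl2 gy) xE.
  have aE : first_index l omega h y = - (l%:Z - 1) by rewrite /first_index yKp.
  rewrite (square y k x gy yK _ xE ry Fy) aE; last first.
    by move: k12 l2; rewrite /n; clear => ? ?; lia.
  rewrite (_ : - (l%:Z - 1) - k + n%:Z = l%:Z - k - 1); last by move: l2; rewrite /n; clear; lia.
  rewrite (_ : - (l%:Z - 1) - k = - l%:Z - k + 1); last by clear; lia.
  (* On K_- the row of x is k + l - 1; it differs from the exponent l + 1 - k by 2 (1 - k). *)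
  congr ((_ * _) *: _); have kn : 0 <= k - - (l%:Z - 1) by move: k12; clear; lia.
  rewrite -[k - - (l%:Z - 1)]gez0_abs// -exprnP; apply/esym.
  by apply: (@sign_exprz _ _ _ (1 - k)); rewrite gez0_abs//; clear; lia.
- move=> k k12; apply: aeS pt => x H [y /mem_set yK /esym xE].
  have gy : generic l omega h y by rewrite /generic yK orbT.
  have yKp : (y \in Kp) = false.
    by apply/negP; move: yK; rewrite K_itv Kp_itv => /andP[? ?] /andP[? ?]; lra.
  have Dy := generic_D h0 hl1 hl2 gy; have [ry Fy ->] := H y k Dy xE.
  have aE : first_index l omega h y = - (l%:Z - 1) by rewrite /first_index yKp.
  (* k <= l - 2 makes the row k + l - 1 smaller than n = 2l - 2, so it is not the deleted last
     row. *)
  have rn : (absz (k + (l%:Z - 1))%R < n)%N by move: k12 l2; rewrite /n; clear => ? ?; lia.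
  have kE : k = first_index l omega h y + (lift ord_max (Ordinal rn))%:Z.
    by rewrite aE lift_max; move: k12; clear; rewrite /=; lia.
  transitivity (deficient_dual h%:C (row' ord_max (symbol omega h P y)) (Ordinal rn)).
    apply/rowP => m; rewrite mxE xE {1}kE /Pd (dual_fourier_row l2 h0 hl1 hl2 Pg eta'0 sigma'0 _ m ry).
    exact: dual_symbol_lift.
  rewrite (deficient_dual_formula l2 h0 Fy Dy (Ordinal rn) (nullvec_neq0 sigma'0 ry yK)).
  rewrite lift_max in kE; rewrite -kE -xE aE.
  (* x - k h = y, where W is the cross product of the rows of A other than the last. *)
  have -> : nullvec omega h P y = tau (- (k%:~R * h)) W x.
    rewrite {1}/tau xE addrK (nullvecE omega l2 h0 Fy) aE /W.
    rewrite (_ : - (l%:Z - 1) + n%:Z - 1 = l%:Z - 2); last by move: l2; rewrite /n; clear; lia.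
    by rewrite (_ : - (l%:Z - 1) = - l%:Z + 1); last by clear; lia.
  rewrite (_ : - (l%:Z - 1) - k + n%:Z - 1 = l%:Z - k - 2); last by move: l2; rewrite /n; clear; lia.
  by rewrite (_ : - (l%:Z - 1) - k = - l%:Z - k + 1); last by clear; lia.
- move=> k k12; apply: aeS pt => x H [y /mem_set yKp /esym xE].
  have gy : generic l omega h y by rewrite /generic yKp !orbT.
  have yK : y \notin K.
    by apply/negP; move: yKp; rewrite Kp_itv K_itv => /andP[? ?] /andP[? ?]; lra.
  have [ry Fy ->] := H y k (generic_D h0 hl1 hl2 gy) xE.
  have aE : first_index l omega h y = - l%:Z by rewrite /first_index yKp.
  rewrite (square y k x gy yK _ xE ry Fy) aE; last first.
    by move: k12 l2; rewrite /n; clear => ? ?; lia.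
  rewrite (_ : - l%:Z - k + n%:Z = l%:Z - 2 - k); last by move: l2; rewrite /n; clear; lia.
  by rewrite opprK addrC.
Qed.
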